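(* There is no sound and complete qualitative simulator for the class of all inputs $(M,s_0)$ such that the model $M$ has a single operating region (hence no operating region transitions) and uses only constraints of the types \emph{derivative}, \emph{add}, \emph{mult} and \emph{constant}. That is, no algorithm meets the sound-and-complete output specification (given in the context) on every such input.
   Context: **Syntax.** A (single-region) model $M$ has finitely many variables and a finite set of constraints. Each variable $X$ has a quantity space: a finite strictly increasing list of landmark symbols, each denoting a fixed but possibly unspecified extended real. The landmark $0$ denotes the number $0$. The symbols $-\infty,\infty$ may occur only as first/last landmark and are always unreachable values; a finite first or last landmark may also be declared unreachable. A quantity space may span only a part of the line, e.g. $[0,\infty)$. The qualitative magnitude of $X$ is either a reachable landmark of $X$ or an open interval between adjacent landmarks; its qualitative direction is the sign of $dX/dt$: inc ($+$), dec ($-$), std ($0$). A qualitative value is a pair $\langle\text{magnitude},\text{direction}\rangle$; a state gives a qualitative value to every variable. Constraint types: add: $X(t)+Y(t)=Z(t)$; mult: $X(t)\times Y(t)=Z(t)$; constant: $dX/dt=0$, optionally with $X$ equal to a specified landmark; derivative: $dX/dt=Y(t)$. Arguments may repeat. A constraint other than derivative may come with correspondences: tuples of landmarks of its variables required to satisfy the same relation. An input is $(M,s_0)$: a model and an initial state $s_0$ (a qualitative value for every variable at the initial time). **Semantics.** A trajectory consists of an assignment of (extended) real values to all landmarks that respects the order of each quantity space and satisfies all correspondences, together with real-valued continuously differentiable functions of time for all variables, satisfying all constraints at all times, staying within the reachable part of their quantity spaces, and having state $s_0$ at the initial time $0$ (time measured from the initial instant). The time domain is either (a) $[0,b]$ with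 $0<b\le\infty$, with finitely many changes of qualitative state, where if $b=\infty$ the values at $\infty$ are the limits of the variables and their derivatives, which must exist, be finite and reachable, and where, if $b<\infty$, at $b$ some variable is at the first (last) landmark of its quantity space with direction dec (inc), i.e. is about to leave its quantity space; or (b) $[0,\infty)$ with infinitely many changes of qualitative state, finitely many in bounded time. The behavior of a trajectory is its sequence of states: alternately the state at a time point and the state on the following open time interval on which the state stays constant. The behavior tree of an input consists of all finite prefixes of behaviors of trajectories of that input (its root is the initial state); it is empty exactly when the input has no trajectory (the initial state is inconsistent). **Sound-and-complete output specification.** On a given input the algorithm must: if the behavior tree is empty, report inconsistency in finite time; if it is nonempty and finite, print exactly the behaviors forming its branches in finite time; if it is infinite, run forever printing exactly the nodes of the tree one by one, in an order in which the root is first and no node is printed before its ancestors, so that for every $i$ the first $i$ nodes have been printed after finitely many steps. *)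

(* Defs.v *)
(* Standard-library reals with Coquelicot. *)
From Stdlib Require Import Reals List Arith Sorting.Sorted.
From Coquelicot Require Import Coquelicot.
Import ListNotations.
Open Scope R_scope.

(** * Qualitative models *)

(* Apart from the three reserved symbols, a symbol [Named k] denotes the same
   number in every quantity space in which it occurs. *)
Inductive landmark : Type :=
| MinusInf
| Zero
| PlusInf
| Named (k : nat).

(* The flags tell whether the first and the last landmark are reachable. *)
Record qspace : Type := QSpace {
  landmarks : list landmark;
  first_reachable : bool;
  last_reachable : bool
}.

Definition is_first (q : qspace) (l : landmark) : Prop :=
  exists r, landmarks q = l :: r.

Definition is_last (q : qspace) (l : landmark) : Prop :=
  exists r, landmarks q = r ++ [l].

Definition reachable (q : qspace) (l : landmark) : Prop :=
  In l (landmarks q) /\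
  (is_first q l -> first_reachable q = true) /\
  (is_last q l -> last_reachable q = true).

Definition adjacent (q : qspace) (l l' : landmark) : Prop :=
  exists r r', landmarks q = r ++ l :: l' :: r'.

Definition wf_qspace (q : qspace) : Prop :=
  landmarks q <> [] /\
  NoDup (landmarks q) /\
  (In MinusInf (landmarks q) -> is_first q MinusInf) /\
  (In PlusInf (landmarks q) -> is_last q PlusInf) /\
  ~ reachable q MinusInf /\
  ~ reachable q PlusInf.

Inductive qmag : Type :=
| At (l : landmark)
| Between (l l' : landmark).

Inductive qdir : Type := Inc | Dec | Std.

Definition qval : Type := (qmag * qdir)%type.

(* The entry at position [X] is the qualitative value of variable [X]. *)
Definition state : Type := list qval.

(* Variables are the positions in the list of quantity spaces. The last
   argument of the first three constructors lists the correspondences. *)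
Inductive constraint : Type :=
| Add (X Y Z : nat) (cs : list (landmark * landmark * landmark))
| Mult (X Y Z : nat) (cs : list (landmark * landmark * landmark))
| Constant (X : nat) (l : option landmark) (cs : list landmark)
| Derivative (X Y : nat).

Record model : Type := Model {
  qspaces : list qspace;
  constraints : list constraint
}.

Record input : Type := Input {
  input_model : model;
  initial_state : state
}.

Definition nvars (M : model) : nat := length (qspaces M).

Definition landmark_of (M : model) (X : nat) (l : landmark) : Prop :=
  exists q, nth_error (qspaces M) X = Some q /\ In l (landmarks q).

Definition wf_ternary (M : model) (X Y Z : nat)
    (cs : list (landmark * landmark * landmark)) : Prop :=
  (X < nvars M)%nat /\ (Y < nvars M)%nat /\ (Z < nvars M)%nat /\
  forall a b c, In (a, b, c) cs ->
    landmark_of M X a /\ landmark_of M Y b /\ landmark_of M Z c.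

Definition wf_constraint (M : model) (c : constraint) : Prop :=
  match c with
  | Add X Y Z cs => wf_ternary M X Y Z cs
  | Mult X Y Z cs => wf_ternary M X Y Z cs
  | Constant X l cs =>
      (X < nvars M)%nat /\
      (forall a, l = Some a -> landmark_of M X a) /\
      (forall a, In a cs -> landmark_of M X a)
  | Derivative X Y => (X < nvars M)%nat /\ (Y < nvars M)%nat
  end.

Definition wf_qmag (q : qspace) (m : qmag) : Prop :=
  match m with
  | At l => reachable q l
  | Between l l' => adjacent q l l'
  end.

Definition wf_state (M : model) (s : state) : Prop :=
  Forall2 (fun q w => wf_qmag q (fst w)) (qspaces M) s.

Definition wf_input (I : input) : Prop :=
  (forall q, In q (qspaces (input_model I)) -> wf_qspace q) /\
  (forall c, In c (constraints (input_model I)) ->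
    wf_constraint (input_model I) c) /\
  wf_state (input_model I) (initial_state I).

(** * Trajectories *)

Definition lval (v : nat -> Rbar) (l : landmark) : Rbar :=
  match l with
  | MinusInf => m_infty
  | Zero => Finite 0
  | PlusInf => p_infty
  | Named k => v k
  end.

Definition qmag_holds (v : nat -> Rbar) (m : qmag) (y : R) : Prop :=
  match m with
  | At l => Finite y = lval v l
  | Between l l' => Rbar_lt (lval v l) y /\ Rbar_lt y (lval v l')
  end.

Definition qdir_holds (w : qdir) (d : R) : Prop :=
  match w with
  | Inc => 0 < d
  | Dec => d < 0
  | Std => d = 0
  end.

Definition value_at (f : R -> R) (T : Rbar) (y : R) : Prop :=
  match T with
  | Finite t => f t = y
  | p_infty => is_lim f p_infty y
  | m_infty => False
  end.

(* [x X] and [dx X] are variable [X] and its derivative, as functions of time. *)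
Definition state_at (M : model) (v : nat -> Rbar) (x dx : nat -> R -> R)
    (T : Rbar) (s : state) : Prop :=
  wf_state M s /\
  forall X w, nth_error s X = Some w ->
    exists y d, value_at (x X) T y /\ value_at (dx X) T d /\
      qmag_holds v (fst w) y /\ qdir_holds (snd w) d.

(* [is_Rbar_plus] and [is_Rbar_mult] fail on the indeterminate forms
   oo - oo and 0 * oo. A plain [Constant] constraint relates no values, so
   correspondences on it impose nothing. *)
Definition correspondences_hold (v : nat -> Rbar) (c : constraint) : Prop :=
  match c with
  | Add _ _ _ cs => forall l1 l2 l3, In (l1, l2, l3) cs ->
      is_Rbar_plus (lval v l1) (lval v l2) (lval v l3)
  | Mult _ _ _ cs => forall l1 l2 l3, In (l1, l2, l3) cs ->
      is_Rbar_mult (lval v l1) (lval v l2) (lval v l3)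
  | Constant _ (Some l) cs => forall l1, In l1 cs -> lval v l1 = lval v l
  | Constant _ None _ => True
  | Derivative _ _ => True
  end.

Definition constraint_holds (v : nat -> Rbar) (x dx : nat -> R -> R) (t : R)
    (c : constraint) : Prop :=
  match c with
  | Add X Y Z _ => x X t + x Y t = x Z t
  | Mult X Y Z _ => x X t * x Y t = x Z t
  | Constant X l _ =>
      dx X t = 0 /\ forall a, l = Some a -> Finite (x X t) = lval v a
  | Derivative X Y => dx X t = x Y t
  end.

Definition in_reachable_part (v : nat -> Rbar) (q : qspace) (y : R) : Prop :=
  exists m, wf_qmag q m /\ qmag_holds v m y.

(* [0, b], or [0, oo) when b = oo. *)
Definition time_domain (b : Rbar) (t : R) : Prop := 0 <= t /\ Rbar_le t b.

(* The part of the definition of a trajectory common to all time domains.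
   Derivatives are taken within the time domain, hence one-sided at its ends. *)
Record is_solution (I : input) (b : Rbar) (v : nat -> Rbar)
    (x dx : nat -> R -> R) : Prop := {
  sol_order : forall q, In q (qspaces (input_model I)) ->
    StronglySorted Rbar_lt (map (lval v) (landmarks q));
  sol_correspondences : forall c, In c (constraints (input_model I)) ->
    correspondences_hold v c;
  sol_C1 : forall X t, (X < nvars (input_model I))%nat -> time_domain b t ->
    D_in (x X) (dx X) (time_domain b) t /\
    continue_in (dx X) (time_domain b) t;
  sol_constraints : forall t c, time_domain b t ->
    In c (constraints (input_model I)) -> constraint_holds v x dx t c;
  sol_reachable : forall t X q, time_domain b t ->
    nth_error (qspaces (input_model I)) X = Some q ->
    in_reachable_part v q (x X t);
  sol_initial : state_at (input_model I) v x dx (Finite 0) (initial_state I)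
}.

Definition about_to_leave (M : model) (v : nat -> Rbar) (x dx : nat -> R -> R)
    (t : R) : Prop :=
  exists X q l, nth_error (qspaces M) X = Some q /\
    Finite (x X t) = lval v l /\
    ((is_first q l /\ dx X t < 0) \/ (is_last q l /\ 0 < dx X t)).

(** * Behaviors *)

(* A behavior is indexed so that [beh (2k)] is the state at the k-th time
   point and [beh (2k+1)] the state on the open interval that follows. *)
Definition phase (M : model) (v : nat -> Rbar) (x dx : nat -> R -> R)
    (T : nat -> Rbar) (beh : nat -> state) (k : nat) : Prop :=
  Rbar_lt (T k) (T (S k)) /\
  state_at M v x dx (T k) (beh (2 * k)%nat) /\
  forall t : R, Rbar_lt (T k) t -> Rbar_lt t (T (S k)) ->
    state_at M v x dx (Finite t) (beh (2 * k + 1)%nat).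

(* Time point k+1 is a genuine one: the state is not constant around it. *)
Definition changes (beh : nat -> state) (k : nat) : Prop :=
  ~ (beh (2 * k + 1)%nat = beh (2 * k + 2)%nat /\
     beh (2 * k + 2)%nat = beh (2 * k + 3)%nat).

Definition finite_behavior (I : input) (n : nat) (beh : nat -> state) : Prop :=
  exists (v : nat -> Rbar) (x dx : nat -> R -> R) (T : nat -> Rbar),
    (0 < n)%nat /\ T 0%nat = Finite 0 /\
    is_solution I (T n) v x dx /\
    (forall k, (k < n)%nat -> phase (input_model I) v x dx T beh k) /\
    (forall k, (S k < n)%nat -> changes beh k) /\
    state_at (input_model I) v x dx (T n) (beh (2 * n)%nat) /\
    (forall b : R, T n = Finite b -> about_to_leave (input_model I) v x dx b).

Definition infinite_behavior (I : input) (beh : nat -> state) : Prop :=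
  exists (v : nat -> Rbar) (x dx : nat -> R -> R) (T : nat -> R),
    T 0%nat = 0 /\ is_lim_seq T p_infty /\
    is_solution I p_infty v x dx /\
    (forall k, phase (input_model I) v x dx (fun j => Finite (T j)) beh k) /\
    (forall k, changes beh k).

(* The nodes of the behavior tree; the parent relation removes the last state. *)
Definition node (I : input) (p : list state) : Prop :=
  exists (beh : nat -> state) (m : nat),
    p = map beh (List.seq 0 (S m)) /\
    ((exists n, finite_behavior I n beh /\ (m <= 2 * n)%nat) \/
     infinite_behavior I beh).

Definition ancestor (p p' : list state) : Prop :=
  exists r, r <> [] /\ p' = p ++ r.

(* A leaf is identified with the branch that it ends. *)
Definition leaf (I : input) (p : list state) : Prop :=
  node I p /\ forall p', node I p' -> ~ ancestor p p'.

Definition empty_tree (I : input) : Prop := forall p, ~ node I p.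

Definition finite_tree (I : input) : Prop :=
  exists L, forall p, node I p -> In p L.

(** * Algorithms *)

(* Algorithms are programs of the WHILE language over binary trees (N. D. Jones,
   Computability and Complexity from a Programming Perspective), with an
   instruction that prints a tree. *)
Inductive tree : Type :=
| Nil
| Cons (a b : tree).

Inductive expr : Type :=
| EVar (X : nat)
| ENil
| ECons (e f : expr)
| EHd (e : expr)
| ETl (e : expr).

Inductive cmd : Type :=
| Assign (X : nat) (e : expr)
| Seq (c d : cmd)
| While (e : expr) (c : cmd)
| Print (e : expr).

Definition store : Type := nat -> tree.

Definition hd_tree (a : tree) : tree :=
  match a with Nil => Nil | Cons b _ => b end.

Definition tl_tree (a : tree) : tree :=
  match a with Nil => Nil | Cons _ b => b end.

Fixpoint eval (s : store) (e : expr) : tree :=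
  match e with
  | EVar X => s X
  | ENil => Nil
  | ECons e f => Cons (eval s e) (eval s f)
  | EHd e => hd_tree (eval s e)
  | ETl e => tl_tree (eval s e)
  end.

Definition update (s : store) (X : nat) (a : tree) : store :=
  fun Y => if Nat.eqb Y X then a else s Y.

Record config : Type := Config {
  todo : list cmd;
  memory : store;
  printed : list tree
}.

Definition step (g : config) : config :=
  match todo g with
  | [] => g
  | Assign X e :: k =>
      Config k (update (memory g) X (eval (memory g) e)) (printed g)
  | Seq c d :: k => Config (c :: d :: k) (memory g) (printed g)
  | While e c :: k =>
      match eval (memory g) e with
      | Nil => Config k (memory g) (printed g)
      | Cons _ _ => Config (c :: While e c :: k) (memory g) (printed g)
      end
  | Print e :: k => Config k (memory g) (printed g ++ [eval (memory g) e])
  end.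

(* The input is in variable 0; all other variables start as [Nil]. *)
Definition start (P : cmd) (a : tree) : config :=
  Config [P] (update (fun _ => Nil) 0 a) [].

Definition run (P : cmd) (a : tree) (n : nat) : config :=
  Nat.iter n step (start P a).

Definition halts_printing (P : cmd) (a : tree) (out : list tree) : Prop :=
  exists n, todo (run P a n) = [] /\ printed (run P a n) = out.

(** * Inputs and outputs as trees *)

Definition enc_list {A : Type} (f : A -> tree) (l : list A) : tree :=
  fold_right (fun x r => Cons (f x) r) Nil l.

Definition enc_nat (n : nat) : tree := Nat.iter n (Cons Nil) Nil.

Definition enc_bool (b : bool) : tree := enc_nat (if b then 1 else 0).

Definition enc_landmark (l : landmark) : tree :=
  match l with
  | MinusInf => Cons (enc_nat 0) Nil
  | Zero => Cons (enc_nat 1) Nil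
  | PlusInf => Cons (enc_nat 2) Nil
  | Named k => Cons (enc_nat 3) (enc_nat k)
  end.

Definition enc_qspace (q : qspace) : tree :=
  Cons (enc_list enc_landmark (landmarks q))
    (Cons (enc_bool (first_reachable q)) (enc_bool (last_reachable q))).

Definition enc_triple (c : landmark * landmark * landmark) : tree :=
  let '(l1, l2, l3) := c in
  Cons (enc_landmark l1) (Cons (enc_landmark l2) (enc_landmark l3)).

Definition enc_option {A : Type} (f : A -> tree) (o : option A) : tree :=
  match o with None => Nil | Some a => Cons (f a) Nil end.

Definition enc_ternary (X Y Z : nat)
    (cs : list (landmark * landmark * landmark)) : tree :=
  Cons (enc_nat X) (Cons (enc_nat Y) (Cons (enc_nat Z) (enc_list enc_triple cs))).

Definition enc_constraint (c : constraint) : tree :=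
  match c with
  | Add X Y Z cs => Cons (enc_nat 0) (enc_ternary X Y Z cs)
  | Mult X Y Z cs => Cons (enc_nat 1) (enc_ternary X Y Z cs)
  | Constant X l cs => Cons (enc_nat 2)
      (Cons (enc_nat X)
        (Cons (enc_option enc_landmark l) (enc_list enc_landmark cs)))
  | Derivative X Y => Cons (enc_nat 3) (Cons (enc_nat X) (enc_nat Y))
  end.

Definition enc_model (M : model) : tree :=
  Cons (enc_list enc_qspace (qspaces M))
    (enc_list enc_constraint (constraints M)).

Definition enc_qmag (m : qmag) : tree :=
  match m with
  | At l => Cons (enc_nat 0) (enc_landmark l)
  | Between l l' => Cons (enc_nat 1) (Cons (enc_landmark l) (enc_landmark l'))
  end.

Definition enc_qdir (w : qdir) : tree :=
  match w with
  | Inc => enc_nat 0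
  | Dec => enc_nat 1
  | Std => enc_nat 2
  end.

Definition enc_qval (w : qval) : tree :=
  Cons (enc_qmag (fst w)) (enc_qdir (snd w)).

Definition enc_state (s : state) : tree := enc_list enc_qval s.

Definition enc_input (I : input) : tree :=
  Cons (enc_model (input_model I)) (enc_state (initial_state I)).

Definition enc_node (p : list state) : tree := enc_list enc_state p.

(* Differs from the code of every node, because nodes are nonempty. *)
Definition inconsistency_report : tree := Nil.

(** * The specification *)

Definition on_empty_tree (P : cmd) (I : input) : Prop :=
  halts_printing P (enc_input I) [inconsistency_report].

Definition on_finite_tree (P : cmd) (I : input) : Prop :=
  exists L : list (list state),
    NoDup L /\ (forall p, In p L <-> leaf I p) /\
    halts_printing P (enc_input I) (map enc_node L).

(* Each printed list is a prefix of the later ones, so the last two clauses say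
   that the sequence of all printed trees codes the enumeration [o]. *)
Definition on_infinite_tree (P : cmd) (I : input) : Prop :=
  exists o : nat -> list state,
    (forall i j, o i = o j -> i = j) /\
    (forall p, node I p <-> exists i, o i = p) /\
    o 0%nat = [initial_state I] /\
    (forall i j, ancestor (o i) (o j) -> (i < j)%nat) /\
    (forall n, exists i,
      printed (run P (enc_input I) n) = map (fun j => enc_node (o j)) (List.seq 0 i)) /\
    (forall i, exists n,
      printed (run P (enc_input I) n) = map (fun j => enc_node (o j)) (List.seq 0 i)).

Definition meets_specification (P : cmd) (I : input) : Prop :=
  (empty_tree I -> on_empty_tree P I) /\
  (~ empty_tree I -> finite_tree I -> on_finite_tree P I) /\
  (~ finite_tree I -> on_infinite_tree P I).

(* Main.v *)
From Stdlib Require Import Reals ZArith List Arith Lia Lra Psatz Sorting.Sorted.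
From Stdlib Require Import Classical FunctionalExtensionality.
From Coquelicot Require Import Coquelicot.
Require Import Defs.
Import ListNotations.
Open Scope R_scope.

(* A program that meets the specification tells whether there is a trajectory by
   whether it ever prints a tree other than [Nil]. So it suffices to build, for
   every WHILE program Q, models whose trajectories are the runs of Q that never
   print such a tree, and to diagonalize: Q first computes the code of the model
   built from Q and its own data, and then runs the given program on that code.

   A model runs Q on a clock s = sin, c = cos, defined by s' = c and c' = - s.
   Functions a, b with a b = 0 and a^2 - b^2 = s^3 vanish on complementary half
   periods, so a x' = 0 and b y' = 0 make x constant where s > 0 and y constant
   where s < 0. Requiring P(x, y) = 0 in the second quarter of each period and
   x = y in the fourth turns u_n = x(2 pi n) into a sequence with
   P(u_n, u_{n+1}) = 0. A step of Q on trees coded by positive integers is such a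
   relation once integrality can be enforced, and integrality is enforced by
   counting down to 0 in unit steps through nonnegative numbers. Data are
   loaded into the model by algebraic constraints on constant variables.

   Conversely, a sequence is realized by steps that are C^2 and piecewise
   polynomial. For all variables the signs of value and derivative have one-sided
   limits at every time, so the state changes finitely often in bounded time. *)

(** An input prescribes little more than signs: no landmark but 0 and the infinities is used. So the
    number 1 has to be obtained from x x = x, the amplitude of the clock remains an unknown A > 0,
    and the machine starts from registers that are all 0, a content that has to be told from every
    genuine configuration.

    The cube in a^2 - b^2 = s^3 is a matter of differentiability. It makes a, up to sign, the power
    3/2 of the positive part of s, which is C^1; with s in its place a would be a square root, with
    infinite slope at the zeros of s.

    Being an integer cannot be expressed by finitely many polynomial equations over the reals, even
    with guessed auxiliary reals, while the coding of trees is injective on integers only. Time is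
    the remedy: a countdown takes an unbounded number of periods, and this delay does no harm, since
    only the existence of an infinite run matters.

    The sign of a sum does not follow from the signs of its terms, so smoothness alone would not
    exclude infinitely many changes of state in bounded time; hence the piecewise polynomial
    registers. *)

(** * Positive formulas as polynomial equations *)

Inductive poly : Type :=
| PVar (i : nat)
| PAdd (p q : poly)
| PSub (p q : poly)
| PMul (p q : poly).

Fixpoint peval (r : nat -> R) (p : poly) : R :=
  match p with
  | PVar i => r i
  | PAdd p q => peval r p + peval r q
  | PSub p q => peval r p - peval r q
  | PMul p q => peval r p * peval r q
  end.

(** Negation is absent on purpose: over the reals a conjunction is a sum of squares and a
    disjunction a product, so every formula is a single polynomial equation, whereas the set of
    solutions of a negated equation need not be closed. *)
Inductive form : Type :=
| FEq (p q : poly)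
| FFalse
| FAnd (f g : form)
| FOr (f g : form).

Fixpoint sat (r : nat -> R) (f : form) : Prop :=
  match f with
  | FEq p q => peval r p = peval r q
  | FFalse => False
  | FAnd f g => sat r f /\ sat r g
  | FOr f g => sat r f \/ sat r g
  end.

(* Variables 0 and 1 of a model are the constants 0 and 1. *)
Definition pzero : poly := PVar 0.
Definition pone : poly := PVar 1.

Fixpoint poly_of (f : form) : poly :=
  match f with
  | FEq p q => PSub p q
  | FFalse => pone
  | FAnd f g =>
      PAdd (PMul (poly_of f) (poly_of f)) (PMul (poly_of g) (poly_of g))
  | FOr f g => PMul (poly_of f) (poly_of g)
  end.

Lemma peval_poly_of (r : nat -> R) (f : form) :
  r 1%nat = 1 -> peval r (poly_of f) = 0 <-> sat r f.
Proof.
  intros H1; induction f as [p q| |f IHf g IHg|f IHf g IHg]; simpl.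
  - lra.
  - lra.
  - rewrite <- IHf, <- IHg; split; intros H.
    + split; nra.
    + destruct H as [-> ->]; ring.
  - rewrite <- IHf, <- IHg; split; intros H.
    + now apply Rmult_integral.
    + destruct H as [-> | ->]; ring.
Qed.

Definition ftrue : form := FEq pzero pzero.
Definition fall (l : list form) : form := fold_right FAnd ftrue l.
Definition fany (l : list form) : form := fold_right FOr FFalse l.

Lemma sat_fall {A : Type} (r : nat -> R) (F : A -> form) (l : list A) :
  sat r (fall (map F l)) <-> forall a, In a l -> sat r (F a).
Proof.
  induction l as [|a l IH]; simpl.
  - split; [intros _ a [] | reflexivity].
  - rewrite IH; split.
    + intros [H1 H2] b [<- | Hb]; auto.
    + intros H; split; auto.
Qed.

Lemma sat_fany {A : Type} (r : nat -> R) (F : A -> form) (l : list A) :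
  sat r (fany (map F l)) <-> exists a, In a l /\ sat r (F a).
Proof.
  induction l as [|a l IH]; simpl.
  - split; [tauto | intros (a & [] & _)].
  - rewrite IH; split.
    + intros [H | (b & Hb & H)]; eauto.
    + intros (b & [<- | Hb] & H); eauto.
Qed.

Fixpoint pnat (n : nat) : poly :=
  match n with
  | O => pzero
  | S n => PAdd (pnat n) pone
  end.

Lemma peval_pnat (r : nat -> R) (n : nat) :
  r 0%nat = 0 -> r 1%nat = 1 -> peval r (pnat n) = INR n.
Proof.
  intros H0 H1; induction n as [|n IH]; simpl pnat.
  - exact H0.
  - rewrite S_INR, <- IH; simpl; now rewrite H1.
Qed.

(** * Trees as positive integers *)

(** A pairing that needs no division, so that two additions and one multiplication express it in a
    model. On positive arguments its values exceed 1, the code of [Nil]. *)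
Definition pair_code (x y : nat) : nat := (x + y) * (x + y) + y.

Fixpoint code (t : tree) : nat :=
  match t with
  | Nil => 1
  | Cons a b => pair_code (code a) (code b)
  end.

(** With s the sum of the arguments, the second argument is at most s, so the code lies between s^2
    and (s + 1)^2 - 1. This determines s, and then both arguments. *)
Lemma pair_code_inj (a b c d : nat) :
  pair_code a b = pair_code c d -> a = c /\ b = d.
Proof.
  unfold pair_code; intros H.
  destruct (lt_eq_lt_dec (a + b) (c + d)) as [[E|E]|E].
  - exfalso.
    assert ((a + b + 1) * (a + b + 1) <= (c + d) * (c + d))%nat
      by (apply Nat.mul_le_mono; lia); nia.
  - rewrite E in H; lia.
  - exfalso.
    assert ((c + d + 1) * (c + d + 1) <= (a + b) * (a + b))%nat
      by (apply Nat.mul_le_mono; lia); nia.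
Qed.

Lemma code_pos (t : tree) : (1 <= code t)%nat.
Proof.
  induction t as [|a IHa b IHb]; simpl; unfold pair_code; nia.
Qed.

Lemma code_Cons_ge_2 (a b : tree) : (2 <= code (Cons a b))%nat.
Proof.
  pose proof (code_pos a); pose proof (code_pos b).
  simpl; unfold pair_code; nia.
Qed.

(** * One step of a program as a formula *)

(** [vx j] is the copy of register [j] that holds its current content, [vy j] the copy that holds
    the next one. The odd indices in between belong to their derivatives. *)
Definition vx (j : nat) : poly := PVar (20 + 4 * j).
Definition vy (j : nat) : poly := PVar (22 + 4 * j).
Definition vdata : poly := PVar 19.

Definition ppair (p q : poly) : poly :=
  PAdd (PMul (PAdd p q) (PAdd p q)) q.

Lemma peval_ppair (r : nat -> R) (p q : poly) (a b : nat) :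
  peval r p = INR a -> peval r q = INR b ->
  peval r (ppair p q) = INR (pair_code a b).
Proof.
  intros Hp Hq; simpl; unfold pair_code.
  now rewrite Hp, Hq, plus_INR, mult_INR, plus_INR.
Qed.

Fixpoint naux (e : expr) : nat :=
  match e with
  | EVar _ | ENil => 0
  | ECons e f => naux e + naux f + 2
  | EHd e | ETl e => naux e + 2
  end.

(** The order is the one in which [eval_form] allots registers: the guesses of the subexpressions,
    then [p] and [q]. For [EHd] and [ETl] the last guess is the component that is thrown away,
    because a pair is decoded by guessing both components. *)
Fixpoint aux_vals (m : store) (e : expr) : list nat :=
  match e with
  | EVar _ | ENil => []
  | ECons e f =>
      aux_vals m e ++ aux_vals m f ++ [code (eval m e); code (eval m f)]
  | EHd e => aux_vals m e ++ [code (eval m e); code (tl_tree (eval m e))]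
  | ETl e => aux_vals m e ++ [code (eval m e); code (hd_tree (eval m e))]
  end.

Lemma length_aux_vals (m : store) (e : expr) : length (aux_vals m e) = naux e.
Proof.
  induction e; simpl; rewrite ?length_app; simpl; lia.
Qed.

(* [v] is the code of the value of [e]; the values of the subexpressions are
   guessed in the registers from [A] on. *)
Fixpoint eval_form (A : nat) (e : expr) (v : poly) : form :=
  match e with
  | EVar X => FEq v (vx (S X))
  | ENil => FEq v pone
  | ECons e f =>
      let p := vy (A + (naux e + naux f)) in
      let q := vy (A + (naux e + naux f + 1)) in
      FAnd (eval_form A e p)
        (FAnd (eval_form (A + naux e) f q) (FEq v (ppair p q)))
  | EHd e =>
      let p := vy (A + naux e) in
      let q := vy (A + (naux e + 1)) in
      FAnd (eval_form A e p)
        (FOr (FAnd (FEq p pone) (FEq v pone)) (FEq p (ppair v q)))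
  | ETl e =>
      let p := vy (A + naux e) in
      let q := vy (A + (naux e + 1)) in
      FAnd (eval_form A e p)
        (FOr (FAnd (FEq p pone) (FEq v pone)) (FEq p (ppair q v)))
  end.

Fixpoint expr_bound (e : expr) : nat :=
  match e with
  | EVar X => S X
  | ENil => 0
  | ECons e f => Nat.max (expr_bound e) (expr_bound f)
  | EHd e | ETl e => expr_bound e
  end.

Lemma pair_code_ne_1 (a b : nat) :
  (1 <= a)%nat -> (1 <= b)%nat -> pair_code a b <> 1%nat.
Proof. unfold pair_code; nia. Qed.

(** Guesses are known to be positive integers, on which [pair_code] is injective and never 1. So the
    two disjuncts for [EHd] and [ETl] separate [Nil] from [Cons] although no inequation is
    stated. *)
Lemma eval_form_sound (r : nat -> R) (m : store) (N k : nat) (y : nat -> nat)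
    (e : expr) :
  r 1%nat = 1 ->
  (forall X, (X < N)%nat -> peval r (vx (S X)) = INR (code (m X))) ->
  (forall j, (j < k)%nat -> peval r (vy j) = INR (y j) /\ (1 <= y j)%nat) ->
  (expr_bound e <= N)%nat ->
  forall A v c, (A + naux e <= k)%nat -> (1 <= c)%nat ->
  peval r v = INR c -> sat r (eval_form A e v) -> c = code (eval m e).
Proof.
  intros H1 Hx Hy; induction e as [X| |e IHe f IHf|e IHe|e IHe];
    intros HN A v c HA Hc Hv; cbn [eval_form sat naux expr_bound eval] in *.
  - rewrite Hv, Hx by lia; apply INR_eq.
  - intros H; rewrite Hv in H; simpl in H; rewrite H1 in H.
    now apply INR_eq.
  - intros (He & Hf & H).
    destruct (Hy (A + (naux e + naux f))%nat ltac:(lia)) as [Hp Hp1].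
    destruct (Hy (A + (naux e + naux f + 1))%nat ltac:(lia)) as [Hq Hq1].
    rewrite (peval_ppair r _ _ _ _ Hp Hq), Hv in H; apply INR_eq in H.
    rewrite H; simpl; f_equal.
    + eapply (IHe ltac:(lia) A); eauto; lia.
    + eapply (IHf ltac:(lia) (A + naux e)%nat); eauto; lia.
  - intros (He & H).
    destruct (Hy (A + naux e)%nat ltac:(lia)) as [Hp Hp1].
    destruct (Hy (A + (naux e + 1))%nat ltac:(lia)) as [Hq Hq1].
    assert (E : y (A + naux e)%nat = code (eval m e))
      by (eapply (IHe ltac:(lia) A); eauto; lia).
    rewrite (peval_ppair r _ _ _ _ Hv Hq), Hp, Hv in H; simpl in H.
    rewrite H1 in H; change 1 with (INR 1) in H.
    rewrite E in H; destruct (eval m e) as [|a b]; destruct H as [[H H'] | H].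
    + now apply INR_eq.
    + now apply INR_eq, eq_sym, pair_code_ne_1 in H.
    + apply INR_eq in H; now apply pair_code_ne_1 in H; try apply code_pos.
    + apply INR_eq, pair_code_inj in H; symmetry; apply H.
  - intros (He & H).
    destruct (Hy (A + naux e)%nat ltac:(lia)) as [Hp Hp1].
    destruct (Hy (A + (naux e + 1))%nat ltac:(lia)) as [Hq Hq1].
    assert (E : y (A + naux e)%nat = code (eval m e))
      by (eapply (IHe ltac:(lia) A); eauto; lia).
    rewrite (peval_ppair r _ _ _ _ Hq Hv), Hp, Hv in H; simpl in H.
    rewrite H1 in H; change 1 with (INR 1) in H.
    rewrite E in H; destruct (eval m e) as [|a b]; destruct H as [[H H'] | H].
    + now apply INR_eq.
    + now apply INR_eq, eq_sym, pair_code_ne_1 in H.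
    + apply INR_eq in H; now apply pair_code_ne_1 in H; try apply code_pos.
    + apply INR_eq, pair_code_inj in H; symmetry; apply H.
Qed.

Lemma eval_form_complete (r : nat -> R) (m : store) (N : nat) (e : expr) :
  r 1%nat = 1 ->
  (forall X, (X < N)%nat -> peval r (vx (S X)) = INR (code (m X))) ->
  (expr_bound e <= N)%nat ->
  forall A v,
  (forall i, (i < naux e)%nat ->
    peval r (vy (A + i)) = INR (nth i (aux_vals m e) 1%nat)) ->
  peval r v = INR (code (eval m e)) -> sat r (eval_form A e v).
Proof.
  intros H1 Hx; induction e as [X| |e IHe f IHf|e IHe|e IHe];
    intros HN A v Hy Hv;
    cbn [eval_form sat naux expr_bound eval aux_vals] in *.
  - rewrite Hv, Hx by lia; reflexivity.
  - rewrite Hv; simpl; now rewrite H1.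
  - assert (Hp := Hy (naux e + naux f)%nat ltac:(lia)).
    assert (Hq := Hy (naux e + naux f + 1)%nat ltac:(lia)).
    rewrite !app_nth2 in Hp, Hq; rewrite ?length_aux_vals in *; try lia.
    replace (naux e + naux f - naux e - naux f)%nat with 0%nat in Hp by lia.
    replace (naux e + naux f + 1 - naux e - naux f)%nat with 1%nat in Hq by lia.
    split; [|split].
    + apply IHe; auto; try lia.
      intros i Hi; rewrite Hy by lia.
      now rewrite app_nth1 by now rewrite length_aux_vals.
    + apply IHf; auto; try lia.
      intros i Hi; rewrite <- Nat.add_assoc, Hy by lia.
      rewrite app_nth2 by (rewrite length_aux_vals; lia).
      rewrite app_nth1; rewrite ?length_aux_vals; try lia.
      do 2 f_equal; lia.
    + rewrite (peval_ppair r _ _ _ _ Hp Hq); exact Hv.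
  - assert (Hp := Hy (naux e)%nat ltac:(lia)).
    assert (Hq := Hy (naux e + 1)%nat ltac:(lia)).
    rewrite !app_nth2 in Hp, Hq; rewrite ?length_aux_vals in *; try lia.
    replace (naux e - naux e)%nat with 0%nat in Hp by lia.
    replace (naux e + 1 - naux e)%nat with 1%nat in Hq by lia.
    split.
    + apply IHe; auto; try lia.
      intros i Hi; rewrite Hy by lia.
      now rewrite app_nth1 by now rewrite length_aux_vals.
    + rewrite (peval_ppair r _ _ _ _ Hv Hq), Hp, Hv; simpl; rewrite H1.
      destruct (eval m e); [now left | now right].
  - assert (Hp := Hy (naux e)%nat ltac:(lia)).
    assert (Hq := Hy (naux e + 1)%nat ltac:(lia)).
    rewrite !app_nth2 in Hp, Hq; rewrite ?length_aux_vals in *; try lia.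
    replace (naux e - naux e)%nat with 0%nat in Hp by lia.
    replace (naux e + 1 - naux e)%nat with 1%nat in Hq by lia.
    split.
    + apply IHe; auto; try lia.
      intros i Hi; rewrite Hy by lia.
      now rewrite app_nth1 by now rewrite length_aux_vals.
    + rewrite (peval_ppair r _ _ _ _ Hq Hv), Hp, Hv; simpl; rewrite H1.
      destruct (eval m e); [now left | now right].
Qed.

(** * Program points and the transition relation *)

Fixpoint continuations (c : cmd) (k : list cmd) : list (list cmd) :=
  (c :: k) ::
  match c with
  | Seq c d => continuations c (d :: k) ++ continuations d k
  | While e d => continuations d (c :: k)
  | _ => []
  end.

(** The empty stack is added because a halted configuration is a fixed point of [step]: the machine
    then idles forever instead of getting stuck. *)
Definition program_points (Q : cmd) : list (list cmd) := [] :: continuations Q [].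

Lemma continuations_head (c : cmd) (k : list cmd) : In (c :: k) (continuations c k).
Proof. destruct c; now left. Qed.

Lemma continuations_step (c : cmd) : forall k g,
  In (todo g) (continuations c k) ->
  In (todo (step g)) (continuations c k) \/ todo (step g) = k.
Proof.
  induction c as [X e|c IHc d IHd|e c IHc|e]; intros k [t m o] H; revert H;
    cbn [todo continuations In].
  - intros [<- | []]; now right.
  - rewrite !in_app_iff; intros [<- | [H | H]].
    + left; right; left; apply continuations_head.
    + apply (IHc _ (Config t m o)) in H as [H | ->]; auto.
      left; right; right; apply continuations_head.
    + apply (IHd _ (Config t m o)) in H as [H | ->]; auto.
  - intros [<- | H].
    + unfold step; simpl; destruct (eval m e); [now right | left; right].
      apply continuations_head.
    + apply (IHc _ (Config t m o)) in H as [H | ->]; auto.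
  - intros [<- | []]; now right.
Qed.

Lemma program_points_step (Q : cmd) (g : config) :
  In (todo g) (program_points Q) -> In (todo (step g)) (program_points Q).
Proof.
  intros [H | H].
  - left; unfold step; now rewrite <- H.
  - apply continuations_step in H as [H | ->]; [now right | now left].
Qed.

Fixpoint cmd_bound (c : cmd) : nat :=
  match c with
  | Assign X e => Nat.max (S X) (expr_bound e)
  | Seq c d => Nat.max (cmd_bound c) (cmd_bound d)
  | While e c => Nat.max (expr_bound e) (cmd_bound c)
  | Print e => expr_bound e
  end.

Definition head_bound (s : list cmd) : nat :=
  match s with
  | [] | Seq _ _ :: _ => 0
  | Assign X e :: _ => Nat.max (S X) (expr_bound e)
  | While e _ :: _ | Print e :: _ => expr_bound e
  end.

Lemma continuations_bound (c : cmd) : forall k s,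
  In s (continuations c k) -> (head_bound s <= cmd_bound c)%nat.
Proof.
  induction c as [X e|c IHc d IHd|e c IHc|e]; intros k s;
    cbn [continuations In cmd_bound].
  - intros [<- | []]; simpl; lia.
  - rewrite in_app_iff; intros [<- | [H | H]].
    + simpl; lia.
    + apply IHc in H; lia.
    + apply IHd in H; lia.
  - intros [<- | H]; [simpl; lia | apply IHc in H; lia].
  - intros [<- | []]; simpl; lia.
Qed.

Lemma program_points_bound (Q : cmd) (s : list cmd) :
  In s (program_points Q) -> (head_bound s <= cmd_bound Q)%nat.
Proof.
  intros [<- | H]; [simpl; lia | now apply continuations_bound in H].
Qed.

Lemma cmds_eq_dec (s s' : list cmd) : {s = s'} + {s <> s'}.
Proof. repeat decide equality. Defined.

Fixpoint position (s : list cmd) (L : list (list cmd)) : nat :=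
  match L with
  | [] => 0
  | x :: L => if cmds_eq_dec x s then 0 else S (position s L)
  end.

Lemma position_inj (L : list (list cmd)) (s s' : list cmd) :
  In s L -> In s' L -> position s L = position s' L -> s = s'.
Proof.
  induction L as [|x L IH]; simpl; [tauto|].
  destruct (cmds_eq_dec x s), (cmds_eq_dec x s'); subst; try easy.
  intros [] []; try easy; auto.
Qed.

(** The successor keeps program counters away from 0, the initial content of register 0, so that the
    first commit can be told from all later ones. *)
Definition pc (L : list (list cmd)) (s : list cmd) : nat := S (position s L).

(* Register 0 holds the program counter, register [S i] the code of program
   variable [i < N], and the registers from [S N] on hold guessed values. *)
Definition goto (L : list (list cmd)) (s : list cmd) : form :=
  FEq (vy 0) (pnat (pc L s)).

(** For [X = N] the exception never occurs and all program variables are kept. *)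
Definition keep_but (N X : nat) : form :=
  fall (map (fun i => if Nat.eqb i X then ftrue else FEq (vy (S i)) (vx (S i)))
    (List.seq 0 N)).

(** [While] recognizes a tree other than [Nil] by [p = q + 1] with [q] a guessed positive integer,
    an equation in place of an inequality. [Print] allows a successor only if the printed tree is
    [Nil]: this is how a forbidden output ends the run. *)
Definition instr_form (N : nat) (L : list (list cmd)) (s : list cmd) : form :=
  match s with
  | [] => FAnd (goto L []) (keep_but N N)
  | Assign X e :: k =>
      FAnd (goto L k) (FAnd (keep_but N X) (eval_form (S N) e (vy (S X))))
  | Seq c d :: k => FAnd (goto L (c :: d :: k)) (keep_but N N)
  | While e c :: k =>
      let p := vy (S N + naux e) in
      let q := vy (S N + (naux e + 1)) in
      FAnd (keep_but N N)
        (FOr (FAnd (goto L k) (eval_form (S N) e pone))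
          (FAnd (goto L (c :: s)) (FAnd (eval_form (S N) e p) (FEq p (PAdd q pone)))))
  | Print e :: k =>
      FAnd (goto L k) (FAnd (keep_but N N) (eval_form (S N) e pone))
  end.

Definition instr_naux (s : list cmd) : nat :=
  match s with
  | Assign _ e :: _ | Print e :: _ => naux e
  | While e _ :: _ => naux e + 2
  | _ => 0
  end.

(** Every guess must be positive, hence the maximum with 1: for [v = 1] there is no positive
    predecessor, and the first disjunct of the [While] formula applies instead. *)
Definition instr_aux (g : config) : list nat :=
  match todo g with
  | Assign _ e :: _ | Print e :: _ => aux_vals (memory g) e
  | While e _ :: _ =>
      let v := code (eval (memory g) e) in
      aux_vals (memory g) e ++ [v; Nat.max 1 (v - 1)]
  | _ => []
  end.

Lemma aux_vals_pos (m : store) (e : expr) (c : nat) :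
  In c (aux_vals m e) -> (1 <= c)%nat.
Proof.
  induction e; simpl; rewrite ?in_app_iff; simpl; intros H;
    repeat destruct H as [H | H]; auto; subst; try apply code_pos; tauto.
Qed.

Lemma instr_aux_pos (g : config) (i : nat) : (1 <= nth i (instr_aux g) 1)%nat.
Proof.
  destruct (nth_in_or_default i (instr_aux g) 1%nat) as [H | ->]; [|lia].
  revert H; generalize (nth i (instr_aux g) 1%nat) as c; intros c.
  unfold instr_aux; destruct (todo g) as [|[] k]; cbn [In]; try tauto;
    rewrite ?in_app_iff; cbn [In]; intros H; try (now apply aux_vals_pos in H).
  destruct H as [H | [<- | [<- | []]]]; [now apply aux_vals_pos in H | apply code_pos | lia].
Qed.

Definition prints_nonnil (g : config) : Prop :=
  match todo g with
  | Print e :: _ => eval (memory g) e <> Nil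
  | _ => False
  end.

Definition represents (N : nat) (L : list (list cmd)) (g : config) (u : nat -> R) : Prop :=
  u 0%nat = INR (pc L (todo g)) /\
  forall i, (i < N)%nat -> u (S i) = INR (code (memory g i)).

Definition step_form (N : nat) (L : list (list cmd)) : form :=
  fany (map (fun s => FAnd (FEq (vx 0) (pnat (pc L s))) (instr_form N L s)) L).

Lemma sat_keep_but (r : nat -> R) (N X : nat) :
  sat r (keep_but N X) <->
  forall i, (i < N)%nat -> i <> X -> peval r (vy (S i)) = peval r (vx (S i)).
Proof.
  unfold keep_but; rewrite sat_fall; split; intros H i Hi.
  - intros HX; specialize (H i); rewrite in_seq in H.
    rewrite (proj2 (Nat.eqb_neq i X) HX) in H; apply H; lia.
  - rewrite in_seq in Hi; destruct (Nat.eqb_spec i X); [reflexivity|].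
    apply H; auto; lia.
Qed.

(** As [position] is injective on the program points, only the disjunct of the current stack can
    hold; the rest is the soundness of [eval_form]. *)
Lemma step_form_sound (r : nat -> R) (N k : nat) (L : list (list cmd))
    (y : nat -> nat) (g : config) :
  r 0%nat = 0 -> r 1%nat = 1 ->
  In (todo g) L -> (head_bound (todo g) <= N)%nat ->
  (S N + instr_naux (todo g) <= k)%nat ->
  represents N L g (fun j => peval r (vx j)) ->
  (forall j, (j < k)%nat -> peval r (vy j) = INR (y j) /\ (1 <= y j)%nat) ->
  sat r (step_form N L) ->
  ~ prints_nonnil g /\ represents N L (step g) (fun j => peval r (vy j)).
Proof.
  intros H0 H1 Hg Hb Hk [Hpc Hm] Hy Hs.
  apply sat_fany in Hs as (s & Hin & Hs & Hi); cbn [sat] in Hs.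
  rewrite Hpc, peval_pnat in Hs by auto; apply INR_eq in Hs.
  unfold pc in Hs; apply eq_add_S, position_inj in Hs; auto; subst s.
  destruct g as [t m o]; unfold prints_nonnil, represents, step;
    cbn [todo memory] in *.
  assert (Hone : peval r pone = INR 1) by exact H1.
  destruct t as [|[X e|c d|e c|e] t]; cbn [instr_form sat head_bound instr_naux] in *;
    unfold goto in Hi; cbn [sat] in Hi; rewrite ?peval_pnat, ?sat_keep_but in Hi by auto;
    cbn [todo memory].
  - destruct Hi as [Hp Hv]; split; [tauto|]; split; [exact Hp|].
    intros i Hi; rewrite Hv by lia; auto.
  - destruct Hi as (Hp & Hv & He); split; [tauto|]; split; [exact Hp|].
    intros i Hi; unfold update; destruct (Nat.eqb_spec i X) as [->|HX].
    + destruct (Hy (S X) ltac:(lia)) as [HX HX1]; rewrite HX; f_equal.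
      eapply eval_form_sound with (k := k); eauto; lia.
    + rewrite Hv by lia; auto.
  - destruct Hi as [Hp Hv]; split; [tauto|]; split; [exact Hp|].
    intros i Hi; rewrite Hv by lia; auto.
  - destruct Hi as [Hv Hi]; split; [tauto|].
    assert (Hv' : forall i, (i < N)%nat -> peval r (vy (S i)) = INR (code (m i)))
      by (intros i Hi'; rewrite Hv by lia; auto).
    destruct Hi as [[Hp He] | (Hp & He & Hpq)].
    + apply (eval_form_sound r m N k y) with (c := 1%nat) in He; auto; try lia.
      destruct (eval m e) as [|a b]; [now split|].
      pose proof (code_Cons_ge_2 a b); lia.
    + destruct (Hy (S N + naux e)%nat ltac:(lia)) as [Hyp Hyp1].
      destruct (Hy (S N + (naux e + 1))%nat ltac:(lia)) as [Hyq Hyq1].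
      change (peval r (vy (S N + naux e)) =
        peval r (vy (S N + (naux e + 1))) + r 1%nat) in Hpq.
      rewrite H1, Hyp, Hyq in Hpq.
      rewrite <- S_INR in Hpq; apply INR_eq in Hpq.
      apply (eval_form_sound r m N k y) with (c := y (S N + naux e)%nat) in He;
        auto; try lia.
      destruct (eval m e) as [|a b]; [|now split].
      change (code Nil) with 1%nat in He; lia.
  - destruct Hi as (Hp & Hv & He).
    apply (eval_form_sound r m N k y) with (c := 1%nat) in He; auto; try lia.
    destruct (eval m e) as [|a b]; [|pose proof (code_Cons_ge_2 a b); lia].
    split; [congruence|]; split; [exact Hp|].
    intros i Hi; rewrite Hv by lia; auto.
Qed.

Lemma step_form_complete (r : nat -> R) (N : nat) (L : list (list cmd)) (g : config) :
  r 0%nat = 0 -> r 1%nat = 1 ->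
  In (todo g) L -> (head_bound (todo g) <= N)%nat ->
  represents N L g (fun j => peval r (vx j)) ->
  represents N L (step g) (fun j => peval r (vy j)) ->
  (forall i, (i < instr_naux (todo g))%nat ->
    peval r (vy (S N + i)) = INR (nth i (instr_aux g) 1%nat)) ->
  ~ prints_nonnil g -> sat r (step_form N L).
Proof.
  intros H0 H1 Hg Hb [Hpc Hm] Hy Ha Hn.
  apply sat_fany; exists (todo g); split; [exact Hg|].
  split; cbn [sat].
  { now rewrite Hpc, peval_pnat. }
  destruct g as [t m o]; unfold prints_nonnil, represents, step, instr_aux in *;
    cbn [todo memory] in *.
  assert (Hone : peval r pone = INR 1) by exact H1.
  destruct t as [|[X e|c d|e c|e] t]; cbn [instr_form sat head_bound instr_naux] in *;
    unfold goto; cbn [sat]; rewrite ?peval_pnat, ?sat_keep_but by auto;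
    cbn [todo memory] in Hy.
  - destruct Hy as [Hp Hv]; split; [exact Hp|].
    intros i Hi _; rewrite Hv, Hm; auto.
  - destruct Hy as [Hp Hv]; split; [exact Hp|]; split.
    + intros i Hi HX; rewrite Hv, Hm by auto; unfold update.
      now rewrite (proj2 (Nat.eqb_neq i X) HX).
    + apply eval_form_complete with (m := m) (N := N); auto; try lia.
      rewrite Hv by lia; unfold update; now rewrite Nat.eqb_refl.
  - destruct Hy as [Hp Hv]; split; [exact Hp|].
    intros i Hi _; rewrite Hv, Hm; auto.
  - assert (Haux : forall i, (i < naux e)%nat ->
      peval r (vy (S N + i)) = INR (nth i (aux_vals m e) 1%nat)).
    { intros i Hi; rewrite Ha by lia.
      now rewrite app_nth1 by now rewrite length_aux_vals. }
    assert (Hp := Ha (naux e) ltac:(lia)).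
    assert (Hq := Ha (naux e + 1)%nat ltac:(lia)).
    rewrite !app_nth2 in Hp, Hq; rewrite ?length_aux_vals in *; try lia.
    replace (naux e - naux e)%nat with 0%nat in Hp by lia.
    replace (naux e + 1 - naux e)%nat with 1%nat in Hq by lia.
    cbn [nth] in Hp, Hq.
    split.
    { intros i Hi _; rewrite Hm by auto.
      destruct (eval m e); cbn [memory] in Hy; now apply Hy. }
    destruct (eval m e) as [|a b] eqn:E; [left | right].
    + split; [apply Hy|].
      apply eval_form_complete with (m := m) (N := N); auto; try lia.
      now rewrite E.
    + split; [apply Hy|]; split.
      * apply eval_form_complete with (m := m) (N := N); auto; try lia.
        now rewrite E.
      * pose proof (code_Cons_ge_2 a b).
        change (peval r (vy (S N + naux e)) = peval r (vy (S N + (naux e + 1))) + r 1%nat).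
        rewrite Hp, Hq, H1, <- S_INR; f_equal; lia.
  - destruct Hy as [Hp Hv]; split; [exact Hp|]; split.
    + intros i Hi _; rewrite Hv, Hm; auto.
    + apply eval_form_complete with (m := m) (N := N); auto; try lia.
      destruct (eval m e) eqn:E; [exact Hone|].
      exfalso; apply Hn; congruence.
Qed.

(** * Start, commit and countdown *)

Fixpoint psum (f : nat -> R) (n : nat) : R :=
  match n with
  | O => 0
  | S n => psum f n + f n
  end.

Lemma psum_ext (f g : nat -> R) (n : nat) :
  (forall i, (i < n)%nat -> f i = g i) -> psum f n = psum g n.
Proof.
  induction n as [|n IH]; simpl; intros H; [reflexivity|].
  rewrite IH, H; auto.
Qed.

Lemma psum_decr (f g : nat -> R) (n j : nat) :
  (j < n)%nat -> g j = f j - 1 ->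
  (forall i, (i < n)%nat -> i <> j -> g i = f i) -> psum g n = psum f n - 1.
Proof.
  induction n as [|n IH]; simpl; intros Hj Hg H; [lia|].
  destruct (Nat.eq_dec j n) as [->|Hn].
  - rewrite Hg, (psum_ext g f) by (intros; apply H; lia); ring.
  - rewrite IH, (H n); auto; try lia; ring.
Qed.

Lemma psum_nonneg (f : nat -> R) (n : nat) :
  (forall i, 0 <= f i) -> 0 <= psum f n.
Proof.
  intros H; induction n as [|n IH]; simpl; [lra|].
  specialize (H n); lra.
Qed.

(** The guard on register 0 can hold only before the first commit. Register 1, for program variable
    0, receives the data, the other program variables the code 1 of [Nil], as in [start]. *)
Definition start_form (N : nat) (L : list (list cmd)) (Q : cmd) : form :=
  FAnd (FEq (vx 0) pzero)
    (FAnd (goto L [Q])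
      (FAnd (FEq (vy 1) vdata)
        (fall (map (fun i => FEq (vy (S i)) pone) (List.seq 1 (N - 1)))))).

Lemma start_form_sound (r : nat -> R) (N : nat) (Q : cmd) (a : tree) :
  let L := program_points Q in
  r 0%nat = 0 -> r 1%nat = 1 -> r 19%nat = INR (code a) ->
  sat r (start_form N L Q) ->
  represents N L (run Q a 0) (fun j => peval r (vy j)).
Proof.
  intros L H0 H1 HK (_ & Hpc & Hd & Hv); split.
  - unfold goto in Hpc; cbn [sat] in Hpc; now rewrite peval_pnat in Hpc.
  - intros [|i] Hi.
    + etransitivity; [apply Hd | apply HK].
    + rewrite sat_fall in Hv.
      specialize (Hv (S i)); rewrite in_seq in Hv.
      etransitivity; [apply Hv; lia | apply H1].
Qed.

Lemma start_form_complete (r : nat -> R) (N : nat) (Q : cmd) (a : tree) :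
  let L := program_points Q in
  (1 <= N)%nat ->
  r 0%nat = 0 -> r 1%nat = 1 -> r 19%nat = INR (code a) ->
  peval r (vx 0) = 0 ->
  represents N L (run Q a 0) (fun j => peval r (vy j)) ->
  sat r (start_form N L Q).
Proof.
  intros L HN H0 H1 HK Hx [Hpc Hv]; split; [|split; [|split]].
  - exact (eq_trans Hx (eq_sym H0)).
  - unfold goto; cbn [sat]; now rewrite peval_pnat.
  - etransitivity; [apply (Hv 0%nat HN) | now symmetry].
  - apply sat_fall; intros [|i]; rewrite in_seq; intros Hi; [lia|].
    etransitivity; [apply Hv; lia | now symmetry].
Qed.

(* Registers [k + j] count down; a new vector of registers [j < k] is accepted
   only after all counters, started at its entries minus 1 and kept as squares,
   have reached 0 in unit steps. This forces the entries to be positive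
   integers. *)
Definition commit_form (k : nat) (f : form) : form :=
  FAnd (fall (map (fun j => FEq (vx (k + j)) pzero) (List.seq 0 k)))
    (FAnd
      (fall (map (fun j => FEq (vy j) (PAdd (PMul (vy (k + j)) (vy (k + j))) pone))
        (List.seq 0 k)))
      f).

Definition tick_form (k : nat) : form :=
  FAnd (fall (map (fun j => FEq (vy j) (vx j)) (List.seq 0 k)))
    (fany (map (fun j =>
      FAnd
        (FEq (PMul (vx (k + j)) (vx (k + j)))
          (PAdd (PMul (vy (k + j)) (vy (k + j))) pone))
        (fall (map (fun i =>
          if Nat.eqb i j then ftrue else FEq (vy (k + i)) (vx (k + i)))
          (List.seq 0 k)))) (List.seq 0 k))).

Lemma sat_commit_form (r : nat -> R) (k : nat) (f : form) :
  r 0%nat = 0 -> r 1%nat = 1 ->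
  sat r (commit_form k f) <->
  (forall j, (j < k)%nat -> peval r (vx (k + j)) = 0) /\
  (forall j, (j < k)%nat -> peval r (vy j) = peval r (vy (k + j)) ^ 2 + 1) /\
  sat r f.
Proof.
  intros H0 H1; unfold commit_form; cbn [sat]; rewrite !sat_fall.
  split; intros (Ha & Hb & Hf); split; [|split| |split]; auto; intros j Hj.
  - etransitivity; [apply Ha; apply in_seq; lia | exact H0].
  - etransitivity; [apply Hb; apply in_seq; lia |].
    cbn [peval pone]; rewrite H1; ring.
  - apply in_seq in Hj; etransitivity; [apply Ha; lia | now symmetry].
  - apply in_seq in Hj; cbn [sat]; rewrite Hb by lia.
    cbn [peval pone]; rewrite H1; ring.
Qed.

Lemma sat_tick_form (r : nat -> R) (k : nat) :
  r 1%nat = 1 ->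
  sat r (tick_form k) <->
  (forall j, (j < k)%nat -> peval r (vy j) = peval r (vx j)) /\
  exists j, (j < k)%nat /\
    peval r (vx (k + j)) ^ 2 = peval r (vy (k + j)) ^ 2 + 1 /\
    forall i, (i < k)%nat -> i <> j -> peval r (vy (k + i)) = peval r (vx (k + i)).
Proof.
  intros H1; unfold tick_form; cbn [sat]; rewrite !sat_fall, sat_fany.
  split; intros (Ha & j & Hj & Hb).
  - split; [intros i Hi; apply Ha, in_seq; lia|].
    apply in_seq in Hj; exists j; split; [lia|].
    destruct Hb as [Hb Hc]; rewrite sat_fall in Hc; split.
    + cbn [peval pone sat] in Hb; rewrite H1 in Hb; simpl in *; lra.
    + intros i Hi Hn; specialize (Hc i ltac:(apply in_seq; lia)).
      now rewrite (proj2 (Nat.eqb_neq i j) Hn) in Hc.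
  - split; [intros i Hi; apply in_seq in Hi; apply Ha; lia|].
    exists j; split; [apply in_seq; lia|].
    destruct Hb as [Hb Hc]; split.
    + cbn [peval pone sat]; rewrite H1; simpl in *; lra.
    + rewrite sat_fall; intros i Hi; apply in_seq in Hi.
      destruct (Nat.eqb_spec i j) as [|Hn]; [reflexivity|].
      apply Hc; auto; lia.
Qed.

(** * The machine relation and its solutions *)

(** The successor guarantees a register for program variable 0, which receives the data, even if the
    program does not mention it. *)
Definition nprog (Q : cmd) : nat := S (cmd_bound Q).

Definition nvals (Q : cmd) : nat :=
  (S (nprog Q) + list_max (map instr_naux (program_points Q)))%nat.

Definition machine_form (Q : cmd) : form :=
  let L := program_points Q in
  FOr (commit_form (nvals Q) (FOr (start_form (nprog Q) L Q) (step_form (nprog Q) L)))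
    (tick_form (nvals Q)).

Lemma run_S (Q : cmd) (a : tree) (n : nat) : run Q a (S n) = step (run Q a n).
Proof. reflexivity. Qed.

Lemma run_program_points (Q : cmd) (a : tree) (n : nat) :
  In (todo (run Q a n)) (program_points Q).
Proof.
  induction n as [|n IH]; [right; apply continuations_head|].
  rewrite run_S; now apply program_points_step.
Qed.

Lemma nvals_bound (Q : cmd) (s : list cmd) :
  In s (program_points Q) -> (S (nprog Q) + instr_naux s <= nvals Q)%nat.
Proof.
  intros H; unfold nvals; apply Nat.add_le_mono_l.
  pose proof (proj1 (list_max_le (map instr_naux (program_points Q)) _) (le_n _)) as F.
  rewrite Forall_forall in F; apply F, in_map, H.
Qed.

Lemma head_bound_nprog (Q : cmd) (s : list cmd) :
  In s (program_points Q) -> (head_bound s <= nprog Q)%nat.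
Proof. intros H; apply program_points_bound in H; unfold nprog; lia. Qed.

(** Only commits matter: ticks leave the first [k] registers alone, and there cannot be infinitely
    many of them in a row. Each commit carries the represented run one step further, with entries
    that are positive integers. *)
Lemma machine_form_sound (Q : cmd) (a : tree) (rho : nat -> nat -> R) :
  let k := nvals Q in
  (forall n, rho n 0%nat = 0 /\ rho n 1%nat = 1 /\ rho n 19%nat = INR (code a)) ->
  (forall n j, (j < 2 * k)%nat -> rho n (22 + 4 * j)%nat = rho (S n) (20 + 4 * j)%nat) ->
  (forall j, (j < 2 * k)%nat -> rho 0%nat (20 + 4 * j)%nat = 0) ->
  (forall n, sat (rho n) (machine_form Q)) ->
  forall i, ~ prints_nonnil (run Q a i).
Proof.
  intros k; assert (Ek : nvals Q = k) by reflexivity; clearbody k.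
  intros Hc Hy Hz Hs; unfold machine_form in Hs; rewrite Ek in Hs.
  set (z n j := peval (rho n) (vx j)).
  assert (Hyz : forall n j, (j < 2 * k)%nat -> peval (rho n) (vy j) = z (S n) j)
    by (intros; now apply Hy).
  set (f := FOr (start_form (nprog Q) (program_points Q) Q)
    (step_form (nprog Q) (program_points Q))).
  (* Induction on a bound for the sum of the squared counters. It is nonnegative and every tick
     lowers it by 1, so a commit must follow; there the counters are 0, and back through the ticks
     every square is a natural number. *)
  assert (Htick : forall M n, psum (fun j => z n (k + j)%nat ^ 2) k < INR M ->
    exists n', (forall j, (j < k)%nat -> z n' j = z n j) /\
      sat (rho n') (commit_form k f) /\
      forall j, (j < k)%nat -> exists c, z n (k + j)%nat ^ 2 = INR c).
  { induction M as [|M IH]; intros n HM.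
    - pose proof (psum_nonneg (fun j => z n (k + j)%nat ^ 2) k
        ltac:(intros; apply pow2_ge_0)); change (INR 0) with 0 in HM; lra.
    - destruct (Hc n) as (H0 & H1 & _).
      destruct (Hs n) as [H | H].
      + exists n; split; [auto|]; split; [exact H|].
        intros j Hj; exists 0%nat.
        apply sat_commit_form in H as (H & _); auto.
        unfold z; rewrite H by auto; simpl; ring.
      + apply sat_tick_form in H as (Ha & j & Hj & Hb & Hd); auto.
        assert (Hd' : forall i, (i < k)%nat -> i <> j ->
          z (S n) (k + i)%nat = z n (k + i)%nat).
        { intros i Hi Hn; rewrite <- Hyz by lia; now apply Hd. }
        rewrite Hyz in Hb by lia; fold (z n (k + j)%nat) in Hb.
        destruct (IH (S n)) as (n' & Hw & Hcom & Hnat).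
        { rewrite (psum_decr (fun j => z n (k + j)%nat ^ 2) _ k j Hj).
          - rewrite S_INR in HM; lra.
          - lra.
          - intros i Hi Hn; now rewrite Hd'. }
        exists n'; split; [|split; [exact Hcom|]].
        * intros i Hi; rewrite Hw, <- Hyz by lia; apply Ha; auto.
        * intros i Hi; destruct (Hnat i Hi) as [c Hc'].
          destruct (Nat.eq_dec i j) as [->|Hn].
          -- exists (S c); rewrite S_INR; lra.
          -- exists c; now rewrite <- Hd'. }
  assert (Hcommit : forall n, exists n',
    (forall j, (j < k)%nat -> z n' j = z n j) /\ sat (rho n') f /\
    exists y : nat -> nat, forall j, (j < k)%nat ->
      peval (rho n') (vy j) = INR (y j) /\ (1 <= y j)%nat).
  { intros n.
    (* Two countdowns are involved. The first leads to a commit at [n']; the second, started right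
       after it, shows that the counters set by this commit have integral squares, hence that its
       new entries are integers. *)
    destruct (INR_unbounded (psum (fun j => z n (k + j)%nat ^ 2) k)) as [M HM].
    destruct (Htick M n HM) as (n' & Hw & Hcom & _).
    destruct (INR_unbounded (psum (fun j => z (S n') (k + j)%nat ^ 2) k)) as [M' HM'].
    destruct (Htick M' (S n') HM') as (_ & _ & _ & Hnat).
    destruct (Hc n') as (H0 & H1 & _).
    apply sat_commit_form in Hcom as (_ & Hyc & Hf); auto.
    exists n'; split; [exact Hw|]; split; [exact Hf|].
    (* For a natural number c, [up] yields c + 1. This gives the function [y] explicitly, without
       choosing an integer for every [j]. *)
    exists (fun j => S (Z.to_nat (up (z (S n') (k + j)%nat ^ 2) - 1))).
    intros j Hj; split; [|lia].
    rewrite Hyc, Hyz by lia; destruct (Hnat j Hj) as [c Hc'].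
    rewrite S_INR, Hc'; do 2 f_equal.
    rewrite <- (tech_up (INR c) (Z.of_nat c + 1)).
    - now rewrite Z.add_simpl_r, Nat2Z.id.
    - rewrite plus_IZR, <- INR_IZR_INZ; lra.
    - rewrite plus_IZR, <- INR_IZR_INZ; lra. }
  assert (Hpos : forall s, 0 < INR (pc (program_points Q) s))
    by (intros s; apply lt_0_INR; unfold pc; lia).
  set (rep i u := represents (nprog Q) (program_points Q) (run Q a i) u).
  assert (Hstep : forall n i, rep i (z n) ->
    ~ prints_nonnil (run Q a i) /\ exists n', rep (S i) (z n')).
  { intros n i [Hpc Hm].
    destruct (Hcommit n) as (n' & Hw & Hf & y & Hy').
    destruct (Hc n') as (H0 & H1 & HK).
    pose proof (nvals_bound Q _ (run_program_points Q a i)); rewrite Ek in *.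
    assert (Hx : rep i (z n')).
    { split.
      - rewrite Hw; [exact Hpc | lia].
      - intros j Hj; rewrite Hw; [now apply Hm | lia]. }
    destruct Hf as [(Hst & _) | Hf].
    (* A restart would need register 0 to be 0, but it holds a program counter. *)
    - exfalso; cbn [sat] in Hst; destruct Hx as [Hx _].
      specialize (Hpos (todo (run Q a i))); unfold z in Hx.
      rewrite Hst in Hx; cbn [peval pzero] in Hx; lra.
    - apply (step_form_sound _ (nprog Q) k _ y (run Q a i)) in Hf as [Hn Hr]; auto.
      + split; [exact Hn|]; exists (S n').
        destruct Hr as [Hr1 Hr2]; split.
        * rewrite <- Hyz by (lia); exact Hr1.
        * intros j Hj; rewrite <- Hyz by (lia); now apply Hr2.
      + apply run_program_points.
      + apply head_bound_nprog, run_program_points. }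
  assert (Hrep : forall i, exists n, rep i (z n)).
  { induction i as [|i [n Hn]].
    - destruct (Hcommit 0%nat) as (n' & Hw & Hf & _).
      destruct (Hc n') as (H0 & H1 & HK).
      pose proof (nvals_bound Q _ (run_program_points Q a 0)); rewrite Ek in *.
      assert (Hx : peval (rho n') (vx 0) = 0).
      { fold (z n' 0%nat); rewrite Hw by (lia).
        apply Hz; lia. }
      destruct Hf as [Hst | Hf].
      + apply (start_form_sound _ _ _ a) in Hst as [Hr1 Hr2]; auto.
        exists (S n'); split.
        * rewrite <- Hyz by (lia); exact Hr1.
        * intros j Hj; rewrite <- Hyz by (lia); now apply Hr2.
      + exfalso; apply sat_fany in Hf as (s & _ & Hs' & _); cbn [sat] in Hs'.
        rewrite Hx, peval_pnat in Hs' by auto; specialize (Hpos s); lra.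
    - now apply Hstep in Hn. }
  intros i; destruct (Hrep i) as [n Hn]; now apply Hstep in Hn.
Qed.

(** Row 0 is the initial content, row [S i] belongs to configuration [i]. Its last entries are the
    guesses that justify the step leading to this configuration, so they come from the preceding
    one; the first commit has no such step and takes the default 1. *)
Definition register_vals (Q : cmd) (a : tree) (i j : nat) : nat :=
  match i, j with
  | O, _ => 0
  | S i, O => pc (program_points Q) (todo (run Q a i))
  | S i, S j =>
      if Nat.ltb j (nprog Q) then code (memory (run Q a i) j)
      else match i with
           | O => 1
           | S i => nth (j - nprog Q) (instr_aux (run Q a i)) 1%nat
           end
  end.

Lemma register_vals_pos (Q : cmd) (a : tree) (i j : nat) :
  (1 <= register_vals Q a (S i) j)%nat.
Proof.
  destruct j as [|j]; cbn [register_vals]; [unfold pc; lia|].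
  destruct (Nat.ltb_spec j (nprog Q)); [apply code_pos|].
  destruct i; [lia | apply instr_aux_pos].
Qed.

Lemma register_vals_represents (Q : cmd) (a : tree) (i : nat) (u : nat -> R) :
  (forall j, (j < nvals Q)%nat -> u j = INR (register_vals Q a (S i) j)) ->
  represents (nprog Q) (program_points Q) (run Q a i) u.
Proof.
  pose proof (nvals_bound Q _ (run_program_points Q a i)).
  intros Hu; split.
  - rewrite Hu by lia; reflexivity.
  - intros j Hj; rewrite Hu by lia; simpl.
    now rewrite (proj2 (Nat.ltb_lt _ _) Hj).
Qed.

(* The state is the number of commits so far and the counters. *)
Definition next_counters (Q : cmd) (a : tree) (p : nat * (nat -> nat)) :
    nat * (nat -> nat) :=
  let (i, c) := p in
  match find (fun j => Nat.ltb 0 (c j)) (List.seq 0 (nvals Q)) with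
  | Some j => (i, fun l => if Nat.eqb l j then pred (c l) else c l)
  | None => (S i, fun j => pred (register_vals Q a (S i) j))
  end.

(** The run is stretched by full countdowns: [next_counters] lowers the first positive counter, and
    commits when none is left. *)
Lemma machine_form_complete (Q : cmd) (a : tree) :
  let k := nvals Q in
  (forall i, ~ prints_nonnil (run Q a i)) ->
  exists z : nat -> nat -> R, (forall j, z 0%nat j = 0) /\
    forall n r, r 0%nat = 0 -> r 1%nat = 1 -> r 19%nat = INR (code a) ->
    (forall j, (j < 2 * k)%nat ->
      r (20 + 4 * j)%nat = z n j /\ r (22 + 4 * j)%nat = z (S n) j) ->
    sat r (machine_form Q).
Proof.
  intros k; assert (Ek : nvals Q = k) by reflexivity; clearbody k.
  intros Hp; unfold machine_form; rewrite Ek.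
  set (st n := Nat.iter n (next_counters Q a) (0%nat, fun _ => 0%nat)).
  (* Counters enter the relation through their squares, so the registers hold square roots of the
     integers that are counted down. *)
  exists (fun n j => if Nat.ltb j k then INR (register_vals Q a (fst (st n)) j)
    else sqrt (INR (snd (st n) (j - k)%nat))).
  split.
  { intros j; destruct (Nat.ltb_spec j k); simpl; [reflexivity | apply sqrt_0]. }
  intros n r H0 H1 HK Hr.
  assert (Hx : forall j, (j < k)%nat ->
    peval r (vx j) = INR (register_vals Q a (fst (st n)) j)).
  { intros j Hj; destruct (Hr j ltac:(lia)) as [E _].
    now rewrite (proj2 (Nat.ltb_lt _ _) Hj) in E. }
  assert (Hy : forall j, (j < k)%nat ->
    peval r (vy j) = INR (register_vals Q a (fst (st (S n))) j)).
  { intros j Hj; destruct (Hr j ltac:(lia)) as [_ E].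
    now rewrite (proj2 (Nat.ltb_lt _ _) Hj) in E. }
  assert (Hxc : forall j, (j < k)%nat ->
    peval r (vx (k + j)) = sqrt (INR (snd (st n) j))).
  { intros j Hj; destruct (Hr (k + j)%nat ltac:(lia)) as [E _].
    rewrite (proj2 (Nat.ltb_ge _ _)) in E by lia.
    now replace (k + j - k)%nat with j in E by lia. }
  assert (Hyc : forall j, (j < k)%nat ->
    peval r (vy (k + j)) = sqrt (INR (snd (st (S n)) j))).
  { intros j Hj; destruct (Hr (k + j)%nat ltac:(lia)) as [_ E].
    rewrite (proj2 (Nat.ltb_ge _ _)) in E by lia.
    now replace (k + j - k)%nat with j in E by lia. }
  clear Hr.
  change (st (S n)) with (next_counters Q a (st n)) in *.
  destruct (st n) as [i c]; cbn [next_counters fst snd] in *.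
  rewrite Ek in *.
  destruct (find _ _) as [j|] eqn:E; cbn [fst snd] in *.
  - apply find_some in E as [Hj Hc].
    apply in_seq in Hj; apply Nat.ltb_lt in Hc.
    right; apply sat_tick_form; auto; split.
    + intros l Hl; rewrite Hx, Hy; auto.
    + exists j; split; [lia|]; split.
      * rewrite Hxc, Hyc by lia; rewrite Nat.eqb_refl, !pow2_sqrt by apply pos_INR.
        rewrite <- S_INR; f_equal; lia.
      * intros l Hl Hn; rewrite Hxc, Hyc by lia.
        now rewrite (proj2 (Nat.eqb_neq l j) Hn).
  - assert (Hc : forall j, (j < k)%nat -> c j = 0%nat).
    { intros j Hj.
      pose proof (find_none _ _ E j ltac:(apply in_seq; lia)) as Hj'.
      apply Nat.ltb_ge in Hj'; lia. }
    left; apply sat_commit_form; auto; split; [|split].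
    + intros j Hj; rewrite Hxc, Hc by auto; apply sqrt_0.
    + intros j Hj; rewrite Hy, Hyc by auto.
      rewrite pow2_sqrt by apply pos_INR; rewrite <- S_INR; f_equal.
      pose proof (register_vals_pos Q a i j); lia.
    + pose proof (register_vals_represents Q a i (fun j => peval r (vy j))) as HR.
      rewrite Ek in HR; specialize (HR Hy).
      pose proof (nvals_bound Q _ (run_program_points Q a 0)); rewrite Ek in *.
      destruct i as [|i]; [left | right].
      * apply start_form_complete with (a := a); auto.
        -- unfold nprog; lia.
        -- apply Hx; lia.
      * pose proof (run_program_points Q a i) as Hin.
        apply step_form_complete with (g := run Q a i); auto.
        -- now apply head_bound_nprog.
        -- apply register_vals_represents; now rewrite Ek.
        -- intros l Hl; pose proof (nvals_bound Q _ Hin).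
           rewrite Hy by (lia); f_equal.
           cbn [Nat.add register_vals].
           rewrite (proj2 (Nat.ltb_ge _ _)) by lia; f_equal; lia.
Qed.

(** * Trees as algebraic constraints *)

Definition relates (r : nat -> R) (c : constraint) : Prop :=
  match c with
  | Add X Y Z _ => r X + r Y = r Z
  | Mult X Y Z _ => r X * r Y = r Z
  | _ => True
  end.

Definition algebraic (b : nat) (c : constraint) : Prop :=
  match c with
  | Add X Y Z [] | Mult X Y Z [] => (X < b /\ Y < b /\ Z < b)%nat
  | _ => False
  end.

Lemma algebraic_le (b b' : nat) (c : constraint) :
  (b <= b')%nat -> algebraic b c -> algebraic b' c.
Proof.
  intros Hb; destruct c as [X Y Z [|]|X Y Z [|]| |]; simpl; lia.
Qed.

Lemma relates_ext (b : nat) (r r' : nat -> R) (c : constraint) :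
  algebraic b c -> (forall j, (j < b)%nat -> r' j = r j) ->
  relates r c -> relates r' c.
Proof.
  intros Hc H; destruct c as [X Y Z [|]|X Y Z [|]| |]; simpl in *;
    try easy; now rewrite !H.
Qed.

(** Every [Cons] takes four fresh variables: the codes of its two subtrees, their sum and the square
    of the sum. The variables of the left subtree come next, then those of the right one. *)
Fixpoint cells (t : tree) : nat :=
  match t with
  | Nil => 0
  | Cons a b => cells b + (cells a + 4)
  end.

(* Variable [i] is made equal to the code of [t], with the help of the variables
   from [n] on. *)
Fixpoint literal (t : tree) (i n : nat) : list constraint :=
  match t with
  | Nil => [Add i 0 1 []]
  | Cons a b =>
      literal b (S n) (cells a + (4 + n)) ++ literal a n (4 + n) ++
      [Add n (S n) (2 + n) []; Mult (2 + n) (2 + n) (3 + n) [];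
       Add (3 + n) (S n) i []]
  end.

Lemma literal_algebraic (t : tree) : forall i n c,
  (2 <= n)%nat -> (i < n)%nat -> In c (literal t i n) ->
  algebraic (cells t + n) c.
Proof.
  induction t as [|a IHa b IHb]; intros i n c Hn Hi; cbn [literal cells].
  - intros [<- | []]; simpl; lia.
  - rewrite !in_app_iff; intros [H | [H | H]].
    + apply IHb in H; try lia; eapply algebraic_le; [|exact H]; lia.
    + apply IHa in H; try lia; eapply algebraic_le; [|exact H]; lia.
    + destruct H as [<- | [<- | [<- | []]]]; simpl; lia.
Qed.

Lemma literal_sound (r : nat -> R) (t : tree) : forall i n,
  r 0%nat = 0 -> r 1%nat = 1 ->
  (forall c, In c (literal t i n) -> relates r c) -> r i = INR (code t).
Proof.
  induction t as [|a IHa b IHb]; intros i n H0 H1 H.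
  - specialize (H _ (or_introl eq_refl)); simpl in *; lra.
  - cbn [literal] in H.
    assert (Ha : r n = INR (code a))
      by (apply IHa with (n := (4 + n)%nat); auto; intros c Hc; apply H;
          rewrite !in_app_iff; auto).
    assert (Hb : r (S n) = INR (code b))
      by (apply IHb with (n := (cells a + (4 + n))%nat); auto; intros c Hc; apply H;
          rewrite !in_app_iff; auto).
    assert (Hl : forall c, In c [Add n (S n) (2 + n) []; Mult (2 + n) (2 + n) (3 + n) [];
       Add (3 + n) (S n) i []] -> relates r c)
      by (intros c Hc; apply H; rewrite !in_app_iff; auto).
    pose proof (Hl _ (or_introl eq_refl)) as E1.
    pose proof (Hl _ (or_intror (or_introl eq_refl))) as E2.
    pose proof (Hl _ (or_intror (or_intror (or_introl eq_refl)))) as E3.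
    cbn [relates] in E1, E2, E3.
    cbn [code]; unfold pair_code.
    now rewrite plus_INR, mult_INR, plus_INR, <- Ha, <- Hb, E1, E2, E3.
Qed.

Lemma literal_complete (t : tree) : forall (r : nat -> R) i n,
  r 0%nat = 0 -> r 1%nat = 1 -> (2 <= n)%nat -> (i < n)%nat ->
  r i = INR (code t) ->
  exists r', (forall j, (j < n)%nat -> r' j = r j) /\
    forall c, In c (literal t i n) -> relates r' c.
Proof.
  induction t as [|a IHa b IHb]; intros r i n H0 H1 Hn Hi Hr.
  - exists r; split; [auto|]; intros c [<- | []]; simpl in *; lra.
  - set (x := INR (code a)); set (y := INR (code b)).
    set (r0 j := if Nat.ltb j n then r j
      else nth (j - n) [x; y; x + y; (x + y) * (x + y)] 0).
    assert (Hlt : forall j, (j < n)%nat -> r0 j = r j)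
      by (intros j Hj; unfold r0; now rewrite (proj2 (Nat.ltb_lt j n) Hj)).
    assert (Hge : forall j, r0 (j + n)%nat = nth j [x; y; x + y; (x + y) * (x + y)] 0).
    { intros j; unfold r0; rewrite (proj2 (Nat.ltb_ge (j + n) n)) by lia.
      f_equal; lia. }
    destruct (IHa r0 n (4 + n)%nat) as (r1 & E1 & L1);
      try (rewrite ?Hlt by lia; auto; lia); [exact (Hge 0%nat)|].
    destruct (IHb r1 (S n) (cells a + (4 + n))%nat) as (r2 & E2 & L2);
      try (rewrite ?E1, ?Hlt by lia; auto; lia).
    { rewrite E1 by lia; exact (Hge 1%nat). }
    exists r2; split.
    + intros j Hj; now rewrite E2, E1, Hlt by lia.
    + intros c; cbn [literal]; rewrite !in_app_iff; intros [H | [H | H]].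
      * now apply L2.
      (* The constraints for [a] use only variables below [cells a + (4 + n)], which the extension
         for [b] leaves unchanged. *)
      * eapply relates_ext; [eapply literal_algebraic; [| |exact H]; lia|exact E2|].
        now apply L1.
      * assert (E : forall j, (j < 4)%nat ->
          r2 (j + n)%nat = nth j [x; y; x + y; (x + y) * (x + y)] 0)
          by (intros j Hj; rewrite E2, E1 by lia; apply Hge).
        assert (Ei : r2 i = (x + y) * (x + y) + y).
        { rewrite E2, E1, Hlt, Hr by lia; cbn [code]; unfold pair_code, x, y.
          now rewrite plus_INR, mult_INR, plus_INR. }
        pose proof (E 0%nat ltac:(lia)) as e0; pose proof (E 1%nat ltac:(lia)) as e1.
        pose proof (E 2%nat ltac:(lia)) as e2; pose proof (E 3%nat ltac:(lia)) as e3.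
        cbn [Nat.add nth] in e0, e1, e2, e3.
        destruct H as [<- | [<- | [<- | []]]]; cbn [relates Nat.add];
          now rewrite ?Ei, ?e0, ?e1, ?e2, ?e3.
Qed.

(** * The prelude *)

Fixpoint quote (t : tree) : expr :=
  match t with
  | Nil => ENil
  | Cons a b => ECons (quote a) (quote b)
  end.

Fixpoint succ_expr (n : nat) (e : expr) : expr :=
  match n with
  | O => e
  | S n => ECons ENil (succ_expr n e)
  end.

Fixpoint push_expr (n : nat) (a : tree) (e : expr) : expr :=
  match n with
  | O => e
  | S n => ECons (quote a) (push_expr n a e)
  end.

Definition ternary_expr (tag : nat) (X Y Z : expr) : expr :=
  ECons (quote (enc_nat tag)) (ECons X (ECons Y (ECons Z ENil))).

Definition free_space : qspace := QSpace [MinusInf; PlusInf] false false.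
Definition free_std : qval := (Between MinusInf PlusInf, Std).

(** Program variable 1 is the stack of pending subtrees, each with the index of the model variable
    for its code; 2 is the next free index; 3, 4 and 5 are the constraints, quantity spaces and
    initial values built so far; 6 lists the base variables still to be added; 7 is the current
    subtree and 8 its index. One pass treats one [Cons], pushes the right subtree and goes on with
    the left one. *)
Definition literal_body : cmd :=
  Seq (Assign 3
    (ECons (ternary_expr 0 (EVar 2) (succ_expr 1 (EVar 2)) (succ_expr 2 (EVar 2)))
    (ECons (ternary_expr 1 (succ_expr 2 (EVar 2)) (succ_expr 2 (EVar 2))
             (succ_expr 3 (EVar 2)))
    (ECons (ternary_expr 0 (succ_expr 3 (EVar 2)) (succ_expr 1 (EVar 2)) (EVar 8))
      (EVar 3)))))
  (Seq (Assign 1 (ECons (ECons (ETl (EVar 7)) (succ_expr 1 (EVar 2))) (EVar 1)))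
  (Seq (Assign 7 (EHd (EVar 7)))
  (Seq (Assign 8 (EVar 2))
  (Seq (Assign 4 (push_expr 4 (enc_qspace free_space) (EVar 4)))
  (Seq (Assign 5 (push_expr 4 (enc_qval free_std) (EVar 5)))
    (Assign 2 (succ_expr 4 (EVar 2)))))))).

Definition emit_leaf : cmd :=
  Assign 3 (ECons (ternary_expr 0 (EVar 8) (quote (enc_nat 0)) (quote (enc_nat 1)))
    (EVar 3)).

Definition literal_loop : cmd :=
  While (EVar 1)
    (Seq (Assign 7 (EHd (EHd (EVar 1))))
    (Seq (Assign 8 (ETl (EHd (EVar 1))))
    (Seq (Assign 1 (ETl (EVar 1)))
    (Seq (While (EVar 7) literal_body) emit_leaf)))).

Definition base_loop : cmd :=
  While (EVar 6)
    (Seq (Assign 4 (ECons (EHd (EHd (EVar 6))) (EVar 4)))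
    (Seq (Assign 5 (ECons (ETl (EHd (EVar 6))) (EVar 5)))
      (Assign 6 (ETl (EVar 6))))).

(** Program variable 0 holds a template, whose own code is to be the value of model variable 19. The
    assignments at the end restore [Nil], so that the next program starts as if run on the
    constructed input. *)
Definition prelude : cmd :=
  Seq (Assign 1 (ECons (ECons (EVar 0) (quote (enc_nat 19))) ENil))
  (Seq (Assign 2 (ETl (ETl (EVar 0))))
  (Seq (Assign 3 (EHd (ETl (EVar 0))))
  (Seq (Assign 6 (EHd (EVar 0)))
  (Seq literal_loop
  (Seq base_loop
  (Seq (Assign 0 (ECons (ECons (EVar 4) (EVar 3)) (EVar 5)))
  (Seq (Assign 2 ENil)
  (Seq (Assign 3 ENil)
  (Seq (Assign 4 ENil)
  (Seq (Assign 5 ENil)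
    (Assign 8 ENil))))))))))).

(* The base variables are listed in reverse, as the prelude conses them. *)
Definition template (vars : list (qspace * qval)) (cs : list constraint) : tree :=
  Cons (enc_list (fun w => Cons (enc_qspace (fst w)) (enc_qval (snd w))) (rev vars))
    (Cons (enc_list enc_constraint cs) (enc_nat (length vars))).

(** Self-reference without circularity: the input contains the code of [t], not of itself. It is
    used with [t] equal to [template vars cs], from which a program can compute the code of the
    whole input. *)
Definition instance (vars : list (qspace * qval)) (cs : list constraint) (t : tree) : input :=
  Input
    (Model (map fst vars ++ repeat free_space (cells t))
      (literal t 19 (length vars) ++ cs))
    (map snd vars ++ repeat free_std (cells t)).

Definition reaches (g g' : config) : Prop := exists n, Nat.iter n step g = g'.

Lemma reaches_refl (g : config) : reaches g g.
Proof. now exists 0%nat. Qed.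

Lemma reaches_step (g g' : config) : reaches (step g) g' -> reaches g g'.
Proof. intros [n H]; exists (S n); now rewrite Nat.iter_succ_r. Qed.

Lemma reaches_trans (g g' g'' : config) :
  reaches g g' -> reaches g' g'' -> reaches g g''.
Proof.
  intros [n <-] [m <-]; exists (m + n)%nat; now rewrite Nat.iter_add.
Qed.

Definition mem9 (v0 v1 v2 v3 v4 v5 v6 v7 v8 : tree) : store := fun X =>
  match X with
  | 0 => v0 | 1 => v1 | 2 => v2 | 3 => v3 | 4 => v4 | 5 => v5 | 6 => v6
  | 7 => v7 | 8 => v8 | _ => Nil
  end%nat.

Lemma update_mem9 (v0 v1 v2 v3 v4 v5 v6 v7 v8 a : tree) :
  let m := mem9 v0 v1 v2 v3 v4 v5 v6 v7 v8 in
  update m 0 a = mem9 a v1 v2 v3 v4 v5 v6 v7 v8 /\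
  update m 1 a = mem9 v0 a v2 v3 v4 v5 v6 v7 v8 /\
  update m 2 a = mem9 v0 v1 a v3 v4 v5 v6 v7 v8 /\
  update m 3 a = mem9 v0 v1 v2 a v4 v5 v6 v7 v8 /\
  update m 4 a = mem9 v0 v1 v2 v3 a v5 v6 v7 v8 /\
  update m 5 a = mem9 v0 v1 v2 v3 v4 a v6 v7 v8 /\
  update m 6 a = mem9 v0 v1 v2 v3 v4 v5 a v7 v8 /\
  update m 7 a = mem9 v0 v1 v2 v3 v4 v5 v6 a v8 /\
  update m 8 a = mem9 v0 v1 v2 v3 v4 v5 v6 v7 a.
Proof.
  repeat split; apply functional_extensionality; intros X;
    do 9 (destruct X as [|X]; [reflexivity|]); reflexivity.
Qed.

Ltac run_assign :=
  apply reaches_step; unfold step at 1; cbn [todo memory printed];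
  match goal with
  | |- context [update (mem9 ?v0 ?v1 ?v2 ?v3 ?v4 ?v5 ?v6 ?v7 ?v8) _ ?a] =>
      let H := fresh in
      pose proof (update_mem9 v0 v1 v2 v3 v4 v5 v6 v7 v8 a) as H; cbv zeta in H;
      repeat match type of H with
      | ?E /\ ?F =>
          let H' := fresh in destruct H as [H' H];
          first [rewrite H' | idtac]; clear H'
      | _ => first [rewrite H | idtac]; clear H
      end
  end; cbn [eval mem9 hd_tree tl_tree].

Ltac run_seq := apply reaches_step; unfold step at 1; cbn [todo memory printed].

Definition enc_stack (l : list (tree * nat)) : tree :=
  enc_list (fun p => Cons (fst p) (enc_nat (snd p))) l.

(** The inner loop deals with [a] while [b] waits on the stack, and the outer loop then takes [b]
    up. Constraints are consed, so the latest come first, which fixes the order of the lists in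
    [literal]. Variable 8 keeps the index of the last leaf met, hence the existential. *)
Lemma literal_reaches (t : tree) : forall i k n cs q s z w o K,
  exists j, reaches
    (Config (While (EVar 7) literal_body :: emit_leaf :: literal_loop :: K)
      (mem9 z (enc_stack k) (enc_nat n) (enc_list enc_constraint cs) q s w t (enc_nat i)) o)
    (Config (literal_loop :: K)
      (mem9 z (enc_stack k) (enc_nat (cells t + n))
        (enc_list enc_constraint (literal t i n ++ cs))
        (Nat.iter (cells t) (Cons (enc_qspace free_space)) q)
        (Nat.iter (cells t) (Cons (enc_qval free_std)) s) w Nil (enc_nat j)) o).
Proof.
  induction t as [|a IHa b IHb]; intros i k n cs q s z w o K.
  - exists i; run_seq; cbn [eval mem9]; unfold emit_leaf.
    run_assign; apply reaches_refl.
  - destruct (IHa n ((b, S n) :: k) (4 + n)%nat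
      ([Add n (S n) (2 + n) []; Mult (2 + n) (2 + n) (3 + n) []; Add (3 + n) (S n) i []] ++ cs)
      (Nat.iter 4 (Cons (enc_qspace free_space)) q)
      (Nat.iter 4 (Cons (enc_qval free_std)) s) z w o K) as [ja Ha].
    destruct (IHb (S n) k (cells a + (4 + n))%nat
      (literal a n (4 + n) ++
       [Add n (S n) (2 + n) []; Mult (2 + n) (2 + n) (3 + n) []; Add (3 + n) (S n) i []] ++ cs)
      (Nat.iter (cells a) (Cons (enc_qspace free_space))
        (Nat.iter 4 (Cons (enc_qspace free_space)) q))
      (Nat.iter (cells a) (Cons (enc_qval free_std))
        (Nat.iter 4 (Cons (enc_qval free_std)) s)) z w o K) as [jb Hb].
    exists jb.
    run_seq; cbn [eval mem9]; unfold literal_body at 1.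
    run_seq; run_assign; run_seq; run_assign; run_seq; run_assign; run_seq; run_assign.
    run_seq; run_assign; run_seq; run_assign; run_assign.
    eapply reaches_trans; [exact Ha|].
    unfold literal_loop at 1; run_seq; cbn [eval mem9 enc_stack enc_list fold_right].
    run_seq; run_assign; run_seq; run_assign; run_seq; run_assign; run_seq.
    eapply reaches_trans; [exact Hb|].
    cbn [cells literal].
    rewrite <- !app_assoc, !Nat.iter_add, <- !Nat.add_assoc.
    apply reaches_refl.
Qed.

Definition enc_var (w : qspace * qval) : tree :=
  Cons (enc_qspace (fst w)) (enc_qval (snd w)).

Lemma base_loop_reaches (l : list (qspace * qval)) : forall z v1 v2 v3 q s v7 v8 o K,
  reaches
    (Config (base_loop :: K) (mem9 z v1 v2 v3 q s (enc_list enc_var l) v7 v8) o)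
    (Config K (mem9 z v1 v2 v3
      (fold_left (fun u w => Cons (enc_qspace (fst w)) u) l q)
      (fold_left (fun u w => Cons (enc_qval (snd w)) u) l s) Nil v7 v8) o).
Proof.
  induction l as [|w l IH]; intros z v1 v2 v3 q s v7 v8 o K.
  - run_seq; cbn [eval mem9 enc_list fold_right fold_left]; apply reaches_refl.
  - unfold base_loop at 1; run_seq; cbn [eval mem9 enc_list fold_right].
    unfold enc_var at 1.
    run_seq; run_assign; run_seq; run_assign; run_assign.
    apply IH.
Qed.

Lemma enc_list_app_repeat {A : Type} (f : A -> tree) (l : list A) (a : A) (n : nat) :
  enc_list f (l ++ repeat a n) =
  fold_right (fun x u => Cons (f x) u) (Nat.iter n (Cons (f a)) Nil) l.
Proof.
  unfold enc_list; rewrite fold_right_app; f_equal.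
  induction n as [|n IH]; simpl; congruence.
Qed.

Lemma fold_right_map {A B C : Type} (f : A -> B) (g : B -> C -> C) (c : C) (l : list A) :
  fold_right g c (map f l) = fold_right (fun x => g (f x)) c l.
Proof. induction l; simpl; congruence. Qed.

Lemma prelude_reaches (vars : list (qspace * qval)) (cs : list constraint)
    (o : list tree) (K : list cmd) :
  let x := template vars cs in
  reaches (Config (prelude :: K) (mem9 x Nil Nil Nil Nil Nil Nil Nil Nil) o)
    (Config K (mem9 (enc_input (instance vars cs x)) Nil Nil Nil Nil Nil Nil Nil Nil) o).
Proof.
  intros x; unfold prelude.
  run_seq; run_assign; run_seq; run_assign; run_seq; run_assign; run_seq; run_assign.
  run_seq; unfold literal_loop at 1; run_seq; cbn [eval mem9].
  run_seq; run_assign; run_seq; run_assign; run_seq; run_assign; run_seq.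
  match goal with |- reaches (Config (_ :: _ :: _ :: ?K') _ _) _ =>
    destruct (literal_reaches x 19 [] (length vars) cs Nil Nil x
      (enc_list enc_var (rev vars)) o K') as [j Hj]
  end.
  cbn [enc_stack enc_list fold_right] in Hj.
  eapply reaches_trans; [exact Hj|].
  unfold literal_loop at 1; run_seq; cbn [eval mem9].
  run_seq; eapply reaches_trans; [apply base_loop_reaches|].
  run_seq; run_assign; run_seq; run_assign; run_seq; run_assign; run_seq; run_assign;
    run_seq; run_assign; run_assign.
  rewrite <- (rev_involutive vars) at 2 3.
  unfold enc_input, enc_model, enc_state, instance.
  cbn [input_model initial_state qspaces constraints].
  rewrite !enc_list_app_repeat, !fold_right_map.
  rewrite <- !fold_left_rev_right, !rev_involutive; apply reaches_refl.
Qed.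

Lemma start_mem9 (P : cmd) (a : tree) :
  start P a = Config [P] (mem9 a Nil Nil Nil Nil Nil Nil Nil Nil) [].
Proof.
  unfold start; f_equal; apply functional_extensionality; intros X.
  do 9 (destruct X as [|X]; [reflexivity|]); reflexivity.
Qed.

Lemma run_after_prelude (P : cmd) (vars : list (qspace * qval)) (cs : list constraint) :
  let x := template vars cs in
  exists n0, forall n,
    run (Seq prelude P) x (n0 + n) = run P (enc_input (instance vars cs x)) n.
Proof.
  intros x.
  destruct (prelude_reaches vars cs [] [P]) as [n0 H].
  exists (S n0); intros n; unfold run.
  rewrite !start_mem9, Nat.add_comm, Nat.iter_add; f_equal.
  rewrite Nat.iter_succ_r; exact H.
Qed.

(** * Printing and self-application *)

Lemma printed_mono (Q : cmd) (a : tree) (n m : nat) (t : tree) :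
  (n <= m)%nat -> In t (printed (run Q a n)) -> In t (printed (run Q a m)).
Proof.
  induction 1 as [|m _ IH]; [auto|]; intros H; apply IH in H.
  rewrite run_S; unfold step.
  destruct (todo (run Q a m)) as [|[] K]; auto.
  - destruct (eval _ _); auto.
  - cbn [printed]; apply in_or_app; now left.
Qed.

Lemma prints_nonnil_printed (Q : cmd) (a : tree) (n : nat) :
  prints_nonnil (run Q a n) -> exists t, t <> Nil /\ In t (printed (run Q a (S n))).
Proof.
  unfold prints_nonnil; rewrite run_S; unfold step.
  destruct (todo (run Q a n)) as [|[] K]; try easy.
  intros H; eexists; split; [exact H|].
  cbn [printed]; apply in_or_app; right; now left.
Qed.

Lemma printed_prints_nonnil (Q : cmd) (a : tree) (n : nat) (t : tree) :
  t <> Nil -> In t (printed (run Q a n)) -> exists i, prints_nonnil (run Q a i).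
Proof.
  intros Ht; induction n as [|n IH]; [intros []|].
  rewrite run_S; unfold step.
  destruct (todo (run Q a n)) as [|[] K] eqn:E; auto.
  - destruct (eval _ _); auto.
  - cbn [printed]; intros H; apply in_app_or in H as [H | [H | []]]; auto.
    exists n; unfold prints_nonnil; now rewrite E, H.
Qed.

(* Running the prelude first makes a program work on the code of an instance of
   its own template. *)
Lemma prints_nonnil_prelude (P : cmd) (vars : list (qspace * qval)) (cs : list constraint) :
  let x := template vars cs in
  (exists i, prints_nonnil (run (Seq prelude P) x i)) <->
  exists n t, t <> Nil /\ In t (printed (run P (enc_input (instance vars cs x)) n)).
Proof.
  intros x; destruct (run_after_prelude P vars cs) as [n0 H]; fold x in H; split.
  - intros [i Hi]; apply prints_nonnil_printed in Hi as (t & Ht & Hin).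
    exists (S i), t; split; [exact Ht|].
    rewrite <- H; apply printed_mono with (2 := Hin); lia.
  - intros (n & t & Ht & Hin); rewrite <- H in Hin.
    eapply printed_prints_nonnil; eauto.
Qed.

(** * Polynomials as algebraic constraints *)

Fixpoint psubs (p : poly) : list poly :=
  match p with
  | PVar _ => []
  | PAdd a b | PSub a b | PMul a b => psubs a ++ psubs b ++ [p]
  end.

(* The non-variable subterms of [p] are represented by the variables from [n]
   on, in postorder; [pindex p n] represents [p] itself. *)
Definition pindex (p : poly) (n : nat) : nat :=
  match p with
  | PVar i => i
  | PAdd a b | PSub a b | PMul a b => length (psubs b) + (length (psubs a) + n)
  end.

Fixpoint pcons (p : poly) (n : nat) : list constraint :=
  match p with
  | PVar _ => []
  | PAdd a b =>
      pcons a n ++ pcons b (length (psubs a) + n) ++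
      [Add (pindex a n) (pindex b (length (psubs a) + n)) (pindex p n) []]
  | PSub a b =>
      pcons a n ++ pcons b (length (psubs a) + n) ++
      [Add (pindex p n) (pindex b (length (psubs a) + n)) (pindex a n) []]
  | PMul a b =>
      pcons a n ++ pcons b (length (psubs a) + n) ++
      [Mult (pindex a n) (pindex b (length (psubs a) + n)) (pindex p n) []]
  end.

Fixpoint pall (Q : nat -> Prop) (p : poly) : Prop :=
  match p with
  | PVar i => Q i
  | PAdd a b | PSub a b | PMul a b => pall Q a /\ pall Q b
  end.

Lemma pcons_sound (r : nat -> R) (p : poly) : forall n,
  (forall c, In c (pcons p n) -> relates r c) -> r (pindex p n) = peval r p.
Proof.
  induction p as [i|a IHa b IHb|a IHa b IHb|a IHa b IHb]; intros n H;
    [reflexivity| | |]; cbn [pcons] in H; cbn [peval];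
    (rewrite <- (IHa n) by (intros c Hc; apply H; rewrite !in_app_iff; auto));
    (rewrite <- (IHb (length (psubs a) + n)%nat)
      by (intros c Hc; apply H; rewrite !in_app_iff; auto)).
  - symmetry; apply (H (Add _ _ _ [])); rewrite !in_app_iff; right; right; now left.
  - apply Rplus_eq_reg_r with (r (pindex b (length (psubs a) + n))).
    etransitivity; [|now rewrite Rplus_comm, Rplus_minus].
    apply (H (Add _ _ _ [])); rewrite !in_app_iff; right; right; now left.
  - symmetry; apply (H (Mult _ _ _ [])); rewrite !in_app_iff; right; right; now left.
Qed.

Lemma pcons_complete (r : nat -> R) (p : poly) : forall n,
  (forall i, (i < length (psubs p))%nat ->
    r (i + n)%nat = peval r (nth i (psubs p) pzero)) ->
  r (pindex p n) = peval r p /\ forall c, In c (pcons p n) -> relates r c.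
Proof.
  assert (Hsub : forall a b p n,
    (forall i, (i < length (psubs a ++ psubs b ++ [p]))%nat ->
      r (i + n)%nat = peval r (nth i (psubs a ++ psubs b ++ [p]) pzero)) ->
    (forall i, (i < length (psubs a))%nat ->
      r (i + n)%nat = peval r (nth i (psubs a) pzero)) /\
    (forall i, (i < length (psubs b))%nat ->
      r (i + (length (psubs a) + n))%nat = peval r (nth i (psubs b) pzero)) /\
    r (length (psubs b) + (length (psubs a) + n))%nat = peval r p).
  { intros a b q n H; split; [|split].
    - intros i Hi; rewrite H; [now rewrite app_nth1|rewrite length_app; lia].
    - intros i Hi.
      replace (i + (length (psubs a) + n))%nat with (i + length (psubs a) + n)%nat by lia.
      rewrite H by (rewrite !length_app; lia).
      rewrite app_nth2, app_nth1 by lia; do 2 f_equal; lia.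
    - replace (length (psubs b) + (length (psubs a) + n))%nat
        with (length (psubs b) + length (psubs a) + n)%nat by lia.
      rewrite H by (rewrite !length_app; simpl; lia).
      rewrite !app_nth2 by lia.
      now replace (length (psubs b) + length (psubs a) - length (psubs a) -
        length (psubs b))%nat with 0%nat by lia. }
  induction p as [i|a IHa b IHb|a IHa b IHb|a IHa b IHb]; intros n H;
    [now split| | |]; cbn [psubs] in H; apply Hsub in H as (Ha & Hb & Hp);
    apply IHa in Ha as [Ea Ca]; apply IHb in Hb as [Eb Cb];
    (split; [exact Hp|]); cbn [pcons]; intros c; rewrite !in_app_iff;
    (intros [H | [H | [<- | []]]]; [now apply Ca | now apply Cb |]);
    cbn [relates pindex]; rewrite Hp, Ea, Eb; cbn [peval]; ring.
Qed.

Lemma pindex_lt (p : poly) (n b : nat) :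
  pall (fun i => (i < b)%nat) p -> (length (psubs p) + n <= b)%nat ->
  (pindex p n < b)%nat.
Proof.
  destruct p; cbn [pall psubs pindex]; rewrite ?length_app; simpl; intros; lia.
Qed.

Lemma pcons_algebraic (b : nat) (p : poly) : forall n c,
  pall (fun i => (i < b)%nat) p -> (length (psubs p) + n <= b)%nat ->
  In c (pcons p n) -> algebraic b c.
Proof.
  induction p as [i|p IHp q IHq|p IHp q IHq|p IHp q IHq]; intros n c Hv Hn;
    [intros []| | |]; match type of Hv with pall _ ?p0 => pose proof (pindex_lt p0 n b Hv Hn) as Hi end;
    cbn [pall psubs pcons] in *;
    rewrite ?length_app in Hn; simpl in Hn; destruct Hv as [Hp Hq];
    pose proof (pindex_lt p n b Hp ltac:(lia));
    pose proof (pindex_lt q (length (psubs p) + n) b Hq ltac:(lia));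
    rewrite !in_app_iff;
    (intros [H' | [H' | [<- | []]]];
      [eapply IHp; eauto; lia | eapply IHq; eauto; lia | cbn [algebraic]; auto]).
Qed.

(* A goal [(g, p)] requires [p] to vanish wherever variable [g] does not. *)
Fixpoint goal_cons (l : list (nat * poly)) (n : nat) : list constraint :=
  match l with
  | [] => []
  | (g, p) :: l =>
      pcons p n ++ Mult g (pindex p n) 0 [] :: goal_cons l (length (psubs p) + n)
  end.

Definition goal_nodes (l : list (nat * poly)) : list poly :=
  flat_map (fun gp => psubs (snd gp)) l.

Lemma goal_cons_sound (r : nat -> R) (l : list (nat * poly)) : forall n g p,
  r 0%nat = 0 ->
  (forall c, In c (goal_cons l n) -> relates r c) -> In (g, p) l ->
  r g * peval r p = 0.
Proof.
  induction l as [|[g' p'] l IH]; intros n g p H0 H; [intros []|].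
  cbn [goal_cons] in H; intros [E | Hin].
  - injection E as -> ->.
    rewrite <- (pcons_sound r p n), <- H0
      by (intros c Hc; apply H; rewrite in_app_iff; auto).
    apply (H (Mult _ _ _ [])); rewrite in_app_iff; right; now left.
  - apply (IH (length (psubs p') + n)%nat); auto.
    intros c Hc; apply H; rewrite in_app_iff; right; now right.
Qed.

Lemma goal_cons_complete (r : nat -> R) (l : list (nat * poly)) : forall n,
  r 0%nat = 0 ->
  (forall i, (i < length (goal_nodes l))%nat ->
    r (i + n)%nat = peval r (nth i (goal_nodes l) pzero)) ->
  (forall g p, In (g, p) l -> r g * peval r p = 0) ->
  forall c, In c (goal_cons l n) -> relates r c.
Proof.
  induction l as [|[g p] l IH]; intros n H0 Hn Hg c; [intros []|].
  cbn [goal_cons goal_nodes flat_map snd] in *.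
  fold (goal_nodes l) in *; rewrite length_app in Hn.
  destruct (pcons_complete r p n) as [Ep Cp].
  { intros i Hi; rewrite Hn by lia; now rewrite app_nth1. }
  rewrite in_app_iff; intros [H | [<- | H]].
  - now apply Cp.
  - cbn [relates]; rewrite Ep, H0; apply Hg; now left.
  - apply (IH (length (psubs p) + n)%nat); auto.
    + intros i Hi.
      replace (i + (length (psubs p) + n))%nat with (i + length (psubs p) + n)%nat by lia.
      rewrite Hn, app_nth2 by lia; do 2 f_equal; lia.
    + intros g' p' H'; apply Hg; now right.
Qed.

Lemma goal_cons_algebraic (b : nat) (l : list (nat * poly)) : forall n c,
  (0 < b)%nat ->
  (forall g p, In (g, p) l -> (g < b)%nat /\ pall (fun i => (i < b)%nat) p) ->
  (length (goal_nodes l) + n <= b)%nat ->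
  In c (goal_cons l n) -> algebraic b c.
Proof.
  induction l as [|[g p] l IH]; intros n c Hb H Hn; [intros []|].
  cbn [goal_cons goal_nodes flat_map snd] in *.
  fold (goal_nodes l) in *; rewrite length_app in Hn.
  destruct (H g p (or_introl eq_refl)) as [Hg Hp].
  rewrite in_app_iff; intros [Hc | [<- | Hc]].
  - eapply pcons_algebraic; [exact Hp | | exact Hc]; lia.
  - cbn [algebraic]; repeat split; auto; apply pindex_lt; auto; lia.
  - eapply IH; [exact Hb | | | exact Hc]; try lia.
    intros g' p' H'; apply H; now right.
Qed.

(** * The model *)

(** Like [free_space], it ends at infinities on both sides, so no variable is ever about to leave
    and no trajectory stops in finite time. The landmark 0 serves to prescribe signs and zeros at
    time 0. *)
Definition signed_space : qspace := QSpace [MinusInf; Zero; PlusInf] false false.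

Definition free_var : qspace * qval := (free_space, free_std).

(* 0 and 1 are constants; 2 and 3 are a sine and a cosine, with squares, cubes
   and one-sided parts in 4 to 16; 17 is nonzero in the second quarter of every
   period only, 18 in the fourth; 19 is the code of the data. Register [j] has
   the copies 20+4j and 22+4j, followed by their derivatives. *)
Definition clock_vars : list (qspace * qval) :=
  [free_var; (signed_space, (Between Zero PlusInf, Std));
   (signed_space, (At Zero, Inc)); (signed_space, (Between Zero PlusInf, Std));
   (free_space, (Between MinusInf PlusInf, Dec))] ++ repeat free_var 15.

(** The equation x + x = x yields 0; x x = x, for a constant variable that is initially positive,
    yields 1. Sine and cosine are fixed only up to a common positive factor. *)
Definition clock_cons : list constraint :=
  [Add 0 0 0 []; Mult 1 1 1 []; Constant 1 None [];
   Derivative 2 3; Derivative 3 4; Add 2 4 0 [];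
   Mult 2 2 5 []; Mult 5 2 6 [];
   Mult 7 8 0 []; Mult 7 7 9 []; Mult 8 8 10 []; Add 10 6 9 [];
   Mult 3 3 11 []; Mult 11 3 12 [];
   Mult 13 14 0 []; Mult 13 13 15 []; Mult 14 14 16 []; Add 16 12 15 [];
   Mult 7 14 17 []; Mult 8 13 18 []].

Definition register_vars : list (qspace * qval) :=
  [(signed_space, (At Zero, Std)); free_var; free_var; free_var].

Fixpoint registers_vars (m : nat) : list (qspace * qval) :=
  match m with
  | O => []
  | S m => registers_vars m ++ register_vars
  end.

Definition register_cons (j : nat) : list constraint :=
  [Derivative (20 + 4 * j) (21 + 4 * j); Derivative (22 + 4 * j) (23 + 4 * j);
   Mult 7 (21 + 4 * j) 0 []; Mult 8 (23 + 4 * j) 0 []].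

Definition goals (m : nat) (p : poly) : list (nat * poly) :=
  (17%nat, p) :: map (fun j => (18%nat, PSub (vx j) (vy j))) (List.seq 0 m).

Definition model_vars (m : nat) (p : poly) : list (qspace * qval) :=
  clock_vars ++ registers_vars m ++ repeat free_var (length (goal_nodes (goals m p))).

Definition model_cons (m : nat) (p : poly) : list constraint :=
  clock_cons ++ flat_map register_cons (List.seq 0 m) ++
  goal_cons (goals m p) (20 + 4 * m).

Lemma length_registers_vars (m : nat) : length (registers_vars m) = (4 * m)%nat.
Proof.
  induction m as [|m IH]; cbn [registers_vars]; rewrite ?length_app; simpl in *; lia.
Qed.

Lemma length_model_vars (m : nat) (p : poly) :
  length (model_vars m p) = (length (goal_nodes (goals m p)) + (20 + 4 * m))%nat.
Proof.
  unfold model_vars; rewrite !length_app, length_registers_vars, repeat_length.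
  simpl length at 1; lia.
Qed.

Lemma nth_registers_vars (m j i : nat) :
  (j < m)%nat -> (i < 4)%nat ->
  nth_error (registers_vars m) (i + 4 * j) = nth_error register_vars i.
Proof.
  intros Hj Hi; induction m as [|m IH]; [lia|]; cbn [registers_vars].
  destruct (Nat.eq_dec j m) as [->|Hn].
  - rewrite nth_error_app2; rewrite length_registers_vars; [f_equal|]; lia.
  - rewrite nth_error_app1; [apply IH; lia|rewrite length_registers_vars; lia].
Qed.

Lemma nth_model_vars_register (m : nat) (p : poly) (j i : nat) :
  (j < m)%nat -> (i < 4)%nat ->
  nth_error (model_vars m p) (i + (20 + 4 * j)) = nth_error register_vars i.
Proof.
  intros Hj Hi; unfold model_vars.
  rewrite nth_error_app2 by (simpl; lia).
  rewrite nth_error_app1 by (rewrite length_registers_vars; simpl; lia).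
  replace (i + (20 + 4 * j) - length clock_vars)%nat with (i + 4 * j)%nat
    by (simpl length; lia).
  now apply nth_registers_vars.
Qed.

(* The variables that may occur in a relation between successive register contents. *)
Definition relation_var (m i : nat) : Prop :=
  i = 0%nat \/ i = 1%nat \/ i = 19%nat \/
  exists j, (j < m)%nat /\ (i = (20 + 4 * j)%nat \/ i = (22 + 4 * j)%nat).

Lemma relation_var_lt (m i : nat) : relation_var m i -> (i < 20 + 4 * m)%nat.
Proof. intros [|[|[|(j & Hj & [|])]]]; lia. Qed.

Lemma pall_impl (P Q : nat -> Prop) (p : poly) :
  (forall i, P i -> Q i) -> pall P p -> pall Q p.
Proof. intros H; induction p; simpl; intuition. Qed.

Lemma goals_var (m : nat) (p : poly) :
  pall (relation_var m) p ->
  forall g q, In (g, q) (goals m p) -> (g < 20)%nat /\ pall (relation_var m) q.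
Proof.
  intros Hp g q [E | H].
  - injection E as <- <-; split; [lia | exact Hp].
  - apply in_map_iff in H as (j & E & Hj); apply in_seq in Hj.
    injection E as <- <-; split; [lia|]; split;
      right; right; right; exists j; split; auto; lia.
Qed.

Fixpoint fvars (P : nat -> Prop) (f : form) : Prop :=
  match f with
  | FEq p q => pall P p /\ pall P q
  | FFalse => True
  | FAnd f g | FOr f g => fvars P f /\ fvars P g
  end.

Lemma pall_poly_of (P : nat -> Prop) (f : form) :
  P 1%nat -> fvars P f -> pall P (poly_of f).
Proof.
  intros H1; induction f; simpl; tauto.
Qed.

Lemma fvars_fall {A : Type} (P : nat -> Prop) (F : A -> form) (l : list A) :
  P 0%nat -> (forall a, In a l -> fvars P (F a)) -> fvars P (fall (map F l)).
Proof.
  intros H0; induction l as [|a l IH]; simpl; [tauto|]; intros H; split; auto.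
Qed.

Lemma fvars_fany {A : Type} (P : nat -> Prop) (F : A -> form) (l : list A) :
  (forall a, In a l -> fvars P (F a)) -> fvars P (fany (map F l)).
Proof.
  induction l as [|a l IH]; simpl; [tauto|]; intros H; split; auto.
Qed.

Lemma relation_var_vx (m j : nat) : (j < m)%nat -> pall (relation_var m) (vx j).
Proof. intros Hj; right; right; right; exists j; split; auto. Qed.

Lemma relation_var_vy (m j : nat) : (j < m)%nat -> pall (relation_var m) (vy j).
Proof. intros Hj; right; right; right; exists j; split; auto. Qed.

Lemma relation_var_pzero (m : nat) : pall (relation_var m) pzero.
Proof. now left. Qed.

Lemma relation_var_pone (m : nat) : pall (relation_var m) pone.
Proof. right; now left. Qed.

Lemma relation_var_vdata (m : nat) : pall (relation_var m) vdata.
Proof. right; right; now left. Qed.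

Lemma relation_var_pnat (m n : nat) : pall (relation_var m) (pnat n).
Proof.
  induction n; [apply relation_var_pzero | split; [auto | apply relation_var_pone]].
Qed.

Lemma relation_var_eval_form (m N : nat) (e : expr) : forall A v,
  (expr_bound e <= N)%nat -> (S N <= m)%nat -> (A + naux e <= m)%nat ->
  pall (relation_var m) v -> fvars (relation_var m) (eval_form A e v).
Proof.
  pose proof (relation_var_pone m) as H1.
  induction e as [X| |e IHe f IHf|e IHe|e IHe]; intros A v HN Hm HA Hv;
    cbn [expr_bound naux eval_form fvars] in *.
  - split; [exact Hv | apply relation_var_vx; lia].
  - now split.
  - assert (Hp := relation_var_vy m (A + (naux e + naux f)) ltac:(lia)).
    assert (Hq := relation_var_vy m (A + (naux e + naux f + 1)) ltac:(lia)).
    split; [apply IHe; auto; lia|]; split; [apply IHf; auto; lia|].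
    cbn [ppair pall]; tauto.
  - assert (Hp := relation_var_vy m (A + naux e) ltac:(lia)).
    assert (Hq := relation_var_vy m (A + (naux e + 1)) ltac:(lia)).
    split; [apply IHe; auto; lia|]; cbn [ppair pall]; tauto.
  - assert (Hp := relation_var_vy m (A + naux e) ltac:(lia)).
    assert (Hq := relation_var_vy m (A + (naux e + 1)) ltac:(lia)).
    split; [apply IHe; auto; lia|]; cbn [ppair pall]; tauto.
Qed.

Lemma relation_var_instr_form (m N : nat) (L : list (list cmd)) (s : list cmd) :
  (head_bound s <= N)%nat -> (S N + instr_naux s <= m)%nat ->
  fvars (relation_var m) (instr_form N L s).
Proof.
  intros HN Hm.
  assert (Hgoto : forall t, fvars (relation_var m) (goto L t))
    by (intros t; split; [apply relation_var_vy; lia | apply relation_var_pnat]).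
  assert (Hkeep : forall X, fvars (relation_var m) (keep_but N X)).
  { intros X; apply fvars_fall; [apply relation_var_pzero|].
    intros i Hi; apply in_seq in Hi; destruct (Nat.eqb i X).
    - split; apply relation_var_pzero.
    - split; [apply relation_var_vy | apply relation_var_vx]; lia. }
  pose proof (relation_var_pone m) as H1.
  destruct s as [|[X e|c d|e c|e] t]; cbn [head_bound instr_naux instr_form fvars] in *.
  - auto.
  - split; [auto|]; split; [auto|].
    apply relation_var_eval_form with (N := N); try lia.
    apply relation_var_vy; lia.
  - auto.
  - assert (Hp := relation_var_vy m (S N + naux e) ltac:(lia)).
    assert (Hq := relation_var_vy m (S N + (naux e + 1)) ltac:(lia)).
    split; [auto|]; split; (split; [auto|]).
    + apply relation_var_eval_form with (N := N); auto; lia.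
    + split; [apply relation_var_eval_form with (N := N); auto; lia|].
      cbn [pall]; tauto.
  - split; [auto|]; split; [auto|].
    apply relation_var_eval_form with (N := N); auto; lia.
Qed.

Lemma relation_var_machine_form (Q : cmd) :
  fvars (relation_var (2 * nvals Q)) (machine_form Q).
Proof.
  set (k := nvals Q).
  assert (Hk : (S (nprog Q) <= k)%nat)
    by (pose proof (nvals_bound Q [] (or_introl eq_refl)); unfold k; lia).
  assert (Hvx := relation_var_vx (2 * k)).
  assert (Hvy := relation_var_vy (2 * k)).
  pose proof (relation_var_pone (2 * k)) as H1.
  pose proof (relation_var_pzero (2 * k)) as H0.
  pose proof (relation_var_vdata (2 * k)) as HK.
  split; split; [|split; [|split]| |].
  - apply fvars_fall; [exact H0|]; intros j Hj; apply in_seq in Hj; fold k in Hj.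
    split; [apply Hvx; fold k; lia | exact H0].
  - apply fvars_fall; [exact H0|]; intros j Hj; apply in_seq in Hj; fold k in Hj.
    assert (pall (relation_var (2 * k)) (vy (k + j))) by (apply Hvy; lia).
    split; [apply Hvy; lia|]; cbn [pall]; tauto.
  - split; [split; [apply Hvx; lia | exact H0]|].
    split; [split; [apply Hvy; lia | apply relation_var_pnat]|].
    split; [split; [apply Hvy; unfold nprog in Hk; lia | exact HK]|].
    apply fvars_fall; [exact H0|]; intros j Hj; apply in_seq in Hj.
    split; [apply Hvy; lia | exact H1].
  - apply fvars_fany; intros s Hs; split.
    + split; [apply Hvx; lia | apply relation_var_pnat].
    + apply relation_var_instr_form; [now apply head_bound_nprog|].
      pose proof (nvals_bound Q s Hs); unfold k; lia.
  - apply fvars_fall; [exact H0|]; intros j Hj; apply in_seq in Hj; fold k in Hj.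
    split; [apply Hvy | apply Hvx]; lia.
  - apply fvars_fany; intros j Hj; apply in_seq in Hj; fold k in Hj.
    assert (pall (relation_var (2 * k)) (vx (k + j))) by (apply Hvx; lia).
    assert (pall (relation_var (2 * k)) (vy (k + j))) by (apply Hvy; lia).
    split; [cbn [fvars pall]; tauto|].
    apply fvars_fall; [exact H0|]; intros i Hi; apply in_seq in Hi; fold k in Hi.
    destruct (Nat.eqb i j); split; try exact H0; [apply Hvy | apply Hvx]; fold k; lia.
Qed.

(** * Well-formedness of the instances *)

Definition base_vars (Q : cmd) : list (qspace * qval) :=
  model_vars (2 * nvals Q) (poly_of (machine_form Q)).

Definition base_cons (Q : cmd) : list constraint :=
  model_cons (2 * nvals Q) (poly_of (machine_form Q)).

Definition machine_input (Q : cmd) (t : tree) : input :=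
  instance (base_vars Q) (base_cons Q) t.

Lemma pall_machine_poly (Q : cmd) :
  pall (relation_var (2 * nvals Q)) (poly_of (machine_form Q)).
Proof.
  apply pall_poly_of; [apply relation_var_pone | apply relation_var_machine_form].
Qed.

Lemma signed_space_adjacent :
  adjacent signed_space MinusInf Zero /\ adjacent signed_space Zero PlusInf.
Proof. split; [exists [], [PlusInf] | exists [MinusInf], []]; reflexivity. Qed.

Lemma free_space_adjacent : adjacent free_space MinusInf PlusInf.
Proof. exists [], []; reflexivity. Qed.

Lemma signed_space_reachable : reachable signed_space Zero.
Proof.
  split; [right; now left|]; split; [intros [r H]; discriminate|].
  intros [[|a [|b [|c r]]] H]; simpl in H; try discriminate.
  injection H as _ _ _ H; now destruct r.
Qed.

Lemma wf_signed_space : wf_qspace signed_space.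
Proof.
  split; [discriminate|]; split; [|split; [|split; [|split]]].
  - repeat constructor; simpl; intuition discriminate.
  - intros _; exists [Zero; PlusInf]; reflexivity.
  - intros _; exists [MinusInf; Zero]; reflexivity.
  - intros (_ & H & _); discriminate H; exists [Zero; PlusInf]; reflexivity.
  - intros (_ & _ & H); discriminate H; exists [MinusInf; Zero]; reflexivity.
Qed.

Lemma wf_free_space : wf_qspace free_space.
Proof.
  split; [discriminate|]; split; [|split; [|split; [|split]]].
  - repeat constructor; simpl; intuition discriminate.
  - intros _; exists [PlusInf]; reflexivity.
  - intros _; exists [MinusInf]; reflexivity.
  - intros (_ & H & _); discriminate H; exists [PlusInf]; reflexivity.
  - intros (_ & _ & H); discriminate H; exists [MinusInf]; reflexivity.
Qed.

Definition wf_var (w : qspace * qval) : Prop :=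
  (fst w = signed_space \/ fst w = free_space) /\ wf_qmag (fst w) (fst (snd w)).

Lemma wf_free_var : wf_var free_var.
Proof. split; [now right | apply free_space_adjacent]. Qed.

Lemma wf_base_vars (Q : cmd) : List.Forall wf_var (base_vars Q).
Proof.
  assert (Hrep : forall n, List.Forall wf_var (repeat free_var n)).
  { intros n; apply Forall_forall; intros w Hw.
    apply repeat_spec in Hw; subst w; apply wf_free_var. }
  unfold base_vars, model_vars, clock_vars; rewrite !Forall_app.
  destruct signed_space_adjacent as [_ Hpos].
  split; [split; [|apply Hrep]|split; [|apply Hrep]].
  - repeat (apply Forall_cons || apply Forall_nil); split; simpl;
      auto using free_space_adjacent, signed_space_reachable.
  - generalize (2 * nvals Q)%nat as m; intros m; induction m as [|m IH]; [constructor|].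
    cbn [registers_vars]; rewrite Forall_app; split; [exact IH|].
    repeat (apply Forall_cons || apply Forall_nil); split; simpl;
      auto using free_space_adjacent, signed_space_reachable.
Qed.

Lemma machine_input_spaces (Q : cmd) (t : tree) (q : qspace) :
  In q (qspaces (input_model (machine_input Q t))) ->
  q = signed_space \/ q = free_space.
Proof.
  cbn [machine_input instance input_model qspaces]; rewrite in_app_iff, in_map_iff.
  intros [(w & <- & Hw) | H].
  - pose proof (wf_base_vars Q) as F; rewrite Forall_forall in F; now apply F.
  - right; now apply repeat_spec in H.
Qed.

Lemma nvars_machine_input (Q : cmd) (t : tree) :
  nvars (input_model (machine_input Q t)) = (cells t + length (base_vars Q))%nat.
Proof.
  unfold nvars; cbn [machine_input instance input_model qspaces].
  rewrite length_app, length_map, repeat_length; lia.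
Qed.

(* Every constraint is algebraic except for the following. *)
Definition differential (m : nat) (c : constraint) : Prop :=
  c = Constant 1 None [] \/ c = Derivative 2 3 \/ c = Derivative 3 4 \/
  exists j, (j < m)%nat /\ (c = Derivative (20 + 4 * j) (21 + 4 * j) \/
    c = Derivative (22 + 4 * j) (23 + 4 * j)).

Lemma machine_input_constraints (Q : cmd) (t : tree) (c : constraint) :
  In c (constraints (input_model (machine_input Q t))) ->
  differential (2 * nvals Q) c \/
  algebraic (nvars (input_model (machine_input Q t))) c.
Proof.
  rewrite nvars_machine_input.
  cbn [machine_input instance input_model constraints]; unfold base_cons, model_cons.
  set (m := (2 * nvals Q)%nat).
  assert (HB : length (base_vars Q) =
    (length (goal_nodes (goals m (poly_of (machine_form Q)))) + (20 + 4 * m))%nat)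
    by apply length_model_vars.
  rewrite !in_app_iff; intros [H | [H | [H | H]]].
  - right; apply literal_algebraic in H; auto; lia.
  - assert (F : List.Forall (fun c => differential m c \/ algebraic 20 c) clock_cons).
    { unfold clock_cons; repeat (apply Forall_cons || apply Forall_nil);
        first [ right; cbn [algebraic]; lia | left; left; reflexivity
              | left; right; left; reflexivity | left; right; right; left; reflexivity ]. }
    rewrite Forall_forall in F; destruct (F c H) as [H' | H']; [now left | right].
    apply algebraic_le with (2 := H'); lia.
  - apply in_flat_map in H as (j & Hj & H); apply in_seq in Hj.
    unfold register_cons in H.
    destruct H as [<- | [<- | [<- | [<- | []]]]]; try (right; cbn [algebraic]; lia);
      left; right; right; right; exists j; split; auto; lia.
  - right; apply algebraic_le with (b := length (base_vars Q)); [lia|].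
    eapply goal_cons_algebraic; [| | |exact H]; try lia.
    intros g p Hg; apply goals_var in Hg as [Hg Hp]; [|apply pall_machine_poly].
    split; [lia|]; apply pall_impl with (2 := Hp).
    intros i Hi; apply relation_var_lt in Hi; lia.
Qed.

Lemma wf_machine_input (Q : cmd) (t : tree) : wf_input (machine_input Q t).
Proof.
  split; [|split].
  - intros q Hq; apply machine_input_spaces in Hq as [-> | ->];
      [apply wf_signed_space | apply wf_free_space].
  - intros c Hc; apply machine_input_constraints in Hc as [H | H].
    + set (M := input_model (machine_input Q t)).
      assert (HM : (20 + 4 * (2 * nvals Q) <= nvars M)%nat).
      { unfold M; rewrite nvars_machine_input; unfold base_vars.
        rewrite length_model_vars; lia. }
      destruct H as [-> | [-> | [-> | (j & Hj & [-> | ->])]]]; cbn [wf_constraint];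
        try lia.
      split; [lia|]; split; [discriminate | intros a []].
    + destruct c as [X Y Z [|]|X Y Z [|]| |]; cbn [algebraic] in H; try contradiction;
        (split; [|split; [|split]]; [apply H | apply H | apply H | intros ? ? ? []]).
  - unfold wf_state; cbn [machine_input instance input_model initial_state qspaces].
    apply Forall2_app.
    + pose proof (wf_base_vars Q) as F.
      induction F as [|w l Hw F IH]; constructor; [apply Hw | exact IH].
    + induction (cells t) as [|n IH]; constructor; [apply free_space_adjacent | exact IH].
Qed.

(** * Trajectories of an instance run the program *)

(** Continued as a constant to negative times, a one-sidedly continuous function is continuous at 0,
    and the mean value theorem applies on intervals that start there. *)
Definition extend (f : R -> R) (t : R) : R := f (Rmax 0 t).

Lemma extend_pos (f : R -> R) (t : R) : 0 <= t -> extend f t = f t.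
Proof. intros Ht; unfold extend; now rewrite Rmax_right. Qed.

Lemma continuity_extend (f : R -> R) :
  (forall t, 0 <= t -> continue_in f (time_domain p_infty) t) ->
  forall t, continuity_pt (extend f) t.
Proof.
  intros H t eps Heps.
  destruct (H (Rmax 0 t) (Rmax_l 0 t) eps Heps) as (d & Hd & Hlim).
  exists d; split; [exact Hd|]; intros u [_ Hu].
  unfold extend; simpl in *.
  destruct (Req_dec (Rmax 0 t) (Rmax 0 u)) as [E|E].
  - rewrite <- E, (proj2 (Rdist_refl _ _) eq_refl); exact Heps.
  - apply Hlim; split; [split; [split; [apply Rmax_l | exact I] | exact E]|].
    eapply Rle_lt_trans; [|exact Hu]; unfold Rdist, Rmax.
    destruct (Rle_dec 0 u), (Rle_dec 0 t); split_Rabs; lra.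
Qed.

Lemma is_derive_extend (f f' : R -> R) (t : R) :
  0 < t -> D_in f f' (time_domain p_infty) t -> is_derive (extend f) t (f' t).
Proof.
  intros Ht H; apply is_derive_Reals; intros eps Heps.
  destruct (H eps Heps) as (d & Hd & Hlim); simpl in Hlim.
  assert (Hm : 0 < Rmin d t) by now apply Rmin_pos.
  exists (mkposreal _ Hm); intros h Hh0 Hh; simpl in Hh.
  pose proof (Rmin_l d t); pose proof (Rmin_r d t).
  assert (Hth : 0 <= t + h) by (split_Rabs; lra).
  rewrite !extend_pos by lra.
  specialize (Hlim (t + h)); unfold Rdist in Hlim.
  replace (t + h - t) with h in Hlim by ring; apply Hlim.
  split; [split; [split; [exact Hth | exact I] | lra] | lra].
Qed.

Lemma null_derivative_eq (F : R -> R) (u v : R) :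
  u <= v -> (forall t, continuity_pt F t) ->
  (forall t, u < t < v -> is_derive F t 0) -> F u = F v.
Proof.
  intros Huv Hc Hd.
  destruct (MVT_gen F u v (fun _ => 0)) as (c & _ & E).
  - intros t Ht; rewrite Rmin_left, Rmax_right in Ht by lra; now apply Hd.
  - auto.
  - lra.
Qed.

(** A gate is nonzero only inside a quarter period, so a goal yields zeros only there; continuity
    carries them to the right end, where the registers are read. *)
Lemma continuity_zero_right (F : R -> R) (u v : R) :
  u < v -> continuity_pt F v -> (forall t, u < t < v -> F t = 0) -> F v = 0.
Proof.
  intros Huv Hc H0; destruct (Req_dec (F v) 0) as [E|E]; [exact E|exfalso].
  destruct (Hc (Rabs (F v)) (Rabs_pos_lt _ E)) as (d & Hd & Hlim).
  simpl in Hlim; unfold Rdist in Hlim.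
  set (t := v - Rmin (d / 2) ((v - u) / 2)).
  assert (Hm : 0 < Rmin (d / 2) ((v - u) / 2)) by (apply Rmin_pos; lra).
  pose proof (Rmin_l (d / 2) ((v - u) / 2)); pose proof (Rmin_r (d / 2) ((v - u) / 2)).
  specialize (Hlim t); rewrite (H0 t) in Hlim by (unfold t; lra).
  replace (0 - F v) with (- F v) in Hlim by ring; rewrite Rabs_Ropp in Hlim.
  apply (Rlt_irrefl (Rabs (F v))), Hlim; split; [split; [exact I | unfold t; lra]|].
  unfold t; split_Rabs; lra.
Qed.

Lemma constraint_holds_relates (v : nat -> Rbar) (x dx : nat -> R -> R) (t : R)
    (c : constraint) :
  constraint_holds v x dx t c -> relates (fun X => x X t) c.
Proof. destruct c; simpl; auto. Qed.

Lemma continuity_peval (n : nat) (x : nat -> R -> R) (p : poly) (t : R) :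
  (forall X, (X < n)%nat -> continuity_pt (extend (x X)) t) ->
  pall (fun X => (X < n)%nat) p ->
  continuity_pt (extend (fun t => peval (fun X => x X t) p)) t.
Proof.
  intros H; induction p as [i|p IHp q IHq|p IHp q IHq|p IHp q IHq];
    cbn [pall peval]; [apply H|intros [Hp Hq]..]; specialize (IHp Hp); specialize (IHq Hq).
  - exact (continuity_pt_plus _ _ t IHp IHq).
  - exact (continuity_pt_minus _ _ t IHp IHq).
  - exact (continuity_pt_mult _ _ t IHp IHq).
Qed.

Lemma machine_input_initial (Q : cmd) (a : tree) (X : nat) (w : qspace * qval) :
  nth_error (base_vars Q) X = Some w ->
  nth_error (initial_state (machine_input Q a)) X = Some (snd w).
Proof.
  intros H; cbn [machine_input instance initial_state].
  rewrite nth_error_app1.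
  - now rewrite nth_error_map, H.
  - rewrite length_map; apply nth_error_Some; congruence.
Qed.

Lemma solution_never_prints (Q : cmd) (a : tree) (v : nat -> Rbar)
    (x dx : nat -> R -> R) :
  is_solution (machine_input Q a) p_infty v x dx ->
  forall i, ~ prints_nonnil (run Q a i).
Proof.
  intros [_ _ HC1 Hcon _ [_ Hinit]].
  set (m := (2 * nvals Q)%nat).
  assert (HB : length (base_vars Q) =
    (length (goal_nodes (goals m (poly_of (machine_form Q)))) + (20 + 4 * m))%nat)
    by apply length_model_vars.
  assert (Hdom : forall t, 0 <= t -> time_domain p_infty t) by (split; [auto | exact I]).
  rewrite nvars_machine_input in HC1.
  assert (Hcont : forall X, (X < length (base_vars Q))%nat ->
    forall t, continuity_pt (extend (x X)) t).
  { intros X HX; apply continuity_extend; intros t Ht.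
    apply cont_deriv with (dx X), HC1; auto; lia. }
  assert (Hder : forall X t, (X < length (base_vars Q))%nat -> 0 < t ->
    is_derive (extend (x X)) t (dx X t)).
  { intros X t HX Ht; apply is_derive_extend; [exact Ht|].
    apply HC1; [lia | apply Hdom; lra]. }
  assert (Hclock : forall t c, 0 <= t -> In c clock_cons -> constraint_holds v x dx t c).
  { intros t c Ht Hc; apply Hcon; [auto|].
    cbn [machine_input instance input_model constraints]; unfold base_cons, model_cons.
    rewrite !in_app_iff; auto. }
  assert (Hreg : forall t c j, 0 <= t -> (j < m)%nat -> In c (register_cons j) ->
    constraint_holds v x dx t c).
  { intros t c j Ht Hj Hc; apply Hcon; [auto|].
    cbn [machine_input instance input_model constraints]; unfold base_cons, model_cons.
    fold m; rewrite !in_app_iff, in_flat_map; right; right; left.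
    exists j; split; [apply in_seq; lia | exact Hc]. }
  assert (H0 : forall t, 0 <= t -> x 0%nat t = 0).
  { intros t Ht; pose proof (Hclock t (Add 0 0 0 []) Ht (or_introl eq_refl)) as H.
    cbn [constraint_holds] in H; lra. }
  assert (Hgoal : forall t g p, 0 <= t -> In (g, p) (goals m (poly_of (machine_form Q))) ->
    x g t * peval (fun X => x X t) p = 0).
  { intros t g p Ht Hg.
    apply (goal_cons_sound (fun X => x X t)
      (goals m (poly_of (machine_form Q))) (20 + 4 * m)); auto.
    intros c Hc; apply (constraint_holds_relates v x dx), Hcon; [auto|].
    cbn [machine_input instance input_model constraints]; unfold base_cons, model_cons.
    fold m; rewrite !in_app_iff; auto. }
  assert (Hdata : forall t, 0 <= t -> relates (fun X => x X t) (Mult 1 1 1 []) /\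
    dx 1%nat t = 0 /\ forall c, In c (literal a 19 (length (base_vars Q))) ->
      relates (fun X => x X t) c).
  { intros t Ht; split; [|split].
    - apply (Hclock t (Mult 1 1 1 [])); simpl; tauto.
    - apply (Hclock t (Constant 1 None [])); simpl; tauto.
    - intros c Hc; apply (constraint_holds_relates v x dx), Hcon; [auto|].
      cbn [machine_input instance input_model constraints].
      rewrite in_app_iff; auto. }
  assert (Hval : forall X w, nth_error (base_vars Q) X = Some w ->
    qmag_holds v (fst (snd w)) (x X 0)).
  { intros X w HX; apply machine_input_initial with (a := a) in HX.
    destruct (Hinit X _ HX) as (y & d & Hy & _ & Hm & _); simpl in Hy; now subst y. }
  assert (Hone : forall t, 0 <= t -> x 1%nat t = 1).
  { intros t Ht.
    assert (E : extend (x 1%nat) 0 = extend (x 1%nat) t).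
    { apply null_derivative_eq; [exact Ht | apply Hcont; lia|].
      intros u Hu; destruct (Hdata u ltac:(lra)) as (_ & E & _); rewrite <- E.
      apply Hder; [lia | lra]. }
    rewrite !extend_pos in E by lra; rewrite <- E.
    destruct (Hdata 0 ltac:(lra)) as (E1 & _ & _); cbn [relates] in E1.
    pose proof (Hval 1%nat _ eq_refl) as [Hp _]; simpl in Hp; nra. }
  assert (HK : forall t, 0 <= t -> x 19%nat t = INR (code a)).
  { intros t Ht; apply (literal_sound (fun X => x X t) a 19 (length (base_vars Q))); auto.
    now apply Hdata. }
  assert (Hs0 : x 2%nat 0 = 0).
  { pose proof (Hval 2%nat _ eq_refl) as H; simpl in H; now injection H. }
  assert (Hc0 : 0 < x 3%nat 0) by (pose proof (Hval 3%nat _ eq_refl) as [H _]; exact H).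
  set (A := x 3%nat 0) in *.
  assert (Hsc : forall t, 0 <= t -> x 2%nat t = A * sin t /\ x 3%nat t = A * cos t).
  { intros t Ht.
    assert (Hsin : forall u, 0 < u -> is_derive (extend (x 2%nat)) u (extend (x 3%nat) u)).
    { intros u Hu; rewrite extend_pos by lra.
      replace (x 3%nat u) with (dx 2%nat u); [apply Hder; [lia | lra]|].
      apply (Hclock u (Derivative 2 3)); simpl; [lra | tauto]. }
    assert (Hcos : forall u, 0 < u -> is_derive (extend (x 3%nat)) u (- extend (x 2%nat) u)).
    { intros u Hu; rewrite extend_pos by lra.
      replace (- x 2%nat u) with (dx 3%nat u); [apply Hder; [lia | lra]|].
      pose proof (Hclock u (Derivative 3 4) ltac:(lra) ltac:(simpl; tauto)) as H1.
      pose proof (Hclock u (Add 2 4 0 []) ltac:(lra) ltac:(simpl; tauto)) as H2.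
      cbn [constraint_holds] in H1, H2; rewrite H0 in H2 by lra; lra. }
    assert (Cs : forall u, continuity_pt (extend (x 2%nat)) u) by (apply Hcont; lia).
    assert (Cc : forall u, continuity_pt (extend (x 3%nat)) u) by (apply Hcont; lia).
    (* Rotating the pair back by the angle [u] gives two functions with derivative 0; by the initial
       values they are 0 and [A]. *)
    assert (E1 : (fun u => extend (x 2%nat) u * cos u - extend (x 3%nat) u * sin u) 0 =
      (fun u => extend (x 2%nat) u * cos u - extend (x 3%nat) u * sin u) t).
    { refine (null_derivative_eq (fun u => extend (x 2%nat) u * cos u - extend (x 3%nat) u * sin u) 0 t Ht _ _).
      - intros u; apply continuity_pt_minus; apply continuity_pt_mult; auto;
          [apply continuity_cos | apply continuity_sin].
      - intros u Hu; auto_derive.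
        + split; [eexists; apply Hsin; lra|]; split; [eexists; apply Hcos; lra | exact I].
        + change (Derive (fun u => extend (x 2%nat) u)) with (Derive (extend (x 2%nat))).
          change (Derive (fun u => extend (x 3%nat) u)) with (Derive (extend (x 3%nat))).
          rewrite (is_derive_unique _ _ _ (Hsin u ltac:(lra))),
            (is_derive_unique _ _ _ (Hcos u ltac:(lra))); ring. }
    assert (E2 : (fun u => extend (x 2%nat) u * sin u + extend (x 3%nat) u * cos u) 0 =
      (fun u => extend (x 2%nat) u * sin u + extend (x 3%nat) u * cos u) t).
    { refine (null_derivative_eq (fun u => extend (x 2%nat) u * sin u + extend (x 3%nat) u * cos u) 0 t Ht _ _).
      - intros u; apply continuity_pt_plus; apply continuity_pt_mult; auto;
          [apply continuity_sin | apply continuity_cos].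
      - intros u Hu; auto_derive.
        + split; [eexists; apply Hsin; lra|]; split; [eexists; apply Hcos; lra | exact I].
        + change (Derive (fun u => extend (x 2%nat) u)) with (Derive (extend (x 2%nat))).
          change (Derive (fun u => extend (x 3%nat) u)) with (Derive (extend (x 3%nat))).
          rewrite (is_derive_unique _ _ _ (Hsin u ltac:(lra))),
            (is_derive_unique _ _ _ (Hcos u ltac:(lra))); ring. }
    cbv beta in E1, E2; rewrite !extend_pos in E1, E2 by lra.
    rewrite Hs0, sin_0, cos_0 in E1, E2; fold A in E1, E2.
    pose proof (sin2_cos2 t) as E3; unfold Rsqr in E3.
    set (S := x 2%nat t) in *; set (C := x 3%nat t) in *.
    set (si := sin t) in *; set (co := cos t) in *.
    split.
    - transitivity (S * (si * si + co * co)); [rewrite E3; ring|].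
      transitivity (si * (S * si + C * co) + co * (S * co - C * si)); [ring|].
      rewrite <- E1, <- E2; ring.
    - transitivity (C * (si * si + co * co)); [rewrite E3; ring|].
      transitivity (co * (S * si + C * co) - si * (S * co - C * si)); [ring|].
      rewrite <- E1, <- E2; ring. }
  (* From a^2 = b^2 + s^3: if a vanished where s > 0, then b^2 would be negative. The other three
     cases are alike. *)
  assert (Hpart : forall t, 0 <= t ->
    (0 < sin t -> x 7%nat t <> 0) /\ (sin t < 0 -> x 8%nat t <> 0) /\
    (0 < cos t -> x 13%nat t <> 0) /\ (cos t < 0 -> x 14%nat t <> 0)).
  { intros t Ht; destruct (Hsc t Ht) as [Es Ec].
    pose proof (Hclock t (Mult 2 2 5 []) Ht ltac:(simpl; tauto)) as E1.
    pose proof (Hclock t (Mult 5 2 6 []) Ht ltac:(simpl; tauto)) as E2.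
    pose proof (Hclock t (Mult 7 7 9 []) Ht ltac:(simpl; tauto)) as E3.
    pose proof (Hclock t (Mult 8 8 10 []) Ht ltac:(simpl; tauto)) as E4.
    pose proof (Hclock t (Add 10 6 9 []) Ht ltac:(simpl; tauto)) as E5.
    pose proof (Hclock t (Mult 3 3 11 []) Ht ltac:(simpl; tauto)) as F1.
    pose proof (Hclock t (Mult 11 3 12 []) Ht ltac:(simpl; tauto)) as F2.
    pose proof (Hclock t (Mult 13 13 15 []) Ht ltac:(simpl; tauto)) as F3.
    pose proof (Hclock t (Mult 14 14 16 []) Ht ltac:(simpl; tauto)) as F4.
    pose proof (Hclock t (Add 16 12 15 []) Ht ltac:(simpl; tauto)) as F5.
    cbn [constraint_holds] in *.
    rewrite <- E3, <- E4, <- E2, <- E1, Es in E5.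
    rewrite <- F3, <- F4, <- F2, <- F1, Ec in F5.
    assert (HA : 0 < A * A * A) by (repeat apply Rmult_lt_0_compat; exact Hc0).
    assert (Hpos : forall y, 0 < y -> 0 < A * y * (A * y) * (A * y))
      by (intros y Hy; repeat apply Rmult_lt_0_compat; assumption).
    split; [|split; [|split]]; intros H E.
    - rewrite E in E5; specialize (Hpos _ H).
      pose proof (Rle_0_sqr (x 8%nat t)) as Hq; unfold Rsqr in Hq; lra.
    - rewrite E in E5; specialize (Hpos (- sin t) ltac:(lra)).
      pose proof (Rle_0_sqr (x 7%nat t)) as Hq; unfold Rsqr in Hq.
      replace (A * - sin t * (A * - sin t) * (A * - sin t))
        with (- (A * sin t * (A * sin t) * (A * sin t))) in Hpos by ring; lra.
    - rewrite E in F5; specialize (Hpos _ H).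
      pose proof (Rle_0_sqr (x 14%nat t)) as Hq; unfold Rsqr in Hq; lra.
    - rewrite E in F5; specialize (Hpos (- cos t) ltac:(lra)).
      pose proof (Rle_0_sqr (x 13%nat t)) as Hq; unfold Rsqr in Hq.
      replace (A * - cos t * (A * - cos t) * (A * - cos t))
        with (- (A * cos t * (A * cos t) * (A * cos t))) in Hpos by ring; lra. }
  pose proof PI_RGT_0 as HPI.
  assert (Hn : forall n, 0 <= INR n * PI)
    by (intros n; pose proof (pos_INR n); nra).
  assert (Hxconst : forall n j, (j < m)%nat ->
    x (20 + 4 * j)%nat (0 + 2 * INR n * PI) = x (20 + 4 * j)%nat (PI + 2 * INR n * PI)).
  { intros n j Hj; specialize (Hn n).
    rewrite <- (extend_pos (x (20 + 4 * j)%nat) (0 + _)) by lra.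
    rewrite <- (extend_pos (x (20 + 4 * j)%nat) (PI + _)) by lra.
    apply null_derivative_eq; [lra | apply Hcont; lia|].
    intros u Hu.
    pose proof (Hreg u (Derivative (20 + 4 * j) (21 + 4 * j)) j ltac:(lra) Hj
      ltac:(simpl; tauto)) as E1.
    pose proof (Hreg u (Mult 7 (21 + 4 * j) 0 []) j ltac:(lra) Hj
      ltac:(simpl; tauto)) as E2.
    cbn [constraint_holds] in E1, E2; rewrite H0 in E2 by lra.
    apply Rmult_integral in E2 as [E2 | E2].
    - exfalso; revert E2; apply Hpart; [lra|].
      replace u with ((u - 2 * INR n * PI) + 2 * INR n * PI) by ring.
      rewrite sin_period; apply sin_gt_0; lra.
    - rewrite <- E2, <- E1; apply Hder; [lia | lra]. }
  assert (Hyconst : forall n j, (j < m)%nat ->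
    x (22 + 4 * j)%nat (PI + 2 * INR n * PI) =
    x (22 + 4 * j)%nat (2 * PI + 2 * INR n * PI)).
  { intros n j Hj; specialize (Hn n).
    rewrite <- (extend_pos (x (22 + 4 * j)%nat) (PI + _)) by lra.
    rewrite <- (extend_pos (x (22 + 4 * j)%nat) (2 * PI + _)) by lra.
    apply null_derivative_eq; [lra | apply Hcont; lia|].
    intros u Hu.
    pose proof (Hreg u (Derivative (22 + 4 * j) (23 + 4 * j)) j ltac:(lra) Hj
      ltac:(simpl; tauto)) as E1.
    pose proof (Hreg u (Mult 8 (23 + 4 * j) 0 []) j ltac:(lra) Hj
      ltac:(simpl; tauto)) as E2.
    cbn [constraint_holds] in E1, E2; rewrite H0 in E2 by lra.
    apply Rmult_integral in E2 as [E2 | E2].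
    - exfalso; revert E2; apply Hpart; [lra|].
      replace u with ((u - 2 * INR n * PI) + 2 * INR n * PI) by ring.
      rewrite sin_period; apply sin_lt_0; lra.
    - rewrite <- E2, <- E1; apply Hder; [lia | lra]. }
  assert (Hvan : forall g p u w, In (g, p) (goals m (poly_of (machine_form Q))) ->
    0 <= u < w -> (forall t, u < t < w -> x g t <> 0) ->
    peval (fun X => x X w) p = 0).
  { intros g p u w Hg Huw Hnz.
    rewrite <- (extend_pos (fun t => peval (fun X => x X t) p) w) by lra.
    apply continuity_zero_right with (u := u); [lra| |].
    - apply (continuity_peval (length (base_vars Q))); [intros; now apply Hcont|].
      apply goals_var in Hg as [_ Hg]; [|apply pall_machine_poly].
      apply pall_impl with (2 := Hg).
      intros i Hi; apply relation_var_lt in Hi; lia.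
    - intros t Ht; rewrite extend_pos by lra.
      destruct (Rmult_integral _ _ (Hgoal t g p ltac:(lra) Hg)) as [E | E]; [|exact E].
      now apply Hnz in E. }
  assert (Hxy : forall n j, (j < m)%nat ->
    x (20 + 4 * j)%nat (2 * PI + 2 * INR n * PI) =
    x (22 + 4 * j)%nat (2 * PI + 2 * INR n * PI)).
  { intros n j Hj; specialize (Hn n).
    apply Rminus_diag_uniq.
    apply (Hvan 18%nat (PSub (vx j) (vy j)) (3 * (PI / 2) + 2 * INR n * PI)).
    - right; apply in_map_iff; exists j; split; [reflexivity | apply in_seq; lia].
    - lra.
    - intros u Hu.
      pose proof (Hclock u (Mult 8 13 18 []) ltac:(lra) ltac:(simpl; tauto)) as E.
      cbn [constraint_holds] in E; rewrite <- E.
      (* The shift by one more period brings the angle between - PI / 2 and 0, where the sine is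
         negative and the cosine positive. *)
      apply Rmult_integral_contrapositive_currified; apply Hpart; try lra;
        replace u with ((u - 2 * PI - 2 * INR n * PI) + 2 * INR (S n) * PI)
          by (rewrite S_INR; ring).
      + rewrite sin_period; apply sin_lt_0_var; lra.
      + rewrite cos_period; apply cos_gt_0; lra. }
  (* Registers are read at the odd multiples of PI, where the second quarter ends: the x copy still
     has its value from the start of the period, the y copy already the one on which both agree at
     its end. *)
  apply (machine_form_sound Q a (fun n X => x X (PI + 2 * INR n * PI))); fold m.
  - intros n; specialize (Hn n); split; [|split].
    + apply H0; lra.
    + apply Hone; lra.
    + apply HK; lra.
  - intros n j Hj; rewrite Hyconst, <- Hxy by exact Hj.
    rewrite <- Hxconst, S_INR by exact Hj; f_equal; ring.
  - intros j Hj; rewrite <- Hxconst by exact Hj.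
    replace (0 + 2 * INR 0 * PI) with 0 by (simpl; ring).
    pose proof (nth_model_vars_register m (poly_of (machine_form Q)) j 0 Hj ltac:(lia)) as E.
    apply Hval in E; simpl in E; now injection E.
  - intros n; specialize (Hn n); apply peval_poly_of; [apply Hone; lra|].
    apply (Hvan 17%nat _ (PI / 2 + 2 * INR n * PI)); [now left | lra|].
    intros u Hu.
    pose proof (Hclock u (Mult 7 14 17 []) ltac:(lra) ltac:(simpl; tauto)) as E.
    cbn [constraint_holds] in E; rewrite <- E.
    apply Rmult_integral_contrapositive_currified; apply Hpart; try lra;
      replace u with ((u - 2 * INR n * PI) + 2 * INR n * PI) by ring.
    + rewrite sin_period; apply sin_gt_0; lra.
    + rewrite cos_period; apply cos_lt_0; lra.
Qed.

(** * Germs of constant sign *)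

Definition dirof (d : R) : qdir :=
  if Rlt_dec 0 d then Inc else if Rlt_dec d 0 then Dec else Std.

Lemma dirof_holds (d : R) : qdir_holds (dirof d) d.
Proof.
  unfold dirof; destruct (Rlt_dec 0 d); [assumption|].
  destruct (Rlt_dec d 0); [assumption | simpl; lra].
Qed.

Lemma dirof_unique (w : qdir) (d : R) : qdir_holds w d -> dirof d = w.
Proof.
  unfold dirof; destruct w, (Rlt_dec 0 d), (Rlt_dec d 0); simpl; intros; auto; lra.
Qed.

(** Excludes oscillations like that of h sin (1 / h) at 0, under which the qualitative state would
    change infinitely often in bounded time. The value at 0 itself does not enter. *)
Definition germ0 (g : R -> R) : Prop :=
  exists eps w, 0 < eps /\ forall h, 0 < h < eps -> qdir_holds w (g h).

(* The left germ is obtained for [sg = -1]. *)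
Definition germ (f : R -> R) (t : R) : Prop :=
  forall sg, germ0 (fun h => f (t + sg * h)).

Lemma germ0_ext (f g : R -> R) (eps : R) :
  0 < eps -> (forall h, 0 < h < eps -> f h = g h) -> germ0 f -> germ0 g.
Proof.
  intros He E (e & w & He' & H); exists (Rmin e eps), w.
  split; [now apply Rmin_pos|]; intros h Hh.
  pose proof (Rmin_l e eps); pose proof (Rmin_r e eps).
  rewrite <- E by lra; apply H; lra.
Qed.

Lemma germ0_const (c : R) : germ0 (fun _ => c).
Proof. exists 1, (dirof c); split; [lra|]; intros; apply dirof_holds. Qed.

Definition qdir_mult (w w' : qdir) : qdir :=
  match w, w' with
  | Inc, Inc | Dec, Dec => Inc
  | Inc, Dec | Dec, Inc => Dec
  | _, _ => Std
  end.

Lemma germ0_mult (f g : R -> R) : germ0 f -> germ0 g -> germ0 (fun h => f h * g h).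
Proof.
  intros (e & w & He & Hf) (e' & w' & He' & Hg).
  exists (Rmin e e'), (qdir_mult w w'); split; [now apply Rmin_pos|]; intros h Hh.
  pose proof (Rmin_l e e'); pose proof (Rmin_r e e').
  specialize (Hf h ltac:(lra)); specialize (Hg h ltac:(lra)).
  destruct w, w'; simpl in *; nra.
Qed.

Lemma germ0_map (F : R -> R) (f : R -> R) :
  (forall a b, dirof a = dirof b -> dirof (F a) = dirof (F b)) ->
  germ0 f -> germ0 (fun h => F (f h)).
Proof.
  intros HF (e & w & He & Hf).
  exists e, (dirof (F (f (e / 2)))); split; [exact He|]; intros h Hh.
  rewrite (HF (f (e / 2)) (f h)); [apply dirof_holds|].
  transitivity w; [|symmetry]; apply dirof_unique, Hf; lra.
Qed.

Lemma mean_value (g g' : R -> R) (a b : R) :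
  a < b -> (forall h, a <= h <= b -> is_derive g h (g' h)) ->
  exists c, a <= c <= b /\ g b - g a = g' c * (b - a).
Proof.
  intros Hab H.
  destruct (MVT_gen g a b g') as (c & Hc & E).
  - intros t Ht; rewrite Rmin_left, Rmax_right in Ht by lra; apply H; lra.
  - intros t Ht; rewrite Rmin_left, Rmax_right in Ht by lra.
    apply derivable_continuous_pt; exists (g' t); apply is_derive_Reals, H; lra.
  - rewrite Rmin_left, Rmax_right in Hc by lra; now exists c.
Qed.

(** Close to 0 the function is strictly monotone or constant. If it increases and is somewhere
    nonpositive, it is negative before that point; otherwise it is positive throughout. No
    continuity at 0 is involved. *)
Lemma germ0_derive (g g' : R -> R) (eps : R) :
  0 < eps -> (forall h, 0 < h < eps -> is_derive g h (g' h)) ->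
  germ0 g' -> germ0 g.
Proof.
  intros He Hd (e & w & He' & Hw).
  set (d := Rmin e eps).
  assert (Hdp : 0 < d) by now apply Rmin_pos.
  assert (d <= e) by apply Rmin_l; assert (d <= eps) by apply Rmin_r.
  assert (HM : forall a b, 0 < a -> a < b -> b < d ->
    exists c, qdir_holds w (g' c) /\ g b - g a = g' c * (b - a)).
  { intros a b Ha Hab Hb.
    destruct (mean_value g g' a b Hab) as (c & Hc & E).
    - intros h Hh; apply Hd; lra.
    - exists c; split; [apply Hw; lra | exact E]. }
  destruct w.
  - destruct (classic (exists h0, 0 < h0 < d /\ g h0 <= 0))
      as [(h0 & Hh0 & Hg) | Hn].
    + exists h0, Dec; split; [lra|]; intros h Hh.
      destruct (HM h h0) as (c & Hc & E); try lra; simpl in *; nra.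
    + exists d, Inc; split; [lra|]; intros h Hh; simpl.
      destruct (Rlt_dec 0 (g h)); [assumption|].
      exfalso; apply Hn; exists h; split; lra.
  - destruct (classic (exists h0, 0 < h0 < d /\ 0 <= g h0))
      as [(h0 & Hh0 & Hg) | Hn].
    + exists h0, Inc; split; [lra|]; intros h Hh.
      destruct (HM h h0) as (c & Hc & E); try lra; simpl in *; nra.
    + exists d, Dec; split; [lra|]; intros h Hh; simpl.
      destruct (Rlt_dec (g h) 0); [assumption|].
      exfalso; apply Hn; exists h; split; lra.
  - exists d, (dirof (g (d / 2))); split; [lra|]; intros h Hh.
    replace (g h) with (g (d / 2)); [apply dirof_holds|].
    destruct (Rtotal_order h (d / 2)) as [L | [-> | L]]; [|reflexivity|].
    + destruct (HM h (d / 2)) as (c & Hc & E); try lra; simpl in Hc; rewrite Hc in E; lra.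
    + destruct (HM (d / 2) h) as (c & Hc & E); try lra; simpl in Hc; rewrite Hc in E; lra.
Qed.

Lemma germ_mult (f g : R -> R) (t : R) :
  germ f t -> germ g t -> germ (fun u => f u * g u) t.
Proof. intros Hf Hg sg; exact (germ0_mult _ _ (Hf sg) (Hg sg)). Qed.

Lemma germ_const (c t : R) : germ (fun _ => c) t.
Proof. intros sg; apply germ0_const. Qed.

Lemma germ_map (F : R -> R) (f : R -> R) (t : R) :
  (forall a b, dirof a = dirof b -> dirof (F a) = dirof (F b)) ->
  germ f t -> germ (fun u => F (f u)) t.
Proof. intros HF Hf sg; exact (germ0_map F _ HF (Hf sg)). Qed.

Lemma germ_opp (f : R -> R) (t : R) : germ f t -> germ (fun u => - f u) t.
Proof.
  apply germ_map; intros a b; unfold dirof.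
  destruct (Rlt_dec 0 a), (Rlt_dec 0 b), (Rlt_dec a 0), (Rlt_dec b 0);
    try discriminate; try lra; intros _;
    destruct (Rlt_dec 0 (- a)), (Rlt_dec 0 (- b)), (Rlt_dec (- a) 0), (Rlt_dec (- b) 0);
    try reflexivity; lra.
Qed.

Lemma germ_sqrt (f : R -> R) (t : R) : germ f t -> germ (fun u => sqrt (f u)) t.
Proof.
  apply germ_map; intros a b H.
  (* [sqrt] is 0 on negative numbers, so the sign of the root depends on the sign of the argument
     alone. *)
  assert (E : forall a, dirof (sqrt a) = if Rlt_dec 0 a then Inc else Std).
  { clear; intros a; apply dirof_unique; destruct (Rlt_dec 0 a) as [H|H]; simpl.
    - now apply sqrt_lt_R0.
    - apply sqrt_neg_0; lra. }
  rewrite !E; unfold dirof in H.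
  destruct (Rlt_dec 0 a), (Rlt_dec 0 b); try reflexivity;
    [destruct (Rlt_dec b 0) | destruct (Rlt_dec a 0)]; discriminate.
Qed.

Lemma germ_derive (f f' : R -> R) (t : R) :
  (forall u, is_derive f u (f' u)) -> germ f' t -> germ f t.
Proof.
  intros Hd H sg.
  apply germ0_derive with (g' := fun h => sg * f' (t + sg * h)) (eps := 1); [lra| |].
  - intros h _; apply (is_derive_comp f (fun h => t + sg * h)); [apply Hd|].
    auto_derive; [exact I | ring].
  - apply germ0_mult; [apply germ0_const | apply H].
Qed.

Lemma germ_continuous_neq0 (f : R -> R) (t : R) :
  continuity_pt f t -> f t <> 0 -> germ f t.
Proof.
  intros Hc Hn sg.
  destruct (Hc (Rabs (f t)) (Rabs_pos_lt _ Hn)) as (d & Hd & Hlim).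
  simpl in Hlim; unfold Rdist in Hlim.
  pose proof (Rabs_pos sg) as Hsg.
  exists (d / (Rabs sg + 1)), (dirof (f t)); split; [apply Rdiv_lt_0_compat; lra|].
  intros h Hh.
  assert (Hsh : Rabs (sg * h) < d).
  { rewrite Rabs_mult, (Rabs_pos_eq h) by lra.
    assert (h * (Rabs sg + 1) < d).
    { apply Rmult_lt_reg_r with (/ (Rabs sg + 1)); [apply Rinv_0_lt_compat; lra|].
      rewrite Rmult_assoc, Rinv_r by lra; unfold Rdiv in Hh; lra. }
    nra. }
  assert (Hf : Rabs (f (t + sg * h) - f t) < Rabs (f t)).
  { destruct (Req_dec (sg * h) 0) as [E|E].
    - rewrite E, Rplus_0_r, Rminus_diag, Rabs_R0; now apply Rabs_pos_lt.
    - apply Hlim; split; [split; [exact I | lra]|].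
      now replace (t + sg * h - t) with (sg * h) by ring. }
  unfold dirof; destruct (Rlt_dec 0 (f t)); [|destruct (Rlt_dec (f t) 0)];
    simpl; split_Rabs; lra.
Qed.

(** * Piecewise polynomial functions *)

(** Degree below [n], expressed by the vanishing of the n-th derivative. No coefficients occur, and
    the sign near a point follows by iterating [germ0_derive]. *)
Fixpoint polynomial (n : nat) (f : R -> R) : Prop :=
  match n with
  | O => forall t, f t = 0
  | S n => exists f', (forall t, is_derive f t (f' t)) /\ polynomial n f'
  end.

Lemma polynomial_S (n : nat) : forall f, polynomial n f -> polynomial (S n) f.
Proof.
  induction n as [|n IH]; intros f; simpl.
  - intros H; exists (fun _ => 0); split; [|auto].
    intros t; apply is_derive_ext with (fun _ => 0); [auto|].
    apply (is_derive_const 0).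
  - intros (f' & Hd & H); exists f'; split; [exact Hd|]; now apply IH.
Qed.

Lemma polynomial_le (n m : nat) (f : R -> R) :
  (n <= m)%nat -> polynomial n f -> polynomial m f.
Proof. induction 1; auto using polynomial_S. Qed.

Lemma polynomial_plus (n : nat) : forall f g,
  polynomial n f -> polynomial n g -> polynomial n (fun t => f t + g t).
Proof.
  induction n as [|n IH]; simpl; intros f g.
  - intros Hf Hg t; rewrite Hf, Hg; ring.
  - intros (f' & Df & Hf) (g' & Dg & Hg); exists (fun t => f' t + g' t); split; [|auto].
    intros t; apply (is_derive_plus f g); auto.
Qed.

Lemma polynomial_opp (n : nat) : forall f,
  polynomial n f -> polynomial n (fun t => - f t).
Proof.
  induction n as [|n IH]; simpl; intros f.
  - intros Hf t; rewrite Hf; ring.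
  - intros (f' & Df & Hf); exists (fun t => - f' t); split; [|auto].
    intros t; apply (is_derive_opp f); auto.
Qed.

Lemma polynomial_mult (n m : nat) (f g : R -> R) :
  polynomial n f -> polynomial m g -> polynomial (n + m) (fun t => f t * g t).
Proof.
  remember (n + m)%nat as k eqn:E; revert n m f g E.
  induction k as [|k IH]; intros n m f g E Hf Hg.
  - destruct n; [|lia]; simpl in *; intros t; rewrite Hf; ring.
  - destruct n as [|n].
    { apply (polynomial_le 0); [lia|]; simpl in *; intros t; rewrite Hf; ring. }
    destruct m as [|m].
    { apply (polynomial_le 0); [lia|]; simpl in *; intros t; rewrite Hg; ring. }
    pose proof Hf as (f' & Df & Hf'); pose proof Hg as (g' & Dg & Hg').
    exists (fun t => f' t * g t + f t * g' t); split.
    + intros t; apply (is_derive_mult f g); auto; intros; apply Rmult_comm.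
    + apply polynomial_plus; [apply (IH n (S m)) | apply (IH (S n) m)]; auto; lia.
Qed.

Lemma polynomial_affine (a b : R) : polynomial 2 (fun t => a * t + b).
Proof.
  exists (fun _ => a); split; [intros t; auto_derive; [exact I | ring]|].
  exists (fun _ => 0); split; [intros t; auto_derive; [exact I | ring] | intros t; reflexivity].
Qed.

Lemma polynomial_germ0 (n : nat) : forall f, polynomial n f -> germ0 f.
Proof.
  induction n as [|n IH]; simpl; intros f.
  - intros H; apply germ0_ext with (fun _ => 0) 1; [lra|auto|apply germ0_const].
  - intros (f' & Hd & H); apply germ0_derive with f' 1; [lra|auto|auto].
Qed.

(** Unlike [germ], this property is closed under sums, so it is the one to maintain for registers
    and for the values computed from them. The polynomials may differ on the two sides, and the
    value at [t] is left open. *)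
Definition piecewise_polynomial (f : R -> R) : Prop :=
  forall t sg, exists eps n p, 0 < eps /\ polynomial n p /\
    forall h, 0 < h < eps -> f (t + sg * h) = p h.

Lemma pp_germ (f : R -> R) (t : R) : piecewise_polynomial f -> germ f t.
Proof.
  intros H sg; destruct (H t sg) as (eps & n & p & He & Hp & E).
  apply germ0_ext with p eps; [exact He | | now apply (polynomial_germ0 n)].
  intros h Hh; symmetry; now apply E.
Qed.

Lemma pp_affine (a b : R) : piecewise_polynomial (fun t => a * t + b).
Proof.
  intros t sg; exists 1, 2%nat, (fun h => (a * sg) * h + (a * t + b)).
  split; [lra|]; split; [apply polynomial_affine | intros; ring].
Qed.

Lemma pp_const (c : R) : piecewise_polynomial (fun _ => c).
Proof.
  intros t sg; exists 1, 2%nat, (fun h => 0 * h + c).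
  split; [lra|]; split; [apply polynomial_affine | intros; ring].
Qed.

Lemma pp_plus (f g : R -> R) :
  piecewise_polynomial f -> piecewise_polynomial g ->
  piecewise_polynomial (fun t => f t + g t).
Proof.
  intros Hf Hg t sg.
  destruct (Hf t sg) as (e & n & p & He & Hp & Ep).
  destruct (Hg t sg) as (e' & n' & p' & He' & Hp' & Ep').
  exists (Rmin e e'), (n + n')%nat, (fun h => p h + p' h).
  split; [now apply Rmin_pos|]; split.
  - apply polynomial_plus; [apply (polynomial_le n) | apply (polynomial_le n')]; auto; lia.
  - intros h Hh; pose proof (Rmin_l e e'); pose proof (Rmin_r e e').
    rewrite Ep, Ep' by lra; reflexivity.
Qed.

Lemma pp_mult (f g : R -> R) :
  piecewise_polynomial f -> piecewise_polynomial g ->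
  piecewise_polynomial (fun t => f t * g t).
Proof.
  intros Hf Hg t sg.
  destruct (Hf t sg) as (e & n & p & He & Hp & Ep).
  destruct (Hg t sg) as (e' & n' & p' & He' & Hp' & Ep').
  exists (Rmin e e'), (n + n')%nat, (fun h => p h * p' h).
  split; [now apply Rmin_pos|]; split; [now apply polynomial_mult|].
  intros h Hh; pose proof (Rmin_l e e'); pose proof (Rmin_r e e').
  rewrite Ep, Ep' by lra; reflexivity.
Qed.

Lemma pp_opp (f : R -> R) :
  piecewise_polynomial f -> piecewise_polynomial (fun t => - f t).
Proof.
  intros Hf t sg; destruct (Hf t sg) as (e & n & p & He & Hp & Ep).
  exists e, n, (fun h => - p h); split; [exact He|]; split; [now apply polynomial_opp|].
  intros h Hh; now rewrite Ep.
Qed.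

Lemma pp_minus (f g : R -> R) :
  piecewise_polynomial f -> piecewise_polynomial g ->
  piecewise_polynomial (fun t => f t - g t).
Proof. intros Hf Hg; apply (pp_plus f); [exact Hf | now apply pp_opp]. Qed.

Lemma pp_ext (f g : R -> R) :
  (forall t, f t = g t) -> piecewise_polynomial f -> piecewise_polynomial g.
Proof.
  intros E H t sg; destruct (H t sg) as (e & n & p & He & Hp & Ep).
  exists e, n, p; split; [exact He|]; split; [exact Hp|].
  intros h Hh; now rewrite <- E, Ep.
Qed.

(** On either side of a point the polynomial piece keeps its sign for a while, so the maximum is the
    piece itself or 0. *)
Lemma pp_Rmax0 (f : R -> R) :
  piecewise_polynomial f -> piecewise_polynomial (fun t => Rmax 0 (f t)).
Proof.
  intros Hf t sg.
  destruct (Hf t sg) as (e & n & p & He & Hp & Ep).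
  destruct (polynomial_germ0 n p Hp) as (e' & w & He' & Hw).
  exists (Rmin e e').
  assert (Hm : 0 < Rmin e e') by now apply Rmin_pos.
  pose proof (Rmin_l e e'); pose proof (Rmin_r e e').
  destruct w.
  - exists n, p; split; [exact Hm|]; split; [exact Hp|]; intros h Hh.
    specialize (Hw h ltac:(lra)); simpl in Hw.
    rewrite Ep by lra; apply Rmax_right; lra.
  - exists 0%nat, (fun _ => 0); split; [exact Hm|]; split; [now simpl|]; intros h Hh.
    specialize (Hw h ltac:(lra)); simpl in Hw.
    rewrite Ep by lra; apply Rmax_left; lra.
  - exists 0%nat, (fun _ => 0); split; [exact Hm|]; split; [now simpl|]; intros h Hh.
    specialize (Hw h ltac:(lra)); simpl in Hw.
    rewrite Ep by lra; apply Rmax_left; lra.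
Qed.

Lemma pp_psum (F : nat -> R -> R) (n : nat) :
  (forall k, piecewise_polynomial (F k)) ->
  piecewise_polynomial (fun t => psum (fun k => F k t) n).
Proof.
  intros H; induction n as [|n IH]; simpl; [apply pp_const | now apply pp_plus].
Qed.

(** * Locally finite sums *)

(** Under [vanishes_before] the terms left out are 0 at time [t], so this is the whole infinite
    series. *)
Definition locsum (F : nat -> R -> R) (t : R) : R :=
  psum (fun k => F k t) (Z.to_nat (up t)).

Definition vanishes_before (F : nat -> R -> R) : Prop :=
  forall k t, t <= INR k -> F k t = 0.

Lemma psum_stable (f : nat -> R) (n m : nat) :
  (n <= m)%nat -> (forall k, (n <= k)%nat -> f k = 0) -> psum f m = psum f n.
Proof.
  intros Hnm H; induction Hnm as [|m Hm IH]; [reflexivity|].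
  simpl; rewrite IH, H by lia; ring.
Qed.

Lemma le_INR_up (t : R) : t <= INR (Z.to_nat (up t)).
Proof.
  pose proof (archimed t) as [H _].
  destruct (Z_le_gt_dec 0 (up t)) as [Hz|Hz].
  - rewrite INR_IZR_INZ, Z2Nat.id by lia; lra.
  - pose proof (pos_INR (Z.to_nat (up t))).
    assert (IZR (up t) <= 0) by (apply IZR_le; lia); lra.
Qed.

Lemma locsum_eq (F : nat -> R -> R) (t : R) (n : nat) :
  vanishes_before F -> t <= INR n -> locsum F t = psum (fun k => F k t) n.
Proof.
  intros HF Hn; unfold locsum; set (N := Z.to_nat (up t)).
  assert (HN : t <= INR N) by apply le_INR_up.
  rewrite <- (psum_stable _ N (Nat.max N n)), <- (psum_stable _ n (Nat.max N n));
    try lia; auto.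
  - intros k Hk; apply HF; apply le_INR in Hk; lra.
  - intros k Hk; apply HF; apply le_INR in Hk; lra.
Qed.

Lemma locsum_near (F : nat -> R -> R) (t u : R) :
  vanishes_before F -> Rabs (u - t) < 1 ->
  locsum F u = psum (fun k => F k u) (S (Z.to_nat (up t))).
Proof.
  intros HF H; apply locsum_eq; [exact HF|].
  pose proof (le_INR_up t); rewrite S_INR; split_Rabs; lra.
Qed.

Lemma is_derive_psum (F F' : nat -> R -> R) (n : nat) (t : R) :
  (forall k, is_derive (F k) t (F' k t)) ->
  is_derive (fun t => psum (fun k => F k t) n) t (psum (fun k => F' k t) n).
Proof.
  intros H; induction n as [|n IH]; simpl.
  - apply (is_derive_const 0).
  - apply (is_derive_plus (fun t => psum (fun k => F k t) n) (F n)); auto.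
Qed.

Lemma locally_dist (P : R -> Prop) (t : R) :
  (forall u, Rabs (u - t) < 1 -> P u) -> locally t P.
Proof. intros H; exists (mkposreal 1 Rlt_0_1); intros u Hu; apply H, Hu. Qed.

Lemma is_derive_locsum (F F' : nat -> R -> R) (t : R) :
  vanishes_before F -> vanishes_before F' ->
  (forall k, is_derive (F k) t (F' k t)) ->
  is_derive (locsum F) t (locsum F' t).
Proof.
  intros HF HF' Hd.
  rewrite (locsum_near F' t t HF') by (rewrite Rminus_diag, Rabs_R0; lra).
  apply is_derive_ext_loc with (fun u => psum (fun k => F k u) (S (Z.to_nat (up t)))).
  - apply locally_dist; intros u Hu; symmetry; now apply locsum_near.
  - now apply is_derive_psum.
Qed.

Lemma continuous_locsum (F : nat -> R -> R) (t : R) :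
  vanishes_before F -> (forall k, continuous (F k) t) -> continuous (locsum F) t.
Proof.
  intros HF Hc.
  apply continuous_ext_loc with (fun u => psum (fun k => F k u) (S (Z.to_nat (up t)))).
  - apply locally_dist; intros u Hu; symmetry; now apply locsum_near.
  - generalize (S (Z.to_nat (up t))) as n; intros n; induction n as [|n IH]; simpl.
    + apply continuous_const.
    + now apply (continuous_plus (fun u => psum (fun k => F k u) n) (F n)).
Qed.

Lemma pp_locsum (F : nat -> R -> R) :
  vanishes_before F -> (forall k, piecewise_polynomial (F k)) ->
  piecewise_polynomial (locsum F).
Proof.
  intros HF H t sg.
  destruct (pp_psum F (S (Z.to_nat (up t))) H t sg) as (e & n & p & He & Hp & Ep).
  pose proof (Rabs_pos sg) as Hsg.
  assert (He2 : 0 < / (Rabs sg + 1)) by (apply Rinv_0_lt_compat; lra).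
  exists (Rmin e (/ (Rabs sg + 1))), n, p; split; [now apply Rmin_pos|].
  split; [exact Hp|]; intros h Hh.
  pose proof (Rmin_l e (/ (Rabs sg + 1))); pose proof (Rmin_r e (/ (Rabs sg + 1))).
  rewrite (locsum_near F t); [apply Ep; lra | exact HF|].
  replace (t + sg * h - t) with (sg * h) by ring.
  rewrite Rabs_mult, (Rabs_pos_eq h) by lra.
  assert (h * (Rabs sg + 1) < 1).
  { apply Rmult_lt_reg_r with (/ (Rabs sg + 1)); [exact He2|].
    rewrite Rmult_assoc, Rinv_r by lra; lra. }
  nra.
Qed.

(** * Smooth steps *)

Lemma is_derive_Rmax0_pow (n : nat) (t : R) :
  (1 <= n)%nat -> is_derive (fun u => Rmax 0 u ^ S n) t (INR (S n) * Rmax 0 t ^ n).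
Proof.
  intros Hn; destruct (Rtotal_order t 0) as [H | [-> | H]].
  - rewrite Rmax_left, pow_i, Rmult_0_r by (lia || lra).
    apply is_derive_ext_loc with (fun _ => 0); [|apply (is_derive_const 0)].
    exists (mkposreal (- t) ltac:(lra)); intros u Hu.
    unfold ball in Hu; simpl in Hu; unfold AbsRing_ball, abs, minus, plus, opp in Hu.
    simpl in Hu; rewrite Rmax_left, pow_i by (lia || split_Rabs; lra); reflexivity.
  - apply is_derive_Reals; rewrite Rmax_left, (pow_i n), Rmult_0_r by (lia || lra).
    intros eps Heps.
    exists (mkposreal (Rmin eps 1) ltac:(apply Rmin_pos; lra)); intros h Hh0 Hh; simpl in Hh.
    pose proof (Rmin_l eps 1); pose proof (Rmin_r eps 1).
    rewrite Rplus_0_l, (Rmax_left 0 0), (pow_i (S n)), !Rminus_0_r by (lia || lra).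
    destruct (Rlt_dec 0 h) as [Hp|Hp].
    + rewrite Rmax_right by lra; simpl; unfold Rdiv.
      rewrite Rmult_comm, <- Rmult_assoc, Rinv_l, Rmult_1_l by lra.
      rewrite Rabs_pos_eq by (apply pow_le; lra).
      rewrite Rabs_pos_eq in Hh by lra.
      apply Rle_lt_trans with h; [|lra].
      destruct n as [|n]; [lia|]; simpl.
      assert (h ^ n <= 1) by (rewrite <- (pow1 n); apply pow_incr; lra); nra.
    + rewrite Rmax_left, pow_i by (lia || lra).
      unfold Rdiv; rewrite Rmult_0_l, Rabs_R0; exact Heps.
  - rewrite Rmax_right by lra.
    apply is_derive_ext_loc with (fun u => u ^ S n).
    + exists (mkposreal t H); intros u Hu.
      unfold ball in Hu; simpl in Hu; unfold AbsRing_ball, abs, minus, plus, opp in Hu.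
      simpl in Hu; rewrite Rmax_right by (split_Rabs; lra); reflexivity.
    + evar_last; [apply is_derive_Reals, derivable_pt_lim_pow|].
      now simpl pred.
Qed.

Definition pos_part (i u : R) : R := Rmax 0 (u - i).

(** A cubic spline with knots 0, 1, 3, 4. Its second derivative [smooth2] is a tent of height 1/2 on
    [0, 2] followed by the opposite tent on [2, 4], so that the first derivative returns to 0. The
    coefficients 1, -2, 2, -1 are twice the changes of slope of [smooth2], and 1/12 makes the total
    rise 1. *)
Definition smooth0 (u : R) : R :=
  (pos_part 0 u ^ 3 - 2 * pos_part 1 u ^ 3 + 2 * pos_part 3 u ^ 3 -
    pos_part 4 u ^ 3) * / 12.

Definition smooth1 (u : R) : R :=
  (pos_part 0 u ^ 2 - 2 * pos_part 1 u ^ 2 + 2 * pos_part 3 u ^ 2 -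
    pos_part 4 u ^ 2) * / 4.

Definition smooth2 (u : R) : R :=
  (pos_part 0 u - 2 * pos_part 1 u + 2 * pos_part 3 u - pos_part 4 u) * / 2.

Lemma is_derive_pos_part (i u : R) (n : nat) :
  (1 <= n)%nat ->
  is_derive (fun u => pos_part i u ^ S n) u (INR (S n) * pos_part i u ^ n).
Proof.
  intros Hn; unfold pos_part.
  evar_last.
  - apply (is_derive_comp (fun v => Rmax 0 v ^ S n) (fun u => u - i)).
    + now apply is_derive_Rmax0_pow.
    + auto_derive; [exact I | reflexivity].
  - unfold scal; simpl; unfold mult; simpl; ring.
Qed.

Lemma is_derive_comb (f0 f1 f3 f4 : R -> R) (d0 d1 d3 d4 c u : R) :
  is_derive f0 u d0 -> is_derive f1 u d1 -> is_derive f3 u d3 -> is_derive f4 u d4 ->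
  is_derive (fun u => (f0 u - 2 * f1 u + 2 * f3 u - f4 u) * c) u
    ((d0 - 2 * d1 + 2 * d3 - d4) * c).
Proof.
  intros H0 H1 H3 H4; auto_derive.
  - repeat split; eexists; eassumption.
  - replace (Derive (fun x => f0 x) u) with d0 by (symmetry; now apply is_derive_unique).
    replace (Derive (fun x => f1 x) u) with d1 by (symmetry; now apply is_derive_unique).
    replace (Derive (fun x => f3 x) u) with d3 by (symmetry; now apply is_derive_unique).
    replace (Derive (fun x => f4 x) u) with d4 by (symmetry; now apply is_derive_unique).
    ring.
Qed.

Lemma is_derive_smooth0 (u : R) : is_derive smooth0 u (smooth1 u).
Proof.
  evar_last.
  - apply is_derive_comb; apply is_derive_pos_part; lia.
  - unfold smooth1; simpl; field.
Qed.

Lemma is_derive_smooth1 (u : R) : is_derive smooth1 u (smooth2 u).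
Proof.
  evar_last.
  - apply is_derive_comb; apply is_derive_pos_part; lia.
  - unfold smooth2; simpl; field.
Qed.

Lemma continuous_pos_part (i u : R) : continuous (pos_part i) u.
Proof.
  apply (continuous_comp (fun u => u - i) (fun v => Rmax 0 v)).
  - apply (ex_derive_continuous (fun u => u - i)); auto_derive; exact I.
  - apply continuous_ext with (fun v => (v + Rabs v) / 2).
    + intros v; unfold Rmax; destruct (Rle_dec 0 v); simpl; split_Rabs; lra.
    + apply (continuous_mult (fun v => v + Rabs v) (fun _ => / 2));
        [|apply continuous_const].
      apply (continuous_plus (fun v => v) Rabs); [apply continuous_id|].
      apply continuous_Rabs.
Qed.

Lemma continuous_smooth2 (u : R) : continuous smooth2 u.
Proof.
  apply (continuous_mult (fun u => pos_part 0 u - 2 * pos_part 1 u + 2 * pos_part 3 u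
    - pos_part 4 u) (fun _ => / 2)); [|apply continuous_const].
  assert (H2 : forall i, continuous (fun u => 2 * pos_part i u) u)
    by (intros i; apply (continuous_mult (fun _ => 2) (pos_part i));
        [apply continuous_const | apply continuous_pos_part]).
  apply (continuous_minus (fun u => pos_part 0 u - 2 * pos_part 1 u + 2 * pos_part 3 u));
    [|apply continuous_pos_part].
  apply (continuous_plus (fun u => pos_part 0 u - 2 * pos_part 1 u)); [|apply H2].
  apply (continuous_minus (pos_part 0)); [apply continuous_pos_part | apply H2].
Qed.

Definition settles (phi : R -> R) (c : R) : Prop :=
  (forall u, u <= 0 -> phi u = 0) /\ (forall u, 4 <= u -> phi u = c).

Lemma pos_part_0 (i u : R) : u <= i -> pos_part i u = 0.
Proof. intros H; apply Rmax_left; lra. Qed.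

Lemma pos_part_pos (i u : R) : i <= u -> pos_part i u = u - i.
Proof. intros H; apply Rmax_right; lra. Qed.

Lemma settles_smooth0 : settles smooth0 1.
Proof.
  split; intros u Hu; unfold smooth0.
  - rewrite !pos_part_0 by lra; ring.
  - rewrite !pos_part_pos by lra; field.
Qed.

Lemma settles_smooth1 : settles smooth1 0.
Proof.
  split; intros u Hu; unfold smooth1.
  - rewrite !pos_part_0 by lra; ring.
  - rewrite !pos_part_pos by lra; field.
Qed.

Lemma settles_smooth2 : settles smooth2 0.
Proof.
  split; intros u Hu; unfold smooth2.
  - rewrite !pos_part_0 by lra; ring.
  - rewrite !pos_part_pos by lra; field.
Qed.

Definition pp_stable (phi : R -> R) : Prop :=
  forall f, piecewise_polynomial f -> piecewise_polynomial (fun t => phi (f t)).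

Lemma pp_pos_part (i : R) : pp_stable (pos_part i).
Proof.
  intros f Hf; apply pp_Rmax0; apply (pp_minus f); [exact Hf | apply pp_const].
Qed.

Lemma pp_pow (f : R -> R) (n : nat) :
  piecewise_polynomial f -> piecewise_polynomial (fun t => f t ^ n).
Proof.
  intros Hf; induction n as [|n IH]; simpl; [apply pp_const | now apply pp_mult].
Qed.

Lemma pp_comb (f0 f1 f3 f4 : R -> R) (c : R) :
  piecewise_polynomial f0 -> piecewise_polynomial f1 ->
  piecewise_polynomial f3 -> piecewise_polynomial f4 ->
  piecewise_polynomial (fun u => (f0 u - 2 * f1 u + 2 * f3 u - f4 u) * c).
Proof.
  intros H0 H1 H3 H4; apply pp_mult; [|apply pp_const].
  apply (pp_minus (fun u => f0 u - 2 * f1 u + 2 * f3 u)); [|exact H4].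
  apply (pp_plus (fun u => f0 u - 2 * f1 u)).
  - apply (pp_minus f0); [exact H0 | apply pp_mult; [apply pp_const | exact H1]].
  - apply pp_mult; [apply pp_const | exact H3].
Qed.

Lemma pp_smooth : pp_stable smooth0 /\ pp_stable smooth1 /\ pp_stable smooth2.
Proof.
  split; [|split]; intros f Hf.
  - apply pp_comb; apply (pp_pow (fun t => pos_part _ (f t))); now apply pp_pos_part.
  - apply pp_comb; apply (pp_pow (fun t => pos_part _ (f t))); now apply pp_pos_part.
  - apply pp_comb; now apply pp_pos_part.
Qed.

(* Moves from [u n] to [u (S n)] during a quarter period from [2 n PI + off] on;
   [phi] is a smooth step on [0, 4] or one of its derivatives. *)
Definition track (phi : R -> R) (u : nat -> R) (off t : R) : R :=
  locsum (fun k t => (u (S k) - u k) * phi ((t - (2 * INR k * PI + off)) * (8 / PI))) t.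

(** The factor 8 / PI stretches a quarter period to the interval [0, 4] of the smooth step. *)
Lemma track_arg (k : nat) (off t : R) :
  ((t <= 2 * INR k * PI + off -> (t - (2 * INR k * PI + off)) * (8 / PI) <= 0) /\
   (2 * INR k * PI + off + PI / 2 <= t ->
     4 <= (t - (2 * INR k * PI + off)) * (8 / PI)))%R.
Proof.
  pose proof PI_RGT_0 as HPI.
  assert (H8 : 0 < 8 / PI) by (apply Rdiv_lt_0_compat; lra).
  split; intros H.
  - nra.
  - replace 4 with (PI / 2 * (8 / PI)) by (field; lra).
    apply Rmult_le_compat_r; lra.
Qed.

Lemma track_vanishes (phi : R -> R) (u : nat -> R) (off c : R) :
  0 <= off -> settles phi c ->
  vanishes_before (fun k t =>
    (u (S k) - u k) * phi ((t - (2 * INR k * PI + off)) * (8 / PI))).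
Proof.
  intros Hoff [H0 _] k t Ht.
  rewrite H0; [ring|]; apply track_arg.
  pose proof PI_RGT_0; pose proof PI2_1; pose proof (pos_INR k); nra.
Qed.

(** The interval is the rest of three quarter periods between two moves: earlier moves are complete,
    later ones have not begun, and the sum telescopes. The step itself has [c = 1], its derivatives
    have [c = 0]. *)
Lemma track_value (phi : R -> R) (u : nat -> R) (off c t : R) (n : nat) :
  0 <= off -> settles phi c ->
  2 * INR n * PI + off - 3 * (PI / 2) <= t <= 2 * INR n * PI + off ->
  track phi u off t = c * (u n - u 0%nat).
Proof.
  intros Hoff Hphi Ht; pose proof PI_RGT_0 as HPI.
  pose proof Hphi as [H0 H1].
  set (F := fun k t => (u (S k) - u k) * phi ((t - (2 * INR k * PI + off)) * (8 / PI))).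
  assert (Hlate : forall k, (n <= k)%nat -> F k t = 0).
  { intros k Hk; unfold F; rewrite H0; [ring|]; apply track_arg.
    apply le_INR in Hk; nra. }
  assert (Hearly : forall k, (k < n)%nat -> F k t = c * (u (S k) - u k)).
  { intros k Hk; unfold F; rewrite H1; [ring|]; apply track_arg.
    apply le_INR in Hk; rewrite S_INR in Hk; nra. }
  change (locsum F t = c * (u n - u 0%nat)).
  rewrite (locsum_eq F t (Nat.max n (Z.to_nat (up t)))).
  - rewrite (psum_stable _ n) by (lia || auto).
    clear Ht Hlate; induction n as [|n IH]; simpl; [ring|].
    rewrite IH, Hearly; auto; ring.
  - now apply (track_vanishes phi u off c).
  - eapply Rle_trans; [apply le_INR_up|]; apply le_INR; lia.
Qed.

Lemma is_derive_track (phi phi' : R -> R) (u : nat -> R) (off c t : R) :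
  0 <= off -> settles phi c -> settles phi' 0 ->
  (forall v, is_derive phi v (phi' v)) ->
  is_derive (track phi u off) t (track (fun v => phi' v * (8 / PI)) u off t).
Proof.
  intros Hoff Hphi Hphi' Hd; apply is_derive_locsum.
  - now apply track_vanishes with c.
  - apply (track_vanishes (fun v => phi' v * (8 / PI)) u off 0); [exact Hoff|].
    destruct Hphi' as [H0 H1].
    split; intros v Hv; [rewrite H0 | rewrite H1]; auto; ring.
  - intros k; evar_last.
    + apply (is_derive_scal (fun t => phi ((t - (2 * INR k * PI + off)) * (8 / PI)))).
      apply (is_derive_comp phi); [apply Hd|].
      auto_derive; [exact I | reflexivity].
    + unfold scal; simpl; unfold mult; simpl; ring.
Qed.

Lemma continuous_track (phi : R -> R) (u : nat -> R) (off c t : R) :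
  0 <= off -> settles phi c -> (forall v, continuous phi v) ->
  continuous (track phi u off) t.
Proof.
  intros Hoff Hphi Hc; apply continuous_locsum; [now apply track_vanishes with c|].
  intros k; apply (continuous_mult (fun _ => u (S k) - u k)); [apply continuous_const|].
  apply (continuous_comp (fun t => (t - (2 * INR k * PI + off)) * (8 / PI)) phi);
    [|apply Hc].
  apply (ex_derive_continuous (fun t => (t - (2 * INR k * PI + off)) * (8 / PI))).
  auto_derive; exact I.
Qed.

Lemma pp_track (phi : R -> R) (u : nat -> R) (off c : R) :
  0 <= off -> settles phi c -> pp_stable phi -> piecewise_polynomial (track phi u off).
Proof.
  intros Hoff Hphi Hpp; apply pp_locsum; [now apply track_vanishes with c|].
  intros k; apply pp_mult; [apply pp_const|]; apply Hpp.
  apply pp_ext with (fun t => (8 / PI) * t + - (2 * INR k * PI + off) * (8 / PI));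
    [intros; ring | apply pp_affine].
Qed.

(** * Cutting the time axis into phases *)

Definition phase_germs {S : Type} (q : R -> S) : Prop :=
  forall t sg, exists eps s, 0 < eps /\ forall h, 0 < h < eps -> q (t + sg * h) = s.

Definition constant_on {S : Type} (q : R -> S) (t u : R) : Prop :=
  forall a b, t < a < u -> t < b < u -> q a = q b.

(** The supremum of the times up to which the state stays constant; the right germ makes the set
    nonempty. The result is informative so that it can be iterated into a sequence of cuts without a
    choice axiom. *)
Lemma next_time {S : Type} (q : R -> S) :
  phase_germs q -> (forall t, exists a b, t < a /\ t < b /\ q a <> q b) ->
  forall t, {n | t < n /\ constant_on q t n /\ forall u, n < u -> ~ constant_on q t u}.
Proof.
  intros Hg Hne t.
  destruct (completeness (fun u => t < u /\ constant_on q t u)) as [n [Hub Hlub]].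
  - destruct (Hne t) as (a & b & Ha & Hb & Hab).
    exists (Rmax a b); intros u [Hu Hc].
    destruct (Rle_dec u (Rmax a b)) as [|Hn]; [assumption|exfalso].
    pose proof (Rmax_l a b); pose proof (Rmax_r a b).
    apply Hab, Hc; lra.
  - destruct (Hg t 1) as (e & s & He & Hs).
    exists (t + e); split; [lra|]; intros a b Ha Hb.
    replace a with (t + 1 * (a - t)) by ring; replace b with (t + 1 * (b - t)) by ring.
    rewrite !Hs by lra; reflexivity.
  - assert (Htn : t < n).
    { destruct (Hg t 1) as (e & s & He & Hs).
      apply Rlt_le_trans with (t + e); [lra|]; apply Hub; split; [lra|].
      intros a b Ha Hb.
      replace a with (t + 1 * (a - t)) by ring; replace b with (t + 1 * (b - t)) by ring.
      rewrite !Hs by lra; reflexivity. }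
    exists n; split; [exact Htn|]; split.
    + intros a b Ha Hb.
      destruct (classic (q a = q b)) as [|Hab]; [assumption|exfalso].
      assert (n <= Rmax a b).
      { apply Hlub; intros u [Hu Hc].
        destruct (Rle_dec u (Rmax a b)) as [|Hn]; [assumption|exfalso].
        pose proof (Rmax_l a b); pose proof (Rmax_r a b).
        apply Hab, Hc; lra. }
      unfold Rmax in *; destruct (Rle_dec a b); lra.
    + intros u Hu Hc; apply (Rlt_irrefl n), Rlt_le_trans with u; [exact Hu|].
      apply Hub; split; [lra | exact Hc].
Qed.

(** Were the cuts bounded, the state would be constant just before their supremum by its left germ,
    although infinitely many cuts lie there, against the maximality of each phase. The same
    maximality makes every cut a genuine change. *)
Lemma cut_into_phases {S : Type} (q : R -> S) :
  phase_germs q -> (forall t, exists a b, t < a /\ t < b /\ q a <> q b) ->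
  exists (T : nat -> R) (beh : nat -> S),
    T 0%nat = 0 /\ is_lim_seq T p_infty /\ (forall k, T k < T (Datatypes.S k)) /\
    (forall k, beh (2 * k)%nat = q (T k)) /\
    (forall k t, T k < t < T (Datatypes.S k) -> q t = beh (2 * k + 1)%nat) /\
    forall k, ~ (beh (2 * k + 1)%nat = beh (2 * k + 2)%nat /\
      beh (2 * k + 2)%nat = beh (2 * k + 3)%nat).
Proof.
  intros Hg Hne.
  set (next t := proj1_sig (next_time q Hg Hne t)).
  assert (Hnext : forall t, t < next t /\ constant_on q t (next t) /\
    forall u, next t < u -> ~ constant_on q t u)
    by (intros t; unfold next; now destruct (next_time q Hg Hne t)).
  set (T k := Nat.iter k next 0).
  assert (HT : forall k, T k < T (Datatypes.S k)) by (intros k; apply Hnext).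
  assert (Hmono : forall j k, (j <= k)%nat -> T j <= T k).
  { induction 1 as [|k _ IH]; [lra|]; specialize (HT k); lra. }
  (* The state of an open phase is read at its midpoint. *)
  exists T, (fun i => if Nat.even i then q (T (Nat.div2 i))
    else q ((T (Nat.div2 i) + T (Datatypes.S (Nat.div2 i))) / 2)).
  assert (Heven : forall k, Nat.even (2 * k) = true)
    by (intros k; rewrite Nat.even_mul; reflexivity).
  assert (Hodd : forall k, Nat.even (2 * k + 1) = false)
    by (intros k; rewrite Nat.add_1_r, Nat.even_succ, <- Nat.negb_even, Heven; reflexivity).
  assert (Hd : forall k, Nat.div2 (2 * k) = k) by apply Nat.div2_double.
  assert (Hd1 : forall k, Nat.div2 (2 * k + 1) = k)
    by (intros k; rewrite Nat.add_1_r; apply Nat.div2_succ_double).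
  assert (Hcst : forall k t, T k < t < T (Datatypes.S k) ->
    q t = q ((T k + T (Datatypes.S k)) / 2)).
  { intros k t Ht; destruct (Hnext (T k)) as (_ & Hc & _); specialize (HT k).
    apply Hc; [exact Ht | change (next (T k)) with (T (Datatypes.S k)); lra]. }
  split; [reflexivity|]; split; [|split; [exact HT|]]; [|split; [|split]].
  - apply is_lim_seq_spec; intros M; simpl.
    destruct (classic (exists N, M < T N)) as [[N HN] | Hno].
    { exists N; intros n Hn; specialize (Hmono N n Hn); lra. }
    exfalso.
    destruct (completeness (fun x => exists k, x = T k)) as [L [Hub Hlub]].
    { exists M; intros x [k ->].
      destruct (Rle_dec (T k) M); [assumption|]; exfalso; apply Hno; exists k; lra. }
    { exists (T 0%nat); now exists 0%nat. }
    assert (HL : forall k, T k < L).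
    { intros k; apply Rlt_le_trans with (T (Datatypes.S k)); [apply HT|].
      apply Hub; now exists (Datatypes.S k). }
    destruct (Hg L (-1)) as (e & s & He & Hs).
    assert (Hk : exists k, L - e < T k).
    { apply NNPP; intros Hn.
      assert (L <= L - e); [|lra].
      apply Hlub; intros x [k ->].
      destruct (Rle_dec (T k) (L - e)); [assumption|]; exfalso; apply Hn; exists k; lra. }
    destruct Hk as [k Hk].
    destruct (Hnext (T k)) as (_ & _ & Hmax).
    apply (Hmax (T (Datatypes.S (Datatypes.S k)))); [apply (HT (Datatypes.S k))|].
    specialize (HL (Datatypes.S (Datatypes.S k))).
    intros a b Ha Hb.
    replace a with (L + -1 * (L - a)) by ring; replace b with (L + -1 * (L - b)) by ring.
    rewrite !Hs by lra; reflexivity.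
  - intros k; now rewrite Heven, Hd.
  - intros k t Ht; rewrite Hodd, Hd1; now apply Hcst.
  - intros k.
    replace (2 * k + 2)%nat with (2 * Datatypes.S k)%nat by lia.
    replace (2 * k + 3)%nat with (2 * Datatypes.S k + 1)%nat by lia.
    rewrite !Heven, !Hodd, !Hd, !Hd1; intros [E1 E2].
    destruct (Hnext (T k)) as (_ & _ & Hmax).
    apply (Hmax (T (Datatypes.S (Datatypes.S k)))); [apply (HT (Datatypes.S k))|].
    assert (Hall : forall a, T k < a < T (Datatypes.S (Datatypes.S k)) ->
      q a = q (T (Datatypes.S k))).
    { intros a Ha; destruct (Rtotal_order a (T (Datatypes.S k))) as [H | [-> | H]].
      - rewrite (Hcst k a) by lra; exact E1.
      - reflexivity.
      - rewrite (Hcst (Datatypes.S k) a) by lra; now symmetry. }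
    intros a b Ha Hb; now rewrite (Hall a Ha), (Hall b Hb).
Qed.

(** * A trajectory for every run that never prints *)

Definition nice (w : (R -> R) * (R -> R)) : Prop :=
  forall t, is_derive (fst w) t (snd w t) /\ continuous (snd w) t /\
    germ (fst w) t /\ germ (snd w) t.

(** The power 3/2 of the positive part, since [sqrt] is 0 on negative numbers. *)
Definition half_power (y : R) : R := y * sqrt y.

Lemma half_power_0 (y : R) : y <= 0 -> half_power y = 0.
Proof. intros H; unfold half_power; rewrite sqrt_neg_0 by exact H; ring. Qed.

Lemma is_derive_half_power (y : R) : is_derive half_power y (3 / 2 * sqrt y).
Proof.
  destruct (Rtotal_order y 0) as [H | [-> | H]].
  - rewrite sqrt_neg_0, Rmult_0_r by lra.
    apply is_derive_ext_loc with (fun _ => 0); [|apply (is_derive_const 0)].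
    exists (mkposreal (- y) ltac:(lra)); intros u Hu.
    unfold ball in Hu; simpl in Hu; unfold AbsRing_ball, abs, minus, plus, opp in Hu.
    simpl in Hu; rewrite half_power_0 by (split_Rabs; lra); reflexivity.
  - rewrite sqrt_0, Rmult_0_r; apply is_derive_Reals; intros eps Heps.
    (* For positive [h] the difference quotient at 0 is [sqrt h]. *)
    exists (mkposreal (eps * eps) ltac:(nra)); intros h Hh0 Hh; simpl in Hh.
    rewrite Rplus_0_l, (half_power_0 0), !Rminus_0_r by lra.
    destruct (Rlt_dec 0 h) as [Hp|Hp].
    + unfold half_power, Rdiv.
      replace (h * sqrt h * / h) with (sqrt h) by (field; lra).
      rewrite Rabs_pos_eq by apply sqrt_pos.
      rewrite <- (sqrt_square eps) by lra.
      apply sqrt_lt_1; try lra; [nra|]; rewrite Rabs_pos_eq in Hh; lra.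
    + rewrite half_power_0 by lra; unfold Rdiv; rewrite Rmult_0_l, Rabs_R0; exact Heps.
  - unfold half_power; auto_derive; [lra|].
    pose proof (sqrt_lt_R0 y H); pose proof (sqrt_sqrt y ltac:(lra)) as E.
    rewrite <- E at 2; field; lra.
Qed.

Lemma derive_mult (f g : R -> R) (t a b : R) :
  is_derive f t a -> is_derive g t b ->
  is_derive (fun u => f u * g u) t (a * g t + f t * b).
Proof. intros Hf Hg; apply (is_derive_mult f g); auto; intros; apply Rmult_comm. Qed.

Lemma derive_const (c t : R) : is_derive (fun _ : R => c) t 0.
Proof. apply (is_derive_const c). Qed.

Lemma derive_opp (f : R -> R) (t a : R) :
  is_derive f t a -> is_derive (fun u => - f u) t (- a).
Proof. apply (is_derive_opp f). Qed.

Lemma derive_half_power (f : R -> R) (t a : R) :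
  is_derive f t a -> is_derive (fun u => half_power (f u)) t (3 / 2 * sqrt (f t) * a).
Proof.
  intros Hf; evar_last.
  - apply (is_derive_comp half_power f); [apply is_derive_half_power | exact Hf].
  - unfold scal; simpl; unfold mult; simpl; ring.
Qed.

Lemma derive_sin (t : R) : is_derive sin t (cos t).
Proof. apply is_derive_Reals, derivable_pt_lim_sin. Qed.

Lemma derive_cos (t : R) : is_derive cos t (- sin t).
Proof. apply is_derive_Reals, derivable_pt_lim_cos. Qed.

Lemma cont_mult (f g : R -> R) (t : R) :
  continuous f t -> continuous g t -> continuous (fun u => f u * g u) t.
Proof. apply (continuous_mult f g). Qed.

Lemma cont_minus (f g : R -> R) (t : R) :
  continuous f t -> continuous g t -> continuous (fun u => f u - g u) t.
Proof. apply (continuous_minus f g). Qed.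

Lemma cont_plus (f g : R -> R) (t : R) :
  continuous f t -> continuous g t -> continuous (fun u => f u + g u) t.
Proof. apply (continuous_plus f g). Qed.

Lemma cont_opp (f : R -> R) (t : R) :
  continuous f t -> continuous (fun u => - f u) t.
Proof. apply (continuous_opp f). Qed.

Lemma cont_const (c t : R) : continuous (fun _ : R => c) t.
Proof. apply continuous_const. Qed.

Lemma cont_sqrt (f : R -> R) (t : R) :
  continuous f t -> continuous (fun u => sqrt (f u)) t.
Proof. intros H; apply (continuous_comp f sqrt); [exact H | apply continuous_sqrt]. Qed.

Lemma cont_derive (f : R -> R) (t a : R) : is_derive f t a -> continuous f t.
Proof. intros H; apply (ex_derive_continuous f); now exists a. Qed.

Lemma cont_sin (t : R) : continuous (fun u => sin u) t.
Proof. exact (cont_derive _ _ _ (derive_sin t)). Qed.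

Lemma cont_cos (t : R) : continuous (fun u => cos u) t.
Proof. exact (cont_derive _ _ _ (derive_cos t)). Qed.

Lemma germ_sin (t : R) : germ (fun u => sin u) t.
Proof.
  destruct (Req_dec (sin t) 0) as [E|E].
  - apply germ_derive with cos; [apply derive_sin|].
    apply germ_continuous_neq0; [apply continuity_cos|].
    intros E'; pose proof (sin2_cos2 t) as H; rewrite E, E' in H; unfold Rsqr in H; lra.
  - apply germ_continuous_neq0; [apply continuity_sin | exact E].
Qed.

Lemma germ_cos (t : R) : germ (fun u => cos u) t.
Proof.
  destruct (Req_dec (cos t) 0) as [E|E].
  - apply germ_derive with (fun u => - sin u); [apply derive_cos|].
    apply germ_opp, germ_sin.
  - apply germ_continuous_neq0; [apply continuity_cos | exact E].
Qed.

(** The factor left over in the derivatives of variables 17 and 18, and the only sum among the clock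
    functions. Germs are not closed under sums, so it is reduced to its derivative, a product. *)
Lemma germ_sin2_cos2 (t : R) : germ (fun u => sin u * sin u - cos u * cos u) t.
Proof.
  apply germ_derive with (fun u => 4 * (sin u * cos u)).
  - intros u; auto_derive; [exact I | ring].
  - apply germ_mult; [apply germ_const|]; apply germ_mult; [apply germ_sin | apply germ_cos].
Qed.

(** Apart from that factor all entries are written as products, to which the closure properties of
    [germ] apply. *)
Definition clock_funs (K : R) : list ((R -> R) * (R -> R)) :=
  [(fun _ => 0, fun _ => 0);
   (fun _ => 1, fun _ => 0);
   (fun t => sin t, fun t => cos t);
   (fun t => cos t, fun t => - sin t);
   (fun t => - sin t, fun t => - cos t);
   (fun t => sin t * sin t, fun t => 2 * (sin t * cos t));
   (fun t => sin t * sin t * sin t, fun t => 3 * (sin t * sin t * cos t));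
   (fun t => half_power (sin t), fun t => 3 / 2 * sqrt (sin t) * cos t);
   (fun t => half_power (- sin t), fun t => 3 / 2 * sqrt (- sin t) * - cos t);
   (fun t => half_power (sin t) * half_power (sin t),
    fun t => 2 * (half_power (sin t) * (3 / 2 * sqrt (sin t) * cos t)));
   (fun t => half_power (- sin t) * half_power (- sin t),
    fun t => 2 * (half_power (- sin t) * (3 / 2 * sqrt (- sin t) * - cos t)));
   (fun t => cos t * cos t, fun t => 2 * (cos t * - sin t));
   (fun t => cos t * cos t * cos t, fun t => 3 * (cos t * cos t * - sin t));
   (fun t => half_power (cos t), fun t => 3 / 2 * sqrt (cos t) * - sin t);
   (fun t => half_power (- cos t), fun t => 3 / 2 * sqrt (- cos t) * sin t);
   (fun t => half_power (cos t) * half_power (cos t),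
    fun t => 2 * (half_power (cos t) * (3 / 2 * sqrt (cos t) * - sin t)));
   (fun t => half_power (- cos t) * half_power (- cos t),
    fun t => 2 * (half_power (- cos t) * (3 / 2 * sqrt (- cos t) * sin t)));
   (fun t => half_power (sin t) * half_power (- cos t),
    fun t => 3 / 2 * (sqrt (sin t) * sqrt (- cos t) * (sin t * sin t - cos t * cos t)));
   (fun t => half_power (- sin t) * half_power (cos t),
    fun t => 3 / 2 * (sqrt (- sin t) * sqrt (cos t) * (sin t * sin t - cos t * cos t)));
   (fun _ => K, fun _ => 0)].

Ltac germs :=
  unfold half_power;
  repeat lazymatch goal with
  | |- germ (fun t => sin t * sin t - cos t * cos t) _ => apply germ_sin2_cos2
  | |- germ (fun t => sin t) _ => apply germ_sin
  | |- germ (fun t => cos t) _ => apply germ_cos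
  | |- germ (fun _ => ?c) _ => apply (germ_const c)
  | |- germ (fun t => - @?f t) _ => apply (germ_opp f)
  | |- germ (fun t => sqrt (@?f t)) _ => apply (germ_sqrt f)
  | |- germ (fun t => @?f t * @?g t) _ => apply (germ_mult f g)
  end.

Ltac conts :=
  unfold half_power;
  repeat lazymatch goal with
  | |- continuous (fun t => sin t) _ => apply cont_sin
  | |- continuous (fun t => cos t) _ => apply cont_cos
  | |- continuous (fun _ => ?c) _ => apply (cont_const c)
  | |- continuous (fun t => - @?f t) _ => apply (cont_opp f)
  | |- continuous (fun t => sqrt (@?f t)) _ => apply (cont_sqrt f)
  | |- continuous (fun t => @?f t * @?g t) _ => apply (cont_mult f g)
  | |- continuous (fun t => @?f t - @?g t) _ => apply (cont_minus f g)
  end.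

Ltac derives :=
  evar_last;
  [ repeat lazymatch goal with
    | |- is_derive (fun t => sin t) _ _ => apply derive_sin
    | |- is_derive (fun t => cos t) _ _ => apply derive_cos
    | |- is_derive (fun _ => ?c) _ _ => apply (derive_const c)
    | |- is_derive (fun t => half_power (@?f t)) _ _ => apply (derive_half_power f)
    | |- is_derive (fun t => - @?f t) _ _ => apply (derive_opp f)
    | |- is_derive (fun t => @?f t * @?g t) _ _ => apply (derive_mult f g)
    end
  | ].

Lemma clock_funs_nice (K : R) : List.Forall nice (clock_funs K).
Proof.
  unfold clock_funs; repeat (apply Forall_cons || apply Forall_nil);
    intros t; cbn [fst snd]; (split; [derives | split; [conts | split; germs]]);
    try reflexivity; unfold half_power, zero; simpl; field.
Qed.

Definition track_funs (phi phi' : R -> R) (u : nat -> R) (off : R) :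
    (R -> R) * (R -> R) :=
  (track phi u off, track phi' u off).

(** The powers of 8 / PI in the next two definitions are the chain rule factors of the time scaling
    in [track]. *)
Definition step0 : R -> R := smooth0.
Definition step1 (v : R) : R := smooth1 v * (8 / PI).
Definition step2 (v : R) : R := smooth2 v * (8 / PI) * (8 / PI).

Lemma settles_scal (phi : R -> R) (c : R) :
  settles phi 0 -> settles (fun v => phi v * c) 0.
Proof.
  intros [H0 H1]; split; intros v Hv; [rewrite H0 | rewrite H1]; auto; ring.
Qed.

Lemma settles_step1 : settles step1 0.
Proof. apply (settles_scal smooth1), settles_smooth1. Qed.

Lemma settles_step2 : settles step2 0.
Proof.
  apply (settles_scal (fun v => smooth2 v * (8 / PI))), settles_scal, settles_smooth2.
Qed.

Lemma is_derive_step1 (v : R) : is_derive step1 v (smooth2 v * (8 / PI)).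
Proof.
  evar_last; [apply derive_mult; [apply is_derive_smooth1 | apply (is_derive_const (8 / PI))]|].
  unfold zero; simpl; ring.
Qed.

Definition nice_pp (w : (R -> R) * (R -> R)) : Prop :=
  (forall t, is_derive (fst w) t (snd w t)) /\ (forall t, continuous (snd w) t) /\
  piecewise_polynomial (fst w) /\ piecewise_polynomial (snd w).

Lemma nice_pp_nice (w : (R -> R) * (R -> R)) : nice_pp w -> nice w.
Proof.
  intros (Hd & Hc & H & H') t.
  split; [apply Hd|]; split; [apply Hc|]; split; now apply pp_germ.
Qed.

Lemma pp_stable_scal (phi : R -> R) (c : R) :
  pp_stable phi -> pp_stable (fun v => phi v * c).
Proof. intros H f Hf; apply pp_mult; [now apply H | apply pp_const]. Qed.

Lemma nice_track0 (u : nat -> R) (off : R) :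
  0 <= off -> nice_pp (track_funs step0 step1 u off).
Proof.
  intros Hoff; destruct pp_smooth as (P0 & P1 & P2).
  split; [|split; [|split]]; cbn [track_funs fst snd].
  - intros t; apply (is_derive_track _ _ _ _ 1); auto using settles_smooth0,
      settles_smooth1, is_derive_smooth0.
  - intros t; apply (continuous_track _ _ _ 0); auto using settles_step1.
    intros v; exact (cont_derive _ _ _ (is_derive_step1 v)).
  - apply (pp_track _ _ _ 1); auto using settles_smooth0.
  - apply (pp_track _ _ _ 0); auto using settles_step1; now apply pp_stable_scal.
Qed.

Lemma nice_track1 (u : nat -> R) (off : R) :
  0 <= off -> nice_pp (track_funs step1 step2 u off).
Proof.
  intros Hoff; destruct pp_smooth as (P0 & P1 & P2).
  split; [|split; [|split]]; cbn [track_funs fst snd].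
  - intros t; apply (is_derive_track _ (fun v => smooth2 v * (8 / PI)) _ _ 0);
      auto using settles_step1, settles_scal, settles_smooth2, is_derive_step1.
  - intros t; apply (continuous_track _ _ _ 0); auto using settles_step2.
    intros v; apply (cont_mult (fun v => smooth2 v * (8 / PI))); [|apply cont_const].
    apply (cont_mult smooth2); [apply continuous_smooth2 | apply cont_const].
  - apply (pp_track _ _ _ 0); auto using settles_step1; now apply pp_stable_scal.
  - apply (pp_track _ _ _ 0); auto using settles_step2.
    apply (pp_stable_scal (fun v => smooth2 v * (8 / PI))); now apply pp_stable_scal.
Qed.

(** The y copy moves in the first quarter of a period (offset 0), the x copy in the third (offset
    PI), each in the half where motion is allowed. In the second quarter they rest at successive
    values, in the fourth at the same one. *)
Definition register_fun (u : nat -> R) (i : nat) : (R -> R) * (R -> R) :=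
  match i with
  | 0 => track_funs step0 step1 u PI
  | 1 => track_funs step1 step2 u PI
  | 2 => track_funs step0 step1 u 0
  | _ => track_funs step1 step2 u 0
  end%nat.

Lemma nice_register_fun (u : nat -> R) (i : nat) : nice_pp (register_fun u i).
Proof.
  pose proof PI_RGT_0.
  destruct i as [|[|[|i]]]; [apply nice_track0 | apply nice_track1 | apply nice_track0
    | apply nice_track1]; lra.
Qed.

Definition base_fun (K : R) (z : nat -> nat -> R) (i : nat) : (R -> R) * (R -> R) :=
  if Nat.ltb i 20 then nth i (clock_funs K) (fun _ => 0, fun _ => 0)
  else register_fun (fun n => z n ((i - 20) / 4)%nat) ((i - 20) mod 4).

Lemma base_fun_register (K : R) (z : nat -> nat -> R) (j i : nat) :
  (i < 4)%nat -> base_fun K z (i + (20 + 4 * j)) = register_fun (fun n => z n j) i.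
Proof.
  intros Hi; unfold base_fun; rewrite (proj2 (Nat.ltb_ge _ _)) by lia.
  replace (i + (20 + 4 * j) - 20)%nat with (i + j * 4)%nat by lia.
  rewrite Nat.div_add, (Nat.div_small i 4), Nat.Div0.mod_add, (Nat.mod_small i 4) by lia.
  reflexivity.
Qed.

Lemma nice_const (c : R) : nice_pp (fun _ => c, fun _ => 0).
Proof.
  split; [|split; [|split]]; cbn [fst snd].
  - intros t; apply (is_derive_const c).
  - intros t; apply cont_const.
  - apply pp_const.
  - apply pp_const.
Qed.

Lemma nice_base_fun (K : R) (z : nat -> nat -> R) (i : nat) : nice (base_fun K z i).
Proof.
  unfold base_fun; destruct (Nat.ltb i 20).
  - pose proof (clock_funs_nice K) as F; rewrite Forall_forall in F.
    destruct (nth_in_or_default i (clock_funs K) (fun _ => 0, fun _ => 0)) as [H | ->].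
    + now apply F.
    + apply nice_pp_nice, nice_const.
  - apply nice_pp_nice, nice_register_fun.
Qed.

(** Relations between registers never mention sine or cosine, so the nodes of their polynomials
    inherit piecewise polynomiality. The derivatives at 0 provide the initial direction [Std]. *)
Lemma base_fun_relation_var (K : R) (z : nat -> nat -> R) (m i : nat) :
  relation_var m i -> nice_pp (base_fun K z i) /\ snd (base_fun K z i) 0 = 0.
Proof.
  pose proof PI_RGT_0.
  intros [-> | [-> | [-> | (j & Hj & [-> | ->])]]].
  - split; [apply (nice_const 0) | reflexivity].
  - split; [apply (nice_const 1) | reflexivity].
  - split; [apply (nice_const K) | reflexivity].
  - pose proof (base_fun_register K z j 0 ltac:(lia)) as E.
    cbn [Nat.add] in E; cbn [Nat.add]; rewrite E.
    split; [apply nice_register_fun|]; cbn [register_fun track_funs snd].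
    rewrite (track_value _ _ _ 0 0 0); auto using settles_step1; simpl; lra.
  - pose proof (base_fun_register K z j 2 ltac:(lia)) as E.
    cbn [Nat.add] in E; cbn [Nat.add]; rewrite E.
    split; [apply nice_register_fun|]; cbn [register_fun track_funs snd].
    rewrite (track_value _ _ _ 0 0 0); auto using settles_step1; simpl; lra.
Qed.

Fixpoint pderiv (r dr : nat -> R) (p : poly) : R :=
  match p with
  | PVar i => dr i
  | PAdd p q => pderiv r dr p + pderiv r dr q
  | PSub p q => pderiv r dr p - pderiv r dr q
  | PMul p q => pderiv r dr p * peval r q + peval r p * pderiv r dr q
  end.

Definition poly_fun (b : nat -> (R -> R) * (R -> R)) (p : poly) : (R -> R) * (R -> R) :=
  (fun t => peval (fun i => fst (b i) t) p,
   fun t => pderiv (fun i => fst (b i) t) (fun i => snd (b i) t) p).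

Lemma nice_poly_fun (b : nat -> (R -> R) * (R -> R)) (p : poly) :
  pall (fun i => nice_pp (b i)) p -> nice_pp (poly_fun b p).
Proof.
  induction p as [i|p IHp q IHq|p IHp q IHq|p IHp q IHq]; cbn [pall].
  - auto.
  - intros [Hp Hq].
    destruct (IHp Hp) as (D1 & C1 & P1 & P1'); destruct (IHq Hq) as (D2 & C2 & P2 & P2').
    split; [|split; [|split]]; cbn [poly_fun fst snd peval pderiv] in *.
    + intros t; exact (is_derive_plus _ _ t _ _ (D1 t) (D2 t)).
    + intros t; exact (cont_plus _ _ t (C1 t) (C2 t)).
    + exact (pp_plus _ _ P1 P2).
    + exact (pp_plus _ _ P1' P2').
  - intros [Hp Hq].
    destruct (IHp Hp) as (D1 & C1 & P1 & P1'); destruct (IHq Hq) as (D2 & C2 & P2 & P2').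
    split; [|split; [|split]]; cbn [poly_fun fst snd peval pderiv] in *.
    + intros t; exact (is_derive_minus _ _ t _ _ (D1 t) (D2 t)).
    + intros t; exact (cont_minus _ _ t (C1 t) (C2 t)).
    + exact (pp_minus _ _ P1 P2).
    + exact (pp_minus _ _ P1' P2').
  - intros [Hp Hq].
    destruct (IHp Hp) as (D1 & C1 & P1 & P1'); destruct (IHq Hq) as (D2 & C2 & P2 & P2').
    split; [|split; [|split]]; cbn [poly_fun fst snd peval pderiv] in *.
    + intros t; exact (derive_mult _ _ t _ _ (D1 t) (D2 t)).
    + intros t; apply cont_plus; apply cont_mult; auto;
        eapply cont_derive; [apply (D2 t) | apply (D1 t)].
    + exact (pp_mult _ _ P1 P2).
    + apply pp_plus; now apply pp_mult.
Qed.

Lemma pderiv_0 (r dr : nat -> R) (p : poly) :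
  pall (fun i => dr i = 0) p -> pderiv r dr p = 0.
Proof.
  induction p as [i|p IHp q IHq|p IHp q IHq|p IHp q IHq]; cbn [pall pderiv];
    [auto|intros [Hp Hq]; rewrite IHp, IHq by assumption; ring..].
Qed.

Lemma pall_psubs (P : nat -> Prop) (p q : poly) :
  pall P p -> In q (psubs p) -> pall P q.
Proof.
  induction p as [i|p IHp p' IHp'|p IHp p' IHp'|p IHp p' IHp']; cbn [psubs];
    [intros _ []|..]; intros H; rewrite !in_app_iff;
    (intros [Hq | [Hq | [<- | []]]];
      [apply IHp; [apply H | exact Hq] | apply IHp'; [apply H | exact Hq] | exact H]).
Qed.

Lemma locate_period (t : R) :
  0 <= t -> exists n r, 0 <= r < 2 * PI /\ t = r + 2 * INR n * PI.
Proof.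
  intros Ht; pose proof PI_RGT_0 as HPI.
  assert (H2 : 0 <= t / (2 * PI)) by (apply Rdiv_le_0_compat; lra).
  destruct (archimed (t / (2 * PI))) as [H H'].
  exists (Z.to_nat (up (t / (2 * PI)) - 1)), (t - 2 * (IZR (up (t / (2 * PI))) - 1) * PI).
  assert (Hz : (0 <= up (t / (2 * PI)) - 1)%Z).
  { assert (0 < up (t / (2 * PI)))%Z by (apply lt_IZR; lra); lia. }
  rewrite INR_IZR_INZ, Z2Nat.id, minus_IZR by exact Hz.
  assert (E : t = t / (2 * PI) * (2 * PI)) by (field; lra).
  split; [|ring].
  set (q := t / (2 * PI)) in *; rewrite E; nra.
Qed.

Lemma period_cases (t : R) :
  0 <= t -> exists n, 0 <= INR n * PI /\
  (0 < sin t -> 2 * INR n * PI <= t <= 2 * INR n * PI + PI) /\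
  (sin t < 0 -> 2 * INR n * PI + PI <= t <= 2 * INR n * PI + 2 * PI) /\
  (0 < sin t -> cos t < 0 ->
    2 * INR n * PI + PI / 2 <= t <= 2 * INR n * PI + PI) /\
  (sin t < 0 -> 0 < cos t ->
    2 * INR n * PI + 3 * (PI / 2) <= t <= 2 * INR n * PI + 2 * PI).
Proof.
  intros Ht; pose proof PI_RGT_0 as HPI.
  destruct (locate_period t Ht) as (n & r & Hr & ->); exists n.
  pose proof (pos_INR n) as Hn.
  rewrite sin_period, cos_period.
  assert (S1 : 0 < sin r -> r <= PI).
  { intros H; destruct (Rle_dec r PI); [assumption|].
    pose proof (sin_le_0 r ltac:(lra) ltac:(lra)); lra. }
  assert (S2 : sin r < 0 -> PI <= r).
  { intros H; destruct (Rle_dec PI r); [assumption|].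
    pose proof (sin_ge_0 r ltac:(lra) ltac:(lra)); lra. }
  assert (C1 : cos r < 0 -> PI / 2 <= r).
  { intros H; destruct (Rle_dec (PI / 2) r); [assumption|].
    pose proof (cos_ge_0 r ltac:(lra) ltac:(lra)); lra. }
  assert (C2 : 0 < cos r -> PI <= r -> 3 * (PI / 2) <= r).
  { intros H H'; destruct (Rle_dec (3 * (PI / 2)) r); [assumption|].
    pose proof (cos_le_0 r ltac:(lra) ltac:(lra)); lra. }
  split; [nra|]; split; [|split; [|split]].
  - intros H; specialize (S1 H); lra.
  - intros H; specialize (S2 H); lra.
  - intros H H'; specialize (S1 H); specialize (C1 H'); lra.
  - intros H H'; specialize (S2 H); specialize (C2 H' S2); lra.
Qed.

(** * Qualitative states of a family of functions *)

(** Two landmarks mean [free_space], otherwise the space is [signed_space]; no other spaces are in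
    use. *)
Definition qmag_of (q : qspace) (y : R) : qmag :=
  if Nat.eqb (length (landmarks q)) 2 then Between MinusInf PlusInf
  else match dirof y with
       | Inc => Between Zero PlusInf
       | Dec => Between MinusInf Zero
       | Std => At Zero
       end.

Fixpoint qstate (f : nat -> (R -> R) * (R -> R)) (l : list qspace) (i : nat) (t : R) : state :=
  match l with
  | [] => []
  | q :: l => (qmag_of q (fst (f i) t), dirof (snd (f i) t)) :: qstate f l (S i) t
  end.

Lemma qmag_of_correct (v : nat -> Rbar) (q : qspace) (y : R) :
  q = signed_space \/ q = free_space ->
  wf_qmag q (qmag_of q y) /\ qmag_holds v (qmag_of q y) y.
Proof.
  intros [-> | ->]; unfold qmag_of; cbn [landmarks signed_space free_space length Nat.eqb].
  - pose proof (dirof_holds y); destruct (dirof y); simpl in *.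
    + split; [apply signed_space_adjacent | auto].
    + split; [apply signed_space_adjacent | auto].
    + split; [apply signed_space_reachable | now f_equal].
  - split; [apply free_space_adjacent | simpl; auto].
Qed.

Lemma qstate_nth (f : nat -> (R -> R) * (R -> R)) (l : list qspace) (t : R) :
  forall i X, nth_error (qstate f l i t) X =
    option_map (fun q =>
      (qmag_of q (fst (f (X + i)%nat) t), dirof (snd (f (X + i)%nat) t)))
      (nth_error l X).
Proof.
  induction l as [|q l IH]; intros i [|X]; simpl; try reflexivity.
  now rewrite IH, Nat.add_succ_r.
Qed.

Lemma qstate_wf (f : nat -> (R -> R) * (R -> R)) (l : list qspace) (t : R) : forall i,
  (forall q, In q l -> q = signed_space \/ q = free_space) ->
  Forall2 (fun q w => wf_qmag q (fst w)) l (qstate f l i t).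
Proof.
  induction l as [|q l IH]; intros i H; simpl; constructor.
  - apply (qmag_of_correct (fun _ => p_infty)), H; now left.
  - apply IH; intros q' Hq; apply H; now right.
Qed.

Lemma qstate_germ (f : nat -> (R -> R) * (R -> R)) (l : list qspace) : forall i,
  (forall i, nice (f i)) -> phase_germs (qstate f l i).
Proof.
  intros i Hf; revert i; induction l as [|q l IH]; intros i t sg.
  - exists 1, []; split; [lra | reflexivity].
  - destruct (IH (S i) t sg) as (e & s & He & Hs).
    destruct (Hf i t) as (_ & _ & G & G').
    destruct (G sg) as (e1 & w1 & He1 & H1); destruct (G' sg) as (e2 & w2 & He2 & H2).
    set (d := Rmin e (Rmin e1 e2)).
    assert (Hd : 0 < d) by (repeat apply Rmin_pos; assumption).
    assert (d <= e) by apply Rmin_l.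
    assert (d <= Rmin e1 e2) by apply Rmin_r.
    pose proof (Rmin_l e1 e2); pose proof (Rmin_r e1 e2).
    exists d, (qstate f (q :: l) i (t + sg * (d / 2))); split; [exact Hd|].
    intros h Hh; cbn [qstate].
    rewrite (Hs h), (Hs (d / 2)) by lra; unfold qmag_of.
    rewrite (dirof_unique _ _ (H1 h ltac:(lra))), (dirof_unique _ _ (H1 (d / 2) ltac:(lra))).
    rewrite (dirof_unique _ _ (H2 h ltac:(lra))), (dirof_unique _ _ (H2 (d / 2) ltac:(lra))).
    reflexivity.
Qed.

(** * The witness *)

Definition variables_of (c : constraint) : list nat :=
  match c with
  | Add X Y Z _ | Mult X Y Z _ => [X; Y; Z]
  | _ => []
  end.

Lemma literal_variables (t : tree) : forall i n c X,
  In c (literal t i n) -> In X (variables_of c) ->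
  X = 0%nat \/ X = 1%nat \/ X = i \/ (n <= X)%nat.
Proof.
  induction t as [|a IHa b IHb]; intros i n c X; cbn [literal].
  - intros [<- | []]; simpl; intuition.
  - rewrite !in_app_iff; intros [H | [H | H]] HX.
    + destruct (IHb _ _ _ _ H HX) as [|[|[|]]]; intuition lia.
    + destruct (IHa _ _ _ _ H HX) as [|[|[|]]]; intuition lia.
    + destruct H as [<- | [<- | [<- | []]]]; simpl in HX; intuition lia.
Qed.

Lemma relates_variables (r r' : nat -> R) (c : constraint) :
  (forall X, In X (variables_of c) -> r' X = r X) -> relates r c -> relates r' c.
Proof.
  destruct c; simpl; auto; intros H; rewrite !H; auto.
Qed.

Definition witness (K : R) (z : nat -> nat -> R) (m : nat) (nodes : list poly)
    (rho : nat -> R) (i : nat) : (R -> R) * (R -> R) :=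
  if Nat.ltb i (20 + 4 * m) then base_fun K z i
  else if Nat.ltb i (length nodes + (20 + 4 * m)) then
    poly_fun (base_fun K z) (nth (i - (20 + 4 * m)) nodes pzero)
  else (fun _ => rho i, fun _ => 0).

Lemma goal_nodes_var (m : nat) (p : poly) (i : nat) :
  pall (relation_var m) p ->
  pall (relation_var m) (nth i (goal_nodes (goals m p)) pzero).
Proof.
  intros Hp.
  destruct (nth_in_or_default i (goal_nodes (goals m p)) pzero) as [H | ->];
    [|apply relation_var_pzero].
  apply in_flat_map in H as ([g q] & Hg & H).
  apply goals_var in Hg as [_ Hq]; [|exact Hp].
  now apply pall_psubs with q.
Qed.

Section Witness.

Context (Q : cmd) (a : tree) (z : nat -> nat -> R) (rho : nat -> R).

Let m : nat := (2 * nvals Q)%nat.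
Let p : poly := poly_of (machine_form Q).
Let f : nat -> (R -> R) * (R -> R) :=
  witness (INR (code a)) z m (goal_nodes (goals m p)) rho.

Lemma witness_base (i : nat) :
  (i < 20 + 4 * m)%nat -> f i = base_fun (INR (code a)) z i.
Proof.
  intros Hi; unfold f, witness; now rewrite (proj2 (Nat.ltb_lt _ _) Hi).
Qed.

Lemma witness_register (j i : nat) :
  (j < m)%nat -> (i < 4)%nat ->
  f (i + (20 + 4 * j)) = register_fun (fun n => z n j) i.
Proof.
  intros Hj Hi; rewrite witness_base by lia; now apply base_fun_register.
Qed.

Lemma witness_node (i : nat) :
  (i < length (goal_nodes (goals m p)))%nat ->
  f (i + (20 + 4 * m)) =
  poly_fun (base_fun (INR (code a)) z) (nth i (goal_nodes (goals m p)) pzero).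
Proof.
  intros Hi; unfold f, witness.
  rewrite (proj2 (Nat.ltb_ge _ _)), (proj2 (Nat.ltb_lt _ _)) by lia.
  now rewrite Nat.add_sub.
Qed.

Lemma witness_const (i : nat) :
  (length (goal_nodes (goals m p)) + (20 + 4 * m) <= i)%nat ->
  f i = (fun _ => rho i, fun _ => 0).
Proof.
  intros Hi; unfold f, witness.
  now rewrite !(proj2 (Nat.ltb_ge _ _)) by lia.
Qed.

Lemma witness_nice (i : nat) : nice (f i).
Proof.
  unfold f, witness; destruct (Nat.ltb i _); [apply nice_base_fun|].
  destruct (Nat.ltb i _); [|apply nice_pp_nice, nice_const].
  apply nice_pp_nice, nice_poly_fun.
  eapply pall_impl; [|apply goal_nodes_var, pall_machine_poly].
  intros j Hj; apply (base_fun_relation_var (INR (code a)) z m j Hj).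
Qed.

Lemma witness_peval (q : poly) (t : R) :
  pall (relation_var m) q ->
  peval (fun i => fst (f i) t) q =
  peval (fun i => fst (base_fun (INR (code a)) z i) t) q.
Proof.
  induction q as [i|q IHq q' IHq'|q IHq q' IHq'|q IHq q' IHq']; cbn [pall peval];
    [|intros [H H']; now rewrite IHq, IHq'..].
  intros Hi; apply relation_var_lt in Hi; now rewrite witness_base.
Qed.

Lemma witness_start (i : nat) :
  (20 <= i)%nat -> snd (f i) 0 = 0.
Proof.
  intros Hi; pose proof PI_RGT_0.
  destruct (le_lt_dec (20 + 4 * m) i) as [Hi'|Hi'].
  - destruct (le_lt_dec (length (goal_nodes (goals m p)) + (20 + 4 * m)) i) as [H'|H'].
    + now rewrite witness_const.
    + replace i with (i - (20 + 4 * m) + (20 + 4 * m))%nat by lia.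
      rewrite witness_node by lia; apply pderiv_0.
      eapply pall_impl; [|apply goal_nodes_var, pall_machine_poly].
      intros j Hj; apply (base_fun_relation_var (INR (code a)) z m j Hj).
  - replace i with ((i - 20) mod 4 + (20 + 4 * ((i - 20) / 4)))%nat.
    2: { pose proof (Nat.div_mod_eq (i - 20) 4); lia. }
    assert (Hmod : ((i - 20) mod 4 < 4)%nat) by (apply Nat.mod_upper_bound; lia).
    rewrite witness_register; [| |exact Hmod].
    + destruct ((i - 20) mod 4) as [|[|[|k]]]; cbn [register_fun track_funs snd];
        rewrite (track_value _ _ _ 0 0 0);
        auto using settles_step1, settles_step2; simpl; lra.
    + apply Nat.Div0.div_lt_upper_bound; lia.
Qed.

Context (z_start : forall j, z 0%nat j = 0).
Context (z_step : forall n r, r 0%nat = 0 -> r 1%nat = 1 -> r 19%nat = INR (code a) ->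
  (forall j, (j < m)%nat ->
    r (20 + 4 * j)%nat = z n j /\ r (22 + 4 * j)%nat = z (S n) j) ->
  sat r (machine_form Q)).

Lemma witness_x (n j : nat) (t : R) :
  (j < m)%nat ->
  2 * INR n * PI - PI / 2 <= t <= 2 * INR n * PI + PI ->
  fst (f (20 + 4 * j)) t = z n j /\ fst (f (21 + 4 * j)) t = 0.
Proof.
  intros Hj Ht; pose proof PI_RGT_0.
  assert (E0 := witness_register j 0 Hj ltac:(lia)).
  assert (E1 := witness_register j 1 Hj ltac:(lia)).
  cbn [Nat.add] in E0, E1; cbn [Nat.add]; rewrite E0, E1.
  cbn [register_fun track_funs fst]; split.
  - rewrite (track_value _ _ _ 1 t n); [|lra|apply settles_smooth0|lra].
    rewrite z_start; ring.
  - rewrite (track_value _ _ _ 0 t n); [|lra|apply settles_step1|lra]; ring.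
Qed.

Lemma witness_y (n j : nat) (t : R) :
  (j < m)%nat ->
  2 * INR n * PI + PI / 2 <= t <= 2 * INR n * PI + 2 * PI ->
  fst (f (22 + 4 * j)) t = z (S n) j /\ fst (f (23 + 4 * j)) t = 0.
Proof.
  intros Hj Ht; pose proof PI_RGT_0.
  assert (E2 := witness_register j 2 Hj ltac:(lia)).
  assert (E3 := witness_register j 3 Hj ltac:(lia)).
  cbn [Nat.add] in E2, E3; cbn [Nat.add]; rewrite E2, E3.
  cbn [register_fun track_funs fst]; split.
  - rewrite (track_value _ _ _ 1 t (S n));
      [|lra|apply settles_smooth0|rewrite S_INR; lra].
    rewrite z_start; ring.
  - rewrite (track_value _ _ _ 0 t (S n));
      [|lra|apply settles_step1|rewrite S_INR; lra]; ring.
Qed.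

Lemma witness_goals (t : R) (g : nat) (q : poly) :
  0 <= t -> In (g, q) (goals m p) ->
  fst (f g) t * peval (fun i => fst (f i) t) q = 0.
Proof.
  intros Ht Hg; pose proof PI_RGT_0.
  destruct (period_cases t Ht) as (n & Hn & _ & _ & H2 & H4).
  assert (Hzero : forall y, ~ 0 < y -> half_power y = 0)
    by (intros y Hy; apply half_power_0; lra).
  destruct Hg as [E | Hg].
  - injection E as <- <-.
    rewrite (witness_base 17) by lia; cbn [base_fun clock_funs nth fst Nat.ltb Nat.leb].
    destruct (Rlt_dec 0 (sin t)) as [Hs|Hs]; [|rewrite Hzero by exact Hs; ring].
    destruct (Rlt_dec 0 (- cos t)) as [Hc|Hc]; [|rewrite (Hzero _ Hc); ring].
    specialize (H2 Hs ltac:(lra)).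
    replace (peval _ _) with 0; [ring|]; symmetry.
    apply peval_poly_of; [now rewrite witness_base by lia|].
    apply (z_step n).
    + now rewrite witness_base by lia.
    + now rewrite witness_base by lia.
    + now rewrite witness_base by lia.
    + intros j Hj; split; [apply witness_x | apply witness_y]; auto; lra.
  - apply in_map_iff in Hg as (j & E & Hj); injection E as <- <-; apply in_seq in Hj.
    rewrite (witness_base 18) by lia; cbn [base_fun clock_funs nth fst Nat.ltb Nat.leb].
    destruct (Rlt_dec 0 (- sin t)) as [Hs|Hs]; [|rewrite Hzero by exact Hs; ring].
    destruct (Rlt_dec 0 (cos t)) as [Hc|Hc]; [|rewrite (Hzero _ Hc); ring].
    specialize (H4 ltac:(lra) Hc).
    change (peval (fun i => fst (f i) t) (PSub (vx j) (vy j)))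
      with (fst (f (20 + 4 * j)) t - fst (f (22 + 4 * j)) t).
    (* In the fourth quarter the x copy has made its move, so its plateau is already the one of
       index [S n]. *)
    destruct (witness_x (S n) j t ltac:(lia)) as [-> _]; [rewrite S_INR; lra|].
    destruct (witness_y n j t ltac:(lia)) as [-> _]; [lra|]; ring.
Qed.

Context (rho_literal : forall c, In c (literal a 19 (length (base_vars Q))) ->
  relates rho c).
Context (rho_base : rho 0%nat = 0 /\ rho 1%nat = 1 /\ rho 19%nat = INR (code a)).

Lemma witness_constraints (v : nat -> Rbar) (t : R) (c : constraint) :
  0 <= t -> In c (constraints (input_model (machine_input Q a))) ->
  constraint_holds v (fun i => fst (f i)) (fun i => snd (f i)) t c.
Proof.
  intros Ht; cbn [machine_input instance input_model constraints];
    unfold base_cons, model_cons; fold m; fold p.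
  assert (HB : length (base_vars Q) =
    (length (goal_nodes (goals m p)) + (20 + 4 * m))%nat) by apply length_model_vars.
  assert (Hrel : forall b c, algebraic b c -> relates (fun i => fst (f i) t) c ->
    constraint_holds v (fun i => fst (f i)) (fun i => snd (f i)) t c)
    by (intros b [] Hb; cbn [algebraic] in Hb; try contradiction; auto).
  rewrite !in_app_iff; intros [H | [H | [H | H]]].
  - apply (Hrel (cells a + length (base_vars Q))%nat).
    { apply literal_algebraic in H; auto; lia. }
    apply relates_variables with (2 := rho_literal c H).
    intros X HX; destruct (literal_variables _ _ _ _ _ H HX) as [-> | [-> | [-> | HX']]].
    + rewrite (proj1 rho_base); now rewrite witness_base by lia.
    + rewrite (proj1 (proj2 rho_base)); now rewrite witness_base by lia.
    + rewrite (proj2 (proj2 rho_base)); now rewrite witness_base by lia.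
    + now rewrite witness_const by lia.
  - assert (Hf : forall i, (i < 20)%nat -> f i = base_fun (INR (code a)) z i)
      by (intros; apply witness_base; lia).
    pose proof (sin2_cos2 t) as E; unfold Rsqr in E.
    assert (Hhp : forall y, half_power y * half_power y =
      half_power (- y) * half_power (- y) + y * y * y /\
      half_power y * half_power (- y) = 0).
    { intros y; destruct (Rle_dec y 0).
      - rewrite (half_power_0 y) by lra; split; [|ring].
        unfold half_power.
        transitivity (- y * - y * (sqrt (- y) * sqrt (- y)) + y * y * y); [|ring].
        rewrite sqrt_sqrt by lra; ring.
      - rewrite (half_power_0 (- y)) by lra; split; [|ring].
        unfold half_power.
        transitivity (y * y * (sqrt y * sqrt y)); [ring|].
        rewrite sqrt_sqrt by lra; ring. }
    destruct (Hhp (sin t)) as [Es Es']; destruct (Hhp (cos t)) as [Ec Ec'].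
    unfold clock_cons in H; cbn [In] in H.
    repeat (destruct H as [<- | H];
      [cbn [constraint_holds]; rewrite ?Hf by lia;
       cbn [base_fun clock_funs nth fst snd Nat.ltb Nat.leb];
       first [ring | lra | (split; [reflexivity | discriminate])]|]).
    destruct H.
  - apply in_flat_map in H as (j & Hj & H); apply in_seq in Hj.
    destruct (period_cases t Ht) as (n & Hn & H1 & H2 & _ & _).
    assert (Hzero : forall y, ~ 0 < y -> half_power y = 0)
      by (intros y Hy; apply half_power_0; lra).
    pose proof PI_RGT_0 as HPI.
    unfold register_cons in H; destruct H as [<- | [<- | [<- | [<- | []]]]];
      cbn [constraint_holds].
    + assert (E0 := witness_register j 0 ltac:(lia) ltac:(lia)).
      assert (E1 := witness_register j 1 ltac:(lia) ltac:(lia)).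
      cbn [Nat.add] in E0, E1; cbn [Nat.add]; rewrite E0, E1; reflexivity.
    + assert (E0 := witness_register j 2 ltac:(lia) ltac:(lia)).
      assert (E1 := witness_register j 3 ltac:(lia) ltac:(lia)).
      cbn [Nat.add] in E0, E1; cbn [Nat.add]; rewrite E0, E1; reflexivity.
    + rewrite (witness_base 7), (witness_base 0) by lia.
      cbn [base_fun clock_funs nth fst Nat.ltb Nat.leb].
      destruct (Rlt_dec 0 (sin t)) as [Hs|Hs]; [|rewrite Hzero by exact Hs; ring].
      specialize (H1 Hs); destruct (witness_x n j t ltac:(lia)) as [_ ->]; [lra | ring].
    + rewrite (witness_base 8), (witness_base 0) by lia.
      cbn [base_fun clock_funs nth fst Nat.ltb Nat.leb].
      destruct (Rlt_dec 0 (- sin t)) as [Hs|Hs]; [|rewrite Hzero by exact Hs; ring].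
      specialize (H2 ltac:(lra)).
      destruct (witness_y n j t ltac:(lia)) as [_ ->]; [lra | ring].
  - assert (Hb : algebraic (length (base_vars Q)) c).
    { eapply goal_cons_algebraic; [| | |exact H]; try lia.
      intros g q Hg; apply goals_var in Hg as [Hg Hq]; [|apply pall_machine_poly].
      split; [lia|]; apply pall_impl with (2 := Hq).
      intros i Hi; apply relation_var_lt in Hi; lia. }
    apply (Hrel _ _ Hb).
    apply (goal_cons_complete (fun i => fst (f i) t) (goals m p) (20 + 4 * m)); [reflexivity | | |exact H].
    + intros i Hi; rewrite witness_node by exact Hi; cbn [poly_fun fst].
      symmetry; apply witness_peval, goal_nodes_var, pall_machine_poly.
    + intros g q Hg; now apply witness_goals.
Qed.

End Witness.

(** * From a run to a trajectory *)

Lemma initial_state_tail (Q : cmd) (a : tree) (X : nat) (w : qval) :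
  (20 <= X)%nat -> nth_error (initial_state (machine_input Q a)) X = Some w ->
  w = free_std \/
  exists j, (j < 2 * nvals Q)%nat /\ X = (20 + 4 * j)%nat /\ w = (At Zero, Std).
Proof.
  intros HX; cbn [machine_input instance initial_state].
  destruct (le_lt_dec (length (map snd (base_vars Q))) X) as [H|H].
  { rewrite nth_error_app2 by exact H; intros E; left.
    now apply nth_error_In, repeat_spec in E. }
  rewrite nth_error_app1, nth_error_map by exact H.
  unfold base_vars, model_vars; set (m := (2 * nvals Q)%nat).
  rewrite nth_error_app2 by exact HX.
  change (length clock_vars) with 20%nat.
  destruct (le_lt_dec (4 * m) (X - 20)) as [H'|H'].
  - rewrite nth_error_app2 by (rewrite length_registers_vars; exact H').
    destruct (nth_error _ _) as [v|] eqn:E; [|discriminate]; intros Ew; left.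
    apply nth_error_In, repeat_spec in E; subst v; now injection Ew as <-.
  - rewrite nth_error_app1 by (rewrite length_registers_vars; exact H').
    set (i := ((X - 20) mod 4)%nat); set (j := ((X - 20) / 4)%nat).
    assert (Hi : (i < 4)%nat) by (apply Nat.mod_upper_bound; lia).
    assert (Eij : (X - 20 = i + 4 * j)%nat)
      by (pose proof (Nat.div_mod_eq (X - 20) 4); unfold i, j; lia).
    assert (Hj : (j < m)%nat) by lia.
    rewrite Eij, nth_registers_vars by assumption.
    destruct i as [|[|[|[|i]]]]; [| | | |lia]; simpl; intros Ew; injection Ew as <-;
      [right; exists j; split; [exact Hj | split; [lia | reflexivity]] | now left..].
Qed.

Lemma D_in_restrict (f f' : R -> R) (D : R -> Prop) (t : R) :
  is_derive f t (f' t) -> D_in f f' D t.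
Proof.
  intros H; apply is_derive_Reals, derivable_pt_lim_D_in in H.
  intros eps Heps; destruct (H eps Heps) as (d & Hd & Hlim).
  exists d; split; [exact Hd|]; intros u [[_ Hu] Hdist]; apply Hlim.
  split; [split; [exact I | exact Hu] | exact Hdist].
Qed.

Lemma continue_in_restrict (f : R -> R) (D : R -> Prop) (t : R) :
  continuous f t -> continue_in f D t.
Proof.
  intros H; apply continuity_pt_filterlim in H.
  intros eps Heps; destruct (H eps Heps) as (d & Hd & Hlim).
  exists d; split; [exact Hd|]; intros u [[_ Hu] Hdist]; apply Hlim.
  split; [split; [exact I | exact Hu] | exact Hdist].
Qed.

Lemma never_prints_infinite_behavior (Q : cmd) (a : tree) :
  (forall i, ~ prints_nonnil (run Q a i)) ->
  exists beh, infinite_behavior (machine_input Q a) beh.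
Proof.
  intros Hp.
  destruct (machine_form_complete Q a Hp) as (z & z0 & zS).
  set (m := (2 * nvals Q)%nat).
  assert (HB : length (base_vars Q) =
    (length (goal_nodes (goals m (poly_of (machine_form Q)))) + (20 + 4 * m))%nat)
    by apply length_model_vars.
  destruct (literal_complete a
    (fun i => if Nat.eqb i 1 then 1 else if Nat.eqb i 19 then INR (code a) else 0)
    19 (length (base_vars Q))) as (rho & Hrho & Hlit); try reflexivity; try lia.
  set (f := witness (INR (code a)) z m
    (goal_nodes (goals m (poly_of (machine_form Q)))) rho).
  set (M := input_model (machine_input Q a)).
  set (v := fun _ : nat => Finite 0).
  set (x := fun i => fst (f i)); set (dx := fun i => snd (f i)).
  set (q := qstate f (qspaces M) 0).
  assert (Hsp : forall s, In s (qspaces M) -> s = signed_space \/ s = free_space)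
    by apply machine_input_spaces.
  assert (Hnice : forall i, nice (f i)) by apply witness_nice.
  assert (Hstate : forall t, state_at M v x dx (Finite t) (q t)).
  { intros t; split; [now apply qstate_wf|].
    intros X w Hw; unfold q in Hw; rewrite qstate_nth, Nat.add_0_r in Hw.
    destruct (nth_error (qspaces M) X) as [s|] eqn:Es; [|discriminate].
    injection Hw as <-; exists (x X t), (dx X t).
    split; [reflexivity|]; split; [reflexivity|]; split; [|apply dirof_holds].
    apply qmag_of_correct, Hsp; now apply nth_error_In in Es. }
  assert (Hsol : is_solution (machine_input Q a) p_infty v x dx).
  { split.
    - intros s Hs; apply Hsp in Hs as [-> | ->]; simpl;
        repeat constructor.
    - intros c Hc; apply machine_input_constraints in Hc as [Hc | Hc].
      + destruct Hc as [-> | [-> | [-> | (j & _ & [-> | ->])]]]; exact I.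
      + destruct c as [X Y Z [|]|X Y Z [|]| |]; cbn [algebraic] in Hc;
          try contradiction; intros ? ? ? [].
    - intros X t _ _; destruct (Hnice X t) as (Hd & Hc & _).
      split; [now apply D_in_restrict | now apply continue_in_restrict].
    - intros t c [Ht _] Hc; apply (witness_constraints Q a z rho); auto.
      repeat split; now rewrite Hrho by lia.
    - intros t X s _ Hs; exists (qmag_of s (x X t)); apply qmag_of_correct, Hsp.
      now apply nth_error_In in Hs.
    - split; [apply wf_machine_input|]; intros X w Hw.
      exists (x X 0), (dx X 0); split; [reflexivity|]; split; [reflexivity|].
      destruct (le_lt_dec 20 X) as [HX|HX].
      + split.
        * apply initial_state_tail in Hw as [-> | (j & Hj & -> & ->)]; [simpl; auto| |exact HX].
          simpl fst; unfold x, f; cbn [qmag_holds lval]; f_equal.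
          pose proof PI_RGT_0.
          destruct (witness_x Q a z rho z0 0 j 0 Hj) as [E _]; [simpl; lra|].
          etransitivity; [exact E | apply z0].
        * replace (snd w) with Std; [now apply (witness_start Q a z rho)|].
          now apply initial_state_tail in Hw as [-> | (j & _ & _ & ->)].
      + assert (Ef : f X = base_fun (INR (code a)) z X)
          by (apply witness_base; lia).
        unfold x, dx; rewrite Ef; revert Hw; clear - HX.
        do 20 (destruct X as [|X];
          [intros Hw; injection Hw as <-; cbn [base_fun clock_funs nth Nat.ltb Nat.leb fst snd];
           rewrite ?sin_0, ?cos_0, ?Ropp_0; unfold half_power;
           rewrite ?sqrt_0; simpl; repeat split; try lra|]).
        lia. }
  destruct (cut_into_phases q) as (T & beh & HT0 & Hlim & HT & He & Ho & Hch).
  - now apply qstate_germ.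
  (* The state never becomes constant because the direction of the sine keeps alternating: the
     cosine is 1 and -1 at the even and odd multiples of PI. *)
  - intros t; pose proof PI_RGT_0.
    assert (H2 : forall u, nth_error (q u) 2 = Some (qmag_of signed_space (sin u), dirof (cos u))).
    { intros u; unfold q; rewrite qstate_nth; reflexivity. }
    destruct (INR_unbounded (Rabs t)) as [n Hn].
    assert (Hnt : t < 2 * INR n * PI).
    { pose proof PI2_1; pose proof (Rabs_pos t); pose proof (Rle_abs t); nra. }
    exists (0 + 2 * INR n * PI), (PI + 2 * INR n * PI).
    split; [lra|]; split; [lra|]; intros E.
    apply (f_equal (fun s => nth_error s 2)) in E; rewrite !H2 in E.
    injection E as _ E; rewrite !cos_period, cos_0, cos_PI in E.
    rewrite (dirof_unique Inc 1), (dirof_unique Dec (-1)) in E by (simpl; lra); discriminate.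
  - exists beh, v, x, dx, T.
    split; [exact HT0|]; split; [exact Hlim|]; split; [exact Hsol|]; split.
    + intros k; split; [apply HT|]; split.
      * rewrite He; apply Hstate.
      * intros t H1 H2; rewrite <- (Ho k t) by (split; assumption); apply Hstate.
    + exact Hch.
Qed.

(** * The diagonal argument *)

(** A trajectory that ends at a finite time would be at a first or last landmark, but these are
    infinite. Every other trajectory, with finitely or infinitely many changes, is a solution on the
    whole half-line and forces the run never to print. *)
Lemma prints_empty_tree (Q : cmd) (a : tree) (i : nat) :
  prints_nonnil (run Q a i) -> empty_tree (machine_input Q a).
Proof.
  intros Hp p (beh & k & _ & [(n & H & _) | H]).
  - destruct H as (v & x & dx & T & Hn & _ & Hsol & Hph & _ & _ & Hleave).
    destruct n as [|n]; [lia|]; specialize (Hph n (Nat.lt_succ_diag_r n)).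
    destruct (T (S n)) as [b| |] eqn:E.
    + destruct (Hleave b eq_refl) as (X & q & l & Hq & Hl & Hfl).
      apply nth_error_In, machine_input_spaces in Hq.
      assert (Hinf : l = MinusInf \/ l = PlusInf).
      { destruct Hfl as [[Hf _] | [Hf _]]; destruct Hf as [r Hr].
        - left; destruct Hq as [-> | ->]; now injection Hr.
        - right; destruct Hq as [-> | ->]; cbn [landmarks signed_space free_space] in Hr.
          + change [MinusInf; Zero; PlusInf] with ([MinusInf; Zero] ++ [PlusInf]) in Hr.
            now apply app_inj_tail in Hr.
          + change [MinusInf; PlusInf] with ([MinusInf] ++ [PlusInf]) in Hr.
            now apply app_inj_tail in Hr. }
      destruct Hinf as [-> | ->]; discriminate.
    + now apply (solution_never_prints Q a v x dx Hsol i).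
    + destruct Hph as [Hlt _]; rewrite E in Hlt; now destruct (T n).
  - destruct H as (v & x & dx & T & _ & _ & Hsol & _).
    now apply (solution_never_prints Q a v x dx Hsol i).
Qed.

(** Its prefixes are nodes of unbounded length. *)
Lemma infinite_behavior_infinite_tree (I : input) (beh : nat -> state) :
  infinite_behavior I beh -> ~ finite_tree I.
Proof.
  intros H [L HL].
  set (node_of := fun k => map beh (List.seq 0 (S k))).
  assert (Hlen : forall k, In (S k) (map (@length state) L)).
  { intros k; apply in_map_iff; exists (node_of k); split.
    - unfold node_of; now rewrite length_map, length_seq.
    - apply HL; exists beh, k; split; [reflexivity | now right]. }
  pose proof (proj1 (list_max_le (map (@length state) L) _) (le_n _)) as F.
  rewrite Forall_forall in F.
  specialize (F _ (Hlen (list_max (map (@length state) L)))); simpl in F; lia.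
Qed.

Theorem theorem8 :
  ~ exists P : cmd, forall I : input, wf_input I -> meets_specification P I.
Proof.
  intros [P HP].
  (* The tree [a] is both the data of [Q] and the data loaded into the model. The prelude turns it
     into the code of [J], so [Q] on [a] acts as [P] on the code of [J]. *)
  set (Q := Seq prelude P); set (a := template (base_vars Q) (base_cons Q)).
  set (J := machine_input Q a).
  destruct (HP J (wf_machine_input Q a)) as (Hempty & _ & Hinf).
  pose proof (prints_nonnil_prelude P (base_vars Q) (base_cons Q)) as Hiff.
  cbv zeta in Hiff; fold Q in Hiff; fold a in Hiff.
  change (instance (base_vars Q) (base_cons Q) a) with J in Hiff.
  destruct (classic (exists i, prints_nonnil (run Q a i))) as [Hp | Hp].
  - assert (Hempty' : empty_tree J)
      by (destruct Hp as [i Hi]; now apply prints_empty_tree with i).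
    apply Hiff in Hp as (n & t & Ht & Hin).
    destruct (Hempty Hempty') as (n' & Htodo & Hout).
    (* After halting nothing more is printed, so the report [Nil] is the whole output, at whatever
       time the other tree was supposed to appear. *)
    assert (Hstop : forall k, run P (enc_input J) (k + n') = run P (enc_input J) n').
    { induction k as [|k IH]; [reflexivity|].
      simpl Nat.add; rewrite run_S, IH; unfold step; now rewrite Htodo. }
    apply (printed_mono P (enc_input J) n (n + n')) in Hin; [|lia].
    rewrite Hstop, Hout in Hin; destruct Hin as [<- | []]; now apply Ht.
  - destruct (never_prints_infinite_behavior Q a) as [beh Hbeh].
    { intros i Hi; apply Hp; now exists i. }
    destruct (Hinf (infinite_behavior_infinite_tree _ _ Hbeh))
      as (o & _ & _ & Ho & _ & _ & Hprint).
    (* An infinite tree obliges [P] to print the root. It is a nonempty list, so its code is not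
       [Nil] and [Q] prints after all. *)
    apply Hp, Hiff; destruct (Hprint 1%nat) as [n Hn].
    exists n, (enc_node (o 0%nat)); split.
    + rewrite Ho; discriminate.
    + rewrite Hn; now left.
Qed.
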